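(* Let $b\in C^1(\mathbb{R}^d;\mathbb{R}^d)$ with $b$ and $\nabla b$ bounded, and let $K:\mathbb{R}^d\to\mathbb{R}^d$ be bounded and Lipschitz continuous. Let $(X^i,V^i)_{i=1}^N$ be the solution of the Hamiltonian-type particle system and $(\tilde X^i,U^i)_{i=1}^N$ the corresponding RBM-1 process with batch size $p$ and time step $\tau$ described in the context, sharing the same initial data $X^i(0)=\tilde X^i(0)=X_0^i$, $V^i(0)=U^i(0)=V_0^i$, where $(X_0^i,V_0^i)$, $i=1,\dots,N$, are i.i.d. samples from some common distribution. Then for every $T>0$ there is $C(T)>0$, independent of $N$ and $\tau$, such that for all $i\in\{1,\dots,N\}$ $$\sup_{0\le t\le T}\Big(\mathbb{E}\frac1N\sum_{j=1}^N\big(|X^j(t)-\tilde X^j(t)|^2+|V^j(t)-U^j(t)|^2\big)\Big)^{1/2}=\sup_{0\le t\le T}\Big(\mathbb{E}\big(|X^i(t)-\tilde X^i(t)|^2+|V^i(t)-U^i(t)|^2\big)\Big)^{1/2}\le C(T)\sqrt{\frac{\tau}{p-1}}.$$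
   Context: Setting. Let $p\ge2$, $n\ge1$ be integers, $N=np$, $\tau>0$, $t_m=m\tau$. For each $m\ge1$ let $\xi_{m-1}$ be a uniformly random division of $\{1,\dots,N\}$ into $n$ batches of size $p$; the divisions $\xi_0,\xi_1,\dots$ are independent of each other and of the initial data. Particle system: for $i=1,\dots,N$, $$\dot X^i=V^i,\qquad \dot V^i=b(X^i)+\frac1{N-1}\sum_{j\ne i}K(X^i-X^j).$$ RBM-1 process: $(\tilde X^i,U^i)$ is continuous in time and for $t\in[t_{m-1},t_m)$, with $\mathcal C$ the batch of $\xi_{m-1}$ containing $i$, $$\dot{\tilde X}^i=U^i,\qquad \dot U^i=b(\tilde X^i)+\frac1{p-1}\sum_{j\in\mathcal C,\,j\ne i}K(\tilde X^i-\tilde X^j).$$ *)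

(* Defs.v *)
From HB Require Import structures.
From mathcomp Require Import all_boot all_order all_algebra.
From mathcomp Require Import all_classical all_reals all_analysis.

Set Implicit Arguments.
Unset Strict Implicit.
Unset Printing Implicit Defensive.

Import Order.TTheory GRing.Theory Num.Theory.
Import numFieldNormedType.Exports.

Local Open Scope classical_set_scope.
Local Open Scope ring_scope.

(* The library norm on 'rV[R]_d is the sup norm.  It is used below only for
   qualitative notions (limits, boundedness, Lipschitz continuity), which do not
   depend on the choice of a norm; the quantities to be estimated use the
   Euclidean norm. *)
Definition sqnorm (R : realType) (d : nat) (x : 'rV[R]_d) : R :=
  \sum_(k < d) x 0 k ^+ 2.

Definition C1 (R : realType) (d : nat) (b : 'rV[R]_d -> 'rV[R]_d) : Prop :=
  (forall x, differentiable b x) /\ continuous (jacobian b).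

(* Derivative relative to A: one-sided at an endpoint of an interval A, the
   usual derivative at an interior point. *)
Definition is_deriv_within (R : realType) (d : nat) (A : set R)
    (f : R -> 'rV[R]_d) (t : R) (l : 'rV[R]_d) : Prop :=
  (s - t)^-1 *: (f s - f t) @[s --> within A t^'] --> l.

Section Dynamics.
Context (R : realType) (d : nat) (b K : 'rV[R]_d -> 'rV[R]_d).

Definition particle_system (N : nat) (X V : 'I_N -> R -> 'rV[R]_d) : Prop :=
  forall (i : 'I_N) (t : R), 0 <= t ->
    is_deriv_within `[0, +oo[ (X i) t (V i t) /\
    is_deriv_within `[0, +oo[ (V i) t
      (b (X i t) + (N%:R - 1)^-1 *: \sum_(j < N | j != i) K (X i t - X j t)).

(* xi m is the division in force on [m * tau, (m + 1) * tau[; pblock (xi m) i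
   is the batch of xi m containing i. *)
Definition rbm1 (N p : nat) (tau : R) (xi : nat -> {set {set 'I_N}})
    (X U : 'I_N -> R -> 'rV[R]_d) : Prop :=
  (forall i : 'I_N, {within `[0, +oo[, continuous (X i)} /\
                    {within `[0, +oo[, continuous (U i)}) /\
  (forall (m : nat) (i : 'I_N) (t : R),
    let I := `[m%:R * tau, m.+1%:R * tau[%classic in
    t \in I ->
    is_deriv_within I (X i) t (U i t) /\
    is_deriv_within I (U i) t
      (b (X i t) + (p%:R - 1)^-1 *:
         \sum_(j in finset.pblock (xi m) i | j != i) K (X i t - X j t))).

End Dynamics.

Definition divisions (n p : nat) : {set {set {set 'I_(n * p)}}} :=
  [set D | [&& finset.partition D [set: 'I_(n * p)],
               #|D| == n & [forall C in D, #|C| == p]]]%SET.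

(* One-particle state space (positions, velocities) with its Borel sets. *)
Definition phase (R : realType) (d : nat) :=
  g_sigma_algebraType (@open ('rV[R]_d * 'rV[R]_d)%type).

Section Randomness.
Context (R : realType) (disp : measure_display) (Omega : measurableType disp)
        (P : probability Omega R).

Definition uniform_division (n p : nat)
    (xi : Omega -> {set {set 'I_(n * p)}}) : Prop :=
  forall D, measurable (xi @^-1` [set D]) /\
    P (xi @^-1` [set D]) =
      ((D \in divisions n p)%:R / #|divisions n p|%:R)%:E.

Definition mutually_independent (I : eqType) (F : I -> set (set Omega)) :=
  forall (J : seq I) (A : I -> set Omega), uniq J ->
    (forall k, k \in J -> F k (A k)) ->
    P (\bigcap_(k in [set` J]) A k) = (\prod_(k <- J) P (A k))%E.

(* The index inl i stands for the initial state of particle i and inr m for the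
   division xi m; each is given with the events it generates. *)
Definition generated_events (d N : nat) (Z0 : 'I_N -> Omega -> phase R d)
    (xi : nat -> Omega -> {set {set 'I_N}}) (k : 'I_N + nat)
    : set (set Omega) :=
  match k with
  | inl i => [set Z0 i @^-1` B | B in measurable]
  | inr m => [set xi m @^-1` D | D in setT]
  end.

End Randomness.

(* Main.v *)
Require Import Defs.
From HB Require Import structures.
From mathcomp Require Import all_boot all_order all_algebra.
From mathcomp Require Import all_classical all_reals all_analysis.
From mathcomp Require Import perm measurable_realfun ring lra.
Set Implicit Arguments.
Unset Strict Implicit.
Unset Printing Implicit Defensive.
Import Order.TTheory GRing.Theory Num.Theory.
Import numFieldNormedType.Exports.
Local Open Scope classical_set_scope.
Local Open Scope ring_scope.

(** Write W = V - U.  Its derivative is a Lipschitz function of the gap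
    minus the noise chi_m(X(t)), where chi_m(x) is the batch average minus the
    full average of K along the configuration x.  The noise is evaluated along
    the full system X, not along the batch process: X depends on the initial
    data only, hence is independent of all the divisions.  So the total
    noise M(t), the integral of chi_m(X), is a sum over the time steps of
    pairwise uncorrelated terms, each with second moment at most
    (C tau)^2 / (p - 1), and E |M(t)|^2 <= C tau t / (p - 1).  A Gronwall
    estimate for X - Xt and W + M, applied pathwise on a fine grid of times
    (which replaces Fubini's theorem), gives the bound.

    Solutions are given only for the data attached to the points of Omega, and
    nothing is assumed on how they depend on the point.  Measurability, independence of the
    divisions, and exchangeability of the particles are therefore obtained by
    cutting the initial data into small cells: by uniform stability, two points
    of Omega whose data lie in the same cell have nearby trajectories, and the
    law of the cells is a product. *)

(** * Right derivatives *)

Section RightDerivative.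
Context (R : realType).
Implicit Types (f g : R -> R) (t l : R).

(** The batch force jumps at every multiple of [tau], so only right derivatives exist there. A
    continuous function with nonpositive right derivatives is still nonincreasing, and the growth
    estimates need no more calculus than this. The constant does not depend on the number of
    particles because the interaction weights are nonnegative with row and column sums at most 1,
    both for the full system and for every genuine division. Values of [xi] are genuine divisions
    only almost surely. Off that event only bounds depending on [N] hold: they suffice for
    measurability and exchangeability, which are qualitative, while the quantitative estimate is
    made on the event [good]. The rate 1 / (p - 1) is the variance of an average sampled without
    replacement: once the forces on a particle are centred, the cross terms of the square add up to
    a nonpositive quantity. The noise is Lipschitz in time with a deterministic constant, so the
    error of the time grid is made smaller than tau / (p - 1) by refining the mesh. *)

Definition rder f t l := (s - t)^-1 * (f s - f t) @[s --> t^'+] --> l.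

Lemma rder_cst c t : rder (fun=> c) t 0.
Proof.
rewrite /rder; under eq_fun do rewrite subrr mulr0.
exact: cvg_cst.
Qed.

Lemma rder_id t : rder id t 1.
Proof.
rewrite /rder; have : (fun=> 1 : R) @ t^'+ --> (1 : R) by exact: cvg_cst.
apply: cvg_trans; apply: near_eq_cvg.
near=> s; rewrite mulVf// subr_eq0.
by rewrite gt_eqF//; near: s; exact: nbhs_right_gt.
Unshelve. all: by end_near. Qed.

Lemma rderD f g t l l' : rder f t l -> rder g t l' ->
  rder (fun s => f s + g s) t (l + l').
Proof.
move=> df dg; rewrite /rder.
under eq_fun do rewrite opprD addrACA mulrDr.
exact: cvgD.
Qed.

Lemma rderZ c f t l : rder f t l -> rder (fun s => c * f s) t (c * l).
Proof.
move=> df; rewrite /rder; under eq_fun do rewrite -mulrBr mulrCA.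
exact: cvgMr.
Qed.

Lemma rderB f g t l l' : rder f t l -> rder g t l' ->
  rder (fun s => f s - g s) t (l - l').
Proof.
move=> df dg; have := rderD df (@rderZ (-1) _ _ _ dg).
by rewrite mulN1r; under [fun s => _ + _]eq_fun do rewrite mulN1r.
Qed.

Lemma rder_sum (I : Type) (r : seq I) (P : pred I) (F : I -> R -> R)
    (L : I -> R) t : (forall i, P i -> rder (F i) t (L i)) ->
  rder (fun s => \sum_(i <- r | P i) F i s) t (\sum_(i <- r | P i) L i).
Proof.
move=> dF; elim: r => [|i r ih].
  rewrite big_nil; under [fun s => _]eq_fun do rewrite big_nil.
  exact: rder_cst.
rewrite big_cons; under [fun s => _]eq_fun do rewrite big_cons.
by case: ifPn => // Pi; apply: rderD => //; exact: dF.
Qed.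

Lemma rder_cvg f t l : rder f t l -> f s @[s --> t^'+] --> f t.
Proof.
move=> df; have : (s - t) * ((s - t)^-1 * (f s - f t)) + f t @[s --> t^'+]
    --> 0 * l + f t.
  apply: cvgD; last exact: cvg_cst.
  apply: cvgM => //; apply: cvg_at_right_filter.
  by rewrite -[X in _ --> X](subrr t); apply: cvgB; [exact: cvg_id|exact: cvg_cst].
rewrite mul0r add0r; apply: cvg_trans; apply: near_eq_cvg.
near=> s; rewrite mulrA divff ?mul1r ?subrK//.
rewrite subr_eq0 gt_eqF//; near: s; exact: nbhs_right_gt.
Unshelve. all: by end_near. Qed.

Lemma rderM f g t l l' : rder f t l -> rder g t l' ->
  rder (fun s => f s * g s) t (l * g t + f t * l').
Proof.
move=> df dg; rewrite /rder.
have -> : (fun s => (s - t)^-1 * (f s * g s - f t * g t)) =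
    (fun s => ((s - t)^-1 * (f s - f t)) * g t
              + f s * ((s - t)^-1 * (g s - g t))).
  by apply/funext => s; ring.
apply: cvgD; first exact: cvgMl.
by apply: cvgM => //; exact: rder_cvg df.
Qed.

Lemma rder_near f g t l : f t = g t -> (\forall s \near t^'+, f s = g s) ->
  rder g t l -> rder f t l.
Proof.
move=> ft fg; rewrite /rder; apply: cvg_trans; apply: near_eq_cvg.
by near=> s; rewrite ft; congr (_ * (_ - _)); near: s; apply: filterS fg.
Unshelve. all: by end_near. Qed.

Lemma is_derive_rder f t l : is_derive t (1 : R) f l -> rder f t l.
Proof.
move=> [df <-]; have : h^-1 *: (f (h *: (1 : R) + t) - f t) @[h --> 0^']
  --> 'D_1 f t by exact: df.
move=> /cvg_dnbhs_at_right /cvgrPdist_lt H.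
apply/cvgrPdist_lt => e e0; have /nbhs_ballP[d /= d0 hd] := H _ e0.
apply/nbhs_ballP; exists d => //= s ts lts.
have := hd (s - t); rewrite /ball/= sub0r normrN distrC [_ *: 1]mulr1 subrK subr_gt0.
by apply.
Qed.

Lemma rder_within A f t l e : 0 < e -> (forall s, t <= s < t + e -> A s) ->
  (s - t)^-1 * (f s - f t) @[s --> within A t^'] --> l -> rder f t l.
Proof.
move=> e0 hA; apply: cvg_trans; apply: cvg_app.
move=> B /nbhs_ballP[d /= d0 hd].
apply/nbhs_ballP; exists (Num.min d e); first by rewrite /= lt_min d0 e0.
move=> s; rewrite /ball/= lt_min => /andP[sd se] ts.
apply: hd => //; first by rewrite gt_eqF.
apply: hA; rewrite ltW//= -ltrBlDl.
by move: se; rewrite distrC gtr0_norm// subr_gt0.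
Qed.

(** Continuity on the closed half-line, encoded as continuity on the whole line of the extension of
    [f] that is constant on negative times; the usual rules for continuous functions then apply
    without subspace topologies. *)
Definition cont0 f := continuous (fun t => f (Num.max 0 t)).

Lemma continuous_max0 : continuous (Num.max 0 : R -> R).
Proof.
move=> t; apply/cvgrPdist_lt => e e0; apply/nbhs_ballP; exists e => //= s.
rewrite /ball/=; apply: le_lt_trans.
rewrite /Order.max/=; do 2 case: ifP => ?; rewrite ?subrr ?normr0//;
  rewrite ler_norml; have := ler_norm (t - s); have := lerNnormlW (lexx (`|t - s|));
  lra.
Qed.

Lemma cont0_within f :
  (forall t, 0 <= t -> f s @[s --> within `[0, +oo[ (nbhs t)] --> f t) -> cont0 f.
Proof.
move=> cf t; have /cf : 0 <= Num.max 0 t by rewrite le_max lexx.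
apply: cvg_comp => B /continuous_max0; rewrite nbhs_simpl /=.
by apply: filterS => s; apply; rewrite /= in_itv/= andbT le_max lexx.
Qed.

Lemma continuous_cont0 f : continuous f -> cont0 f.
Proof. by move=> cf t; apply: continuous_comp; [exact: continuous_max0|exact: cf]. Qed.

(** Continuous induction: for a slightly tilted function, the supremum [c] of the times at which it
    stays below its initial value is such a time by continuity, and if [c < b] the right derivative
    at [c] yields a later one. *)
Lemma rder_nonincreasing f a b : 0 <= a -> a <= b -> cont0 f ->
  (forall t, a <= t -> t < b -> exists2 l, l <= 0 & rder f t l) -> f b <= f a.
Proof.
move=> a0 ab cf df.
apply/ler_addgt0Pr => e e0.
(* The tilt makes the slope strictly negative; dividing by [b - a + 1] keeps its total over the
   interval at most [e], also when [a = b]. *)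
pose g t := f (Num.max 0 t) - e / (b - a + 1) * (t - a).
have ba0 : 0 < b - a + 1 by rewrite ltr_wpDl// subr_ge0.
have k0 : 0 < e / (b - a + 1) by rewrite divr_gt0.
have cg : continuous g.
  move=> t; apply: cvgB; first exact: cf.
  apply: cvgMr; apply: cvgB; [exact: cvg_id|exact: cvg_cst].
pose S := [set t | a <= t <= b /\ g t <= f a].
have Sa : S a by split; rewrite ?lexx//= /g subrr mulr0 subr0 max_r.
have hS : has_sup S by split; [exists a|exists b => t [/andP[]]].
pose c := sup S.
have ac : a <= c by apply: ub_le_sup => //; exact: hS.2.
have cb : c <= b by apply: ge_sup; [exists a|move=> t [/andP[]]].
have gc : g c <= f a.
  rewrite leNgt; apply/negP => gca.
  have [d d0 hd] : exists2 d, 0 < d & forall t, `|c - t| < d -> f a < g t.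
    have /cvgrPdist_lt/(_ (g c - f a)) := cg c.
    rewrite subr_gt0 => /(_ gca)/nbhs_ballP[d d0 hd]; exists d => // t ct.
    have := hd t ct; rewrite /= => /ltr_normlP[_]; lra.
  have [t [/andP[at_ tb] gt] ct] := sup_adherent d0 hS.
  have tc : t <= c by apply: ub_le_sup; [exact: hS.2|split => //; apply/andP].
  have := hd t; rewrite ger0_norm ?subr_ge0// => H.
  have /H : c - t < d by rewrite -/c in ct; lra.
  by rewrite ltNge gt.
have [cltb|] := ltP c b; last first.
  move=> bc; have cE : c = b by apply/eqP; rewrite eq_le cb.
  move: gc; rewrite cE /g max_r ?(le_trans a0)// => gc.
  have : e / (b - a + 1) * (b - a) <= e.
    by rewrite mulrAC ler_pdivrMr// ler_wpM2l ?ltW//; lra.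
  lra.
have [l l0 dl] := df _ ac cltb.
have c0 : 0 <= c by exact: le_trans ac.
suff [s [/andP[cs sb] Hs]] : exists s, c < s <= b /\ (s - c)^-1 * (f s - f c) < e / (b - a + 1).
  have sc0 : 0 < s - c by rewrite subr_gt0.
  suff : S s by move=> Ss; have := ub_le_sup hS.2 Ss; rewrite -/c leNgt cs.
  split; first by rewrite sb andbT (le_trans ac)// ltW.
  move: gc; rewrite /g !max_r ?(le_trans c0 (ltW cs))// => gc.
  move: Hs; rewrite mulrC ltr_pdivrMr// => Hs; lra.
have /cvgrPdist_lt/(_ _ k0) H := dl.
near (c^'+) => s; exists s; split.
  by apply/andP; split; near: s; [exact: nbhs_right_gt|exact: nbhs_right_le].
have : `|l - (s - c)^-1 * (f s - f c)| < e / (b - a + 1) by near: s.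
move=> /ltr_normlP[]; lra.
Unshelve. all: by end_near. Qed.

End RightDerivative.

(** * Growth estimates *)

Section Growth.
Context (R : realType).
Implicit Types (f g : R -> R) (t l : R).

Lemma cont0_cst (c : R) : cont0 (fun=> c).
Proof. by move=> t; exact: cvg_cst. Qed.

Lemma cont0D f g : cont0 f -> cont0 g -> cont0 (fun t => f t + g t).
Proof. by move=> cf cg t; apply: cvgD; [exact: cf|exact: cg]. Qed.

Lemma cont0M f g : cont0 f -> cont0 g -> cont0 (fun t => f t * g t).
Proof. by move=> cf cg t; apply: cvgM; [exact: cf|exact: cg]. Qed.

Lemma cont0B f g : cont0 f -> cont0 g -> cont0 (fun t => f t - g t).
Proof. by move=> cf cg t; apply: cvgB; [exact: cf|exact: cg]. Qed.

Lemma cont0_sum (I : Type) (r : seq I) (P : pred I) (F : I -> R -> R) :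
  (forall i, P i -> cont0 (F i)) -> cont0 (fun t => \sum_(i <- r | P i) F i t).
Proof.
move=> cF t; apply: cvg_big => [|i Pi]; last exact: cF.
exact: add_continuous.
Qed.

Lemma rder_le f a b c : 0 <= a -> a <= b -> cont0 f ->
  (forall t, a <= t -> t < b -> exists2 l, l <= c & rder f t l) ->
  f b - f a <= c * (b - a).
Proof.
move=> a0 ab cf df.
have cid : cont0 (id : R -> R) by apply: continuous_cont0; move=> ?; exact: cvg_id.
suff h : f b - c * b <= f a - c * a by lra.
apply: (@rder_nonincreasing _ (fun t => f t - c * t)) => //.
  by apply: cont0B => //; apply: cont0M => //; exact: cont0_cst.
move=> t at_ tb; have [l lc dl] := df _ at_ tb.
exists (l - c * 1); first by rewrite mulr1 subr_le0.
by apply: rderB => //; apply: rderZ; exact: rder_id.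
Qed.

Lemma rder_lipschitz f a b c : 0 <= a -> a <= b -> cont0 f ->
  (forall t, a <= t -> t < b -> exists2 l, `|l| <= c & rder f t l) ->
  `|f b - f a| <= c * (b - a).
Proof.
move=> a0 ab cf df; rewrite ler_norml; apply/andP; split.
  rewrite lerNl.
  have := @rder_le (fun t => 0 - f t) a b c a0 ab.
  rewrite !sub0r -opprD; apply; first by apply: cont0B => //; exact: cont0_cst.
  move=> t at_ tb; have [l] := df _ at_ tb.
  rewrite ler_norml => /andP[lc _] dl; exists (0 - l); first by rewrite sub0r lerNl.
  by apply: rderB => //; exact: rder_cst.
apply: rder_le => // t at_ tb; have [l] := df _ at_ tb.
by rewrite ler_norml => /andP[_ lc] dl; exists l.
Qed.

(** With the integrating factor [e t = expR (- lam * (t - a))], the function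
    [e t * f t - c * (t - a)] has nonpositive right derivatives, since [e t <= 1] bounds [e t * c]
    by [c]. *)
Lemma gronwall f a b lam c : 0 <= a -> a <= b -> 0 <= lam -> 0 <= c -> cont0 f ->
  (forall t, a <= t -> t < b -> exists2 l, l <= lam * f t + c & rder f t l) ->
  f b <= expR (lam * (b - a)) * (f a + c * (b - a)).
Proof.
move=> a0 ab lam0 c0 cf df.
pose e t := expR (- lam * (t - a)).
have ce : continuous e.
  move=> t; apply: (@continuous_comp _ _ _ (fun t => - lam * (t - a)) expR).
    by apply: cvgMr; apply: cvgB; [exact: cvg_id|exact: cvg_cst].
  exact: continuous_expR.
have de t : rder e t (- lam * e t).
  apply: is_derive_rder; rewrite /e.
  have : is_derive t (1 : R) (fun t : R => - lam * (t - a)) (- lam).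
    have -> : (fun t : R => - lam * (t - a)) = - lam \*: (id - cst a) by [].
    by apply: is_derive_eq; rewrite subr0 [_ *: _]mulr1.
  move=> h; have := @is_derive1_comp _ expR (fun t : R => - lam * (t - a)) t _ _
    (is_derive_expR _) h.
  by rewrite mulrC.
have : e b * f b - c * (b - a) <= e a * f a - c * (a - a).
  apply: (@rder_nonincreasing _ (fun t => e t * f t - c * (t - a))) => //.
    apply: cont0B; first by apply: cont0M => //; exact: continuous_cont0.
    apply: continuous_cont0 => t.
    by apply: cvgMr; apply: cvgB; [exact: cvg_id|exact: cvg_cst].
  move=> t at_ tb; have [l lf dl] := df _ at_ tb.
  exists (- lam * e t * f t + e t * l - c * (1 - 0)); last first.
    apply: rderB; first exact: rderM.
    by apply: rderZ; apply: rderB; [exact: rder_id|exact: rder_cst].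
  have e0 : 0 < e t by exact: expR_gt0.
  have e1 : e t <= 1.
    by rewrite -[leRHS]expR0 ler_expR mulNr oppr_le0 mulr_ge0// subr_ge0.
  have : e t * l <= e t * (lam * f t + c) by rewrite ler_wpM2l// ltW.
  have : e t * c <= 1 * c by rewrite ler_wpM2r.
  lra.
rewrite {2}/e subrr mulr0 expR0 mul1r mulr0 subr0 lerBlDr => h.
have -> : expR (lam * (b - a)) = (e b)^-1 by rewrite /e mulNr expRN invrK.
by rewrite mulrC ler_pdivlMr ?expR_gt0// mulrC.
Qed.

(** Here [z] is a position gap, [y] a velocity gap freed of the noise, [mu] the noise. Bounding each
    of the products 2zy, 2z mu and 2y beta by a sum of squares gives the rate [2 + lam] and leaves
    the squares of [mu] as the only forcing. *)
Lemma energy_growth (I : finType) (z y mu : I -> R -> R) (lam c a b : R) :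
  0 <= a -> a <= b -> 0 <= lam -> 0 <= c ->
  (forall i, cont0 (z i)) -> (forall i, cont0 (y i)) ->
  (forall t, a <= t -> t < b ->
     (exists beta : I -> R,
     [/\ forall i, rder (z i) t (y i t + mu i t),
         forall i, rder (y i) t (beta i),
         \sum_i beta i ^+ 2 <= lam * \sum_i z i t ^+ 2 &
         \sum_i mu i t ^+ 2 <= c])) ->
  \sum_i (z i b ^+ 2 + y i b ^+ 2) <=
    expR ((2 + lam) * (b - a)) *
    (\sum_i (z i a ^+ 2 + y i a ^+ 2) + c * (b - a)).
Proof.
move=> a0 ab lam0 c0 cz cy dzy.
apply: (@gronwall (fun t => \sum_i (z i t ^+ 2 + y i t ^+ 2))) => //.
- by rewrite addr_ge0.
- by apply: cont0_sum => i _; apply: cont0D; exact: cont0M.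
move=> t at_ tb; have [beta [dz dy hb hm]] := dzy _ at_ tb.
exists (\sum_i ((y i t + mu i t) * z i t + z i t * (y i t + mu i t) +
   (beta i * y i t + y i t * beta i))); last first.
  by apply: rder_sum => i _; apply: rderD; exact: rderM.
have : \sum_i ((y i t + mu i t) * z i t + z i t * (y i t + mu i t) +
   (beta i * y i t + y i t * beta i)) <=
   \sum_i ((2 * z i t ^+ 2) + 2 * y i t ^+ 2 + (mu i t ^+ 2 + beta i ^+ 2)).
  apply: ler_sum => i _.
  have := sqr_ge0 (y i t - z i t); have := sqr_ge0 (mu i t - z i t).
  have := sqr_ge0 (y i t - beta i); rewrite !sqrrB !expr2; lra.
move/le_trans; apply; rewrite !big_split/= -!mulr_sumr.
have : 0 <= lam * \sum_i y i t ^+ 2.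
  by rewrite mulr_ge0// sumr_ge0// => i _; rewrite sqr_ge0.
lra.
Qed.

End Growth.

(** * Weighted Cauchy-Schwarz inequality and Lipschitz bound for the drift *)

Section Weights.
Context (R : realType).

(** Expand the nonnegative sum of the [A j * (a * q j - s) ^+ 2] and use that the weights add up to
    at most [a]; one factor [a] then cancels. *)
Lemma weighted_cauchy (J : finType) (a : R) (A q : J -> R) : 0 < a ->
  (forall j, 0 <= A j) -> \sum_j A j <= a ->
  (\sum_j A j * q j) ^+ 2 <= a * \sum_j A j * q j ^+ 2.
Proof.
move=> a0 A0 Aa; set s := \sum_j A j * q j.
have : 0 <= \sum_j A j * (a * q j - s) ^+ 2.
  by apply: sumr_ge0 => j _; rewrite mulr_ge0// sqr_ge0.
have -> : \sum_j A j * (a * q j - s) ^+ 2 =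
    a ^+ 2 * (\sum_j A j * q j ^+ 2) - 2 * a * s * s + s ^+ 2 * \sum_j A j.
  rewrite (eq_bigr (fun j => a ^+ 2 * (A j * q j ^+ 2) - 2 * a * s * (A j * q j)
    + s ^+ 2 * A j)); last by move=> j _; ring.
  by rewrite big_split/= sumrB -!mulr_sumr.
move=> h; have : s ^+ 2 * \sum_j A j <= s ^+ 2 * a by rewrite ler_wpM2l// sqr_ge0.
move=> h2; have : a * s ^+ 2 <= a * (a * \sum_j A j * q j ^+ 2) by lra.
by rewrite ler_pM2l.
Qed.

Lemma sqrD_le (x y : R) : (x + y) ^+ 2 <= 2 * x ^+ 2 + 2 * y ^+ 2.
Proof. have := sqr_ge0 (x - y); rewrite sqrrB sqrrD; lra. Qed.

Context (d : nat).
Implicit Types x y : 'rV[R]_d.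

Lemma sqnorm_ge0 x : 0 <= sqnorm x.
Proof. by apply: sumr_ge0 => k _; rewrite sqr_ge0. Qed.

Lemma sqnormB_le x y : sqnorm (x - y) <= 2 * sqnorm x + 2 * sqnorm y.
Proof.
rewrite /sqnorm !mulr_sumr -big_split/=; apply: ler_sum => k _.
by rewrite !mxE (le_trans (sqrD_le _ _))// sqrrN.
Qed.

Definition sqlipschitz (L : R) (f : 'rV[R]_d -> 'rV[R]_d) :=
  forall x y, sqnorm (f x - f y) <= L * sqnorm (x - y).

(** The force of [j] on [i] changes with both gaps [z i] and [z j]: row sums absorb the former,
    column sums the latter, so no factor counting the particles appears. The 8 is a 2 from splitting
    off [b], a 2 from splitting a difference of positions, and a 2 from adding the two sums. *)
Lemma drift_lipschitz (I : finType) (b K : 'rV[R]_d -> 'rV[R]_d) (Lb LK a : R)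
    (A : I -> I -> R) (x y : I -> 'rV[R]_d) :
  sqlipschitz Lb b -> sqlipschitz LK K -> 0 <= LK -> 0 < a ->
  (forall i j, 0 <= A i j) -> (forall i, \sum_j A i j <= a) ->
  (forall j, \sum_i A i j <= a) ->
  \sum_i \sum_k (b (x i) 0 k - b (y i) 0 k +
     \sum_j A i j * (K (x i - x j) 0 k - K (y i - y j) 0 k)) ^+ 2
  <= (2 * Lb + 8 * a ^+ 2 * LK) * \sum_i sqnorm (x i - y i).
Proof.
move=> hb hK LK0 a0 A0 Ar Ac.
pose z i := sqnorm (x i - y i).
have z0 i : 0 <= z i by exact: sqnorm_ge0.
have h1 i : \sum_k (b (x i) 0 k - b (y i) 0 k +
     \sum_j A i j * (K (x i - x j) 0 k - K (y i - y j) 0 k)) ^+ 2 <=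
   2 * (Lb * z i) + 2 * (a * \sum_j A i j * (LK * (2 * z i + 2 * z j))).
  apply: (@le_trans _ _ (\sum_k (2 * (b (x i) - b (y i)) 0 k ^+ 2 +
    2 * (a * \sum_j A i j * (K (x i - x j) - K (y i - y j)) 0 k ^+ 2)))).
    apply: ler_sum => k _; rewrite (le_trans (sqrD_le _ _))//.
    rewrite !mxE lerD2l ler_wpM2l// (le_trans (weighted_cauchy _ a0 (A0 i) (Ar i)))//.
    rewrite ler_wpM2l ?(ltW a0)//; apply: ler_sum => j _.
    by rewrite !mxE.
  rewrite big_split/= -!mulr_sumr; apply: lerD; first by rewrite ler_wpM2l//; exact: hb.
  rewrite ler_wpM2l// ler_wpM2l ?(ltW a0)// exchange_big/=.
  apply: ler_sum => j _; rewrite -mulr_sumr ler_wpM2l//.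
  apply: (le_trans (hK _ _)); rewrite ler_wpM2l//.
  have -> : x i - x j - (y i - y j) = (x i - y i) - (x j - y j).
    by apply/rowP => k; rewrite !mxE; ring.
  exact: sqnormB_le.
apply: le_trans (ler_sum _ (fun i _ => h1 i)) _.
rewrite -[\sum_i sqnorm _]/(\sum_i z i) big_split/= -!mulr_sumr.
clearbody z.
rewrite [leRHS]mulrDl -[2 * Lb * _]mulrA lerD2l.
have -> : \sum_i \sum_j A i j * (LK * (2 * z i + 2 * z j)) =
    2 * LK * (\sum_i \sum_j A i j * z i) + 2 * LK * (\sum_j \sum_i A i j * z j).
  rewrite [X in _ + _ * X]exchange_big/= !mulr_sumr -big_split/=.
  apply: eq_bigr => i _; rewrite !mulr_sumr -big_split/=.
  by apply: eq_bigr => j _; ring.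
have r1 : \sum_i \sum_j A i j * z i <= a * \sum_i z i.
  rewrite mulr_sumr; apply: ler_sum => i _.
  by rewrite -mulr_suml ler_wpM2r.
have r2 : \sum_j \sum_i A i j * z j <= a * \sum_i z i.
  rewrite mulr_sumr; apply: ler_sum => i _.
  by rewrite -mulr_suml ler_wpM2r.
have c0 : 0 <= 2 * LK by rewrite mulr_ge0.
have s1 := ler_wpM2l c0 r1; have s2 := ler_wpM2l c0 r2.
have a2 : 0 <= 2 * a by rewrite mulr_ge0// ltW.
rewrite mulrA (_ : 8 * _ * _ * _ = 2 * a * (2 * LK * (a * \sum_i z i) + 2 * LK * (a * \sum_i z i))).
  by rewrite ler_wpM2l// lerD.
ring.
Qed.

End Weights.

(** * Weighted interaction systems *)

Section WeightedSystem.
Context (R : realType) (d : nat) (b K : 'rV[R]_d -> 'rV[R]_d) (tau : R).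
Hypothesis tau_gt0 : 0 < tau.

(* On [m tau, (m + 1) tau[ particle i feels particle j with weight A m i j: the
   full system and the random batch process are both of this form. *)
Definition weighted_system (I : finType) (A : nat -> I -> I -> R)
    (x v : I -> R -> 'rV[R]_d) : Prop :=
  (forall i k, cont0 (fun t => x i t 0 k) /\ cont0 (fun t => v i t 0 k)) /\
  (forall m i k t, m%:R * tau <= t -> t < m.+1%:R * tau ->
    rder (fun s => x i s 0 k) t (v i t 0 k) /\
    rder (fun s => v i s 0 k) t
      (b (x i t) 0 k + \sum_j A m i j * K (x i t - x j t) 0 k)).

Lemma time_step t : 0 <= t ->
  exists m : nat, m%:R * tau <= t /\ t < m.+1%:R * tau.
Proof.
move=> t0; exists (Num.truncn (t / tau)).
have : 0 <= t / tau by rewrite divr_ge0// ltW.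
by move=> /truncn_itv/andP[]; rewrite ler_pdivlMr// ltr_pdivrMr.
Qed.

Lemma weighted_system_relabel (I : finType) (A : nat -> I -> I -> R) x v
    (s : I -> I) : bijective s -> weighted_system A x v ->
  weighted_system (fun m i j => A m (s i) (s j))
    (fun i => x (s i)) (fun i => v (s i)).
Proof.
move=> sb [cxv dxv]; split=> [i k|m i k t mt tm]; first exact: cxv.
have [dx dv] := dxv m (s i) k t mt tm; split=> //.
move: dv; rewrite (reindex s)//; exact: onW_bij.
Qed.

Definition bounded_weights (I : finType) (a : R) (A : I -> I -> R) : Prop :=
  [/\ forall i j, 0 <= A i j, forall i, \sum_j A i j <= a
    & forall j, \sum_i A i j <= a].

Context (Lb LK Bb BK : R).
Hypotheses (hb : sqlipschitz Lb b) (hK : sqlipschitz LK K).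
Hypotheses (Lb0 : 0 <= Lb) (LK0 : 0 <= LK).
Hypotheses (bB : forall x k, `|b x 0 k| <= Bb) (KB : forall x k, `|K x 0 k| <= BK).
Hypotheses (Bb0 : 0 <= Bb) (BK0 : 0 <= BK).

Let growth (a : R) := 2 + (2 * Lb + 8 * a ^+ 2 * LK).

Lemma sum_sqnorm2 (I : finType) (f g : I -> 'rV[R]_d) :
  \sum_i (sqnorm (f i) + sqnorm (g i)) =
  \sum_(q : I * 'I_d) (f q.1 0 q.2 ^+ 2 + g q.1 0 q.2 ^+ 2).
Proof.
rewrite -(pair_bigA _ (fun i k => f i 0 k ^+ 2 + g i 0 k ^+ 2))/=.
by apply: eq_bigr => i _; rewrite big_split.
Qed.

Lemma sum_sqnorm (I : finType) (f : I -> 'rV[R]_d) :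
  \sum_i sqnorm (f i) = \sum_(q : I * 'I_d) f q.1 0 q.2 ^+ 2.
Proof. by rewrite -(pair_bigA _ (fun i k => f i 0 k ^+ 2)). Qed.

(* y = v - u - mu removes the noise mu from the velocity gap, so that its
   derivative is controlled by the position gap alone. *)
Lemma noise_comparison (I : finType) (a : R) (A0 A : nat -> I -> I -> R)
    (x v y u : I -> R -> 'rV[R]_d) (mu : I -> R -> 'rV[R]_d) (c s t : R) :
  0 < a -> (forall m, m%:R * tau < t -> bounded_weights a (A m)) ->
  weighted_system A0 x v -> weighted_system A y u ->
  (forall i k, cont0 (fun r => mu i r 0 k)) ->
  (forall m i k r, m%:R * tau <= r -> r < m.+1%:R * tau -> s <= r -> r < t ->
     rder (fun r => mu i r 0 k) r
       (\sum_j (A0 m i j - A m i j) * K (x i r - x j r) 0 k)) ->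
  0 <= s -> s <= t -> 0 <= c ->
  (forall r, s <= r -> r < t -> \sum_i sqnorm (mu i r) <= c) ->
  let E r := \sum_i (sqnorm (x i r - y i r) +
                     sqnorm (v i r - u i r - mu i r)) in
  E t <= expR (growth a * (t - s)) * (E s + c * (t - s)).
Proof.
move=> a0 Aa [cx dx] [cy dy] cmu dmu s0 st c0 muc /=.
rewrite !sum_sqnorm2.
have [hr hc] : (forall f g : I -> R -> 'rV[R]_d, forall t (q : I * 'I_d),
    (f q.1 t - g q.1 t) 0 q.2 = f q.1 t 0 q.2 - g q.1 t 0 q.2) /\
    (forall f g h : I -> R -> 'rV[R]_d, forall t (q : I * 'I_d),
    (f q.1 t - g q.1 t - h q.1 t) 0 q.2 =
      f q.1 t 0 q.2 - g q.1 t 0 q.2 - h q.1 t 0 q.2).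
  by split=> *; rewrite !mxE.
under eq_bigr do rewrite hr hc; under [in leRHS]eq_bigr do rewrite hr hc.
apply: (@energy_growth _ _ (fun q r => x q.1 r 0 q.2 - y q.1 r 0 q.2)
  (fun q r => v q.1 r 0 q.2 - u q.1 r 0 q.2 - mu q.1 r 0 q.2)
  (fun q r => mu q.1 r 0 q.2)) => //.
- by rewrite addr_ge0// mulr_ge0// mulr_ge0// sqr_ge0.
- by move=> q; apply: cont0B; [exact: (cx _ _).1|exact: (cy _ _).1].
- by move=> q; apply: cont0B => //; apply: cont0B; [exact: (cx _ _).2|exact: (cy _ _).2].
move=> r sr rt; have [m [mr rm]] := time_step (le_trans s0 sr).
exists (fun q => b (x q.1 r) 0 q.2 - b (y q.1 r) 0 q.2 + \sum_j A m q.1 j *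
  (K (x q.1 r - x j r) 0 q.2 - K (y q.1 r - y j r) 0 q.2)); split.
- move=> q; rewrite subrK; apply: rderB.
    by case: (dx m q.1 q.2 r mr rm).
  by case: (dy m q.1 q.2 r mr rm).
- move=> q; have [_ h1] := dx m q.1 q.2 r mr rm; have [_ h2] := dy m q.1 q.2 r mr rm.
  have h3 := dmu m q.1 q.2 r mr rm sr rt.
  have := rderB (rderB h1 h2) h3; congr (rder _ _ _).
  (* Since the noise is evaluated along [x], subtracting it replaces the weights [A0] by [A] in the
     force along [x]; both forces then carry the same weights and only the Lipschitz difference of
     [K] remains. *)
  have -> : \sum_j A m q.1 j * (K (x q.1 r - x j r) 0 q.2 - K (y q.1 r - y j r) 0 q.2) =
      \sum_j A0 m q.1 j * K (x q.1 r - x j r) 0 q.2 -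
      \sum_j A m q.1 j * K (y q.1 r - y j r) 0 q.2 -
      \sum_j (A0 m q.1 j - A m q.1 j) * K (x q.1 r - x j r) 0 q.2.
    by rewrite -!sumrB; apply: eq_bigr => j _; ring.
  by ring.
- rewrite -(pair_bigA _ (fun i k => (b (x i r) 0 k - b (y i r) 0 k + \sum_j A m i j *
    (K (x i r - x j r) 0 k - K (y i r - y j r) 0 k)) ^+ 2))/=.
  have [A1 A2 A3] := Aa m (le_lt_trans mr rt).
  apply: le_trans (drift_lipschitz _ _ hb hK LK0 a0 A1 A2 A3) _.
  by rewrite sum_sqnorm/=; under eq_bigr do rewrite hr.
- by have := muc r sr rt; rewrite sum_sqnorm.
Qed.

(** Weights that agree before [t] produce no noise, so [noise_comparison] applies with zero noise
    and the gap comes from the initial data alone. This is the source of all continuity in the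
    initial data used below. *)
Lemma weighted_system_stability (I : finType) (a : R) (A A' : nat -> I -> I -> R)
    (x v y u : I -> R -> 'rV[R]_d) (t : R) :
  0 < a -> (forall m, bounded_weights a (A' m)) ->
  (forall m i j, m%:R * tau < t -> A m i j = A' m i j) ->
  weighted_system A x v -> weighted_system A' y u -> 0 <= t ->
  let E r := \sum_i (sqnorm (x i r - y i r) + sqnorm (v i r - u i r)) in
  E t <= expR (growth a * t) * E 0.
Proof.
move=> a0 Aa AA' xv yu t0 /=.
have := @noise_comparison I a A A' x v y u (fun _ _ => 0) 0 0 t a0 (fun m _ => Aa m) xv yu.
rewrite /= !subr0 mul0r addr0.
have sE r : \sum_i (sqnorm (x i r - y i r) + sqnorm (v i r - u i r - 0)) =
    \sum_i (sqnorm (x i r - y i r) + sqnorm (v i r - u i r)).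
  by under eq_bigr do rewrite subr0.
rewrite !sE; apply=> //.
- by move=> i k; under eq_fun do rewrite mxE; exact: cont0_cst.
- move=> m i k r mr _ _ rt; under eq_fun do rewrite mxE.
  rewrite big1 => [|j _]; first exact: rder_cst.
  by rewrite (AA' m i j (le_lt_trans mr rt)) subrr mul0r.
- by move=> r *; rewrite big1// => i _; rewrite /sqnorm big1// => k _; rewrite mxE expr0n.
Qed.

Lemma force_bound (I : finType) (a : R) (A : I -> I -> R) (x : 'rV[R]_d)
    (y : I -> 'rV[R]_d) i k : bounded_weights a A ->
  `|b x 0 k + \sum_j A i j * K (y j) 0 k| <= Bb + a * BK.
Proof.
move=> [A0 Ar _]; rewrite (le_trans (ler_normD _ _))// lerD//.
rewrite (le_trans (ler_norm_sum _ _ _))//.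
apply: (@le_trans _ _ (\sum_j A i j * BK)).
  by apply: ler_sum => j _; rewrite normrM ger0_norm// ler_wpM2l.
by rewrite -mulr_suml ler_wpM2r.
Qed.

(** The initial law may have arbitrary tails, so the trajectories need not be bounded uniformly over
    Omega. The gap of two solutions with equal initial state is: bounded forces, integrated once for
    the velocity and twice for the position, bound it, and this makes it integrable. *)
Lemma weighted_system_gap (I : finType) (a : R) (A A' : nat -> I -> I -> R)
    (x v y u : I -> R -> 'rV[R]_d) (t T : R) i k :
  (forall m, bounded_weights a (A m)) -> (forall m, bounded_weights a (A' m)) ->
  weighted_system A x v -> weighted_system A' y u ->
  x i 0 = y i 0 -> v i 0 = u i 0 -> 0 <= t -> t <= T ->
  `|(v i t - u i t) 0 k| <= 2 * (Bb + a * BK) * T /\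
  `|(x i t - y i t) 0 k| <= 2 * (Bb + a * BK) * T * T.
Proof.
move=> Aa A'a [cx dx] [cy dy] xy0 vu0 t0 tT.
have c0 : 0 <= 2 * (Bb + a * BK).
  by rewrite mulr_ge0// (le_trans _ (force_bound (x i 0) (x ^~ 0) i k (Aa 0%N))).
have hv r : 0 <= r -> r <= T -> `|(v i r - u i r) 0 k| <= 2 * (Bb + a * BK) * T.
  move=> r0 rT; apply: (@le_trans _ _ (2 * (Bb + a * BK) * (r - 0))); last first.
    by rewrite ler_wpM2l// subr0.
  have -> : (v i r - u i r) 0 k = (v i r 0 k - u i r 0 k) - (v i 0 0 k - u i 0 0 k).
    by rewrite vu0 subrr subr0 !mxE.
  apply: (@rder_lipschitz _ (fun r => v i r 0 k - u i r 0 k)) => //.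
    by apply: cont0B; [exact: (cx _ _).2|exact: (cy _ _).2].
  move=> q q0 qr; have [m [mq qm]] := time_step q0.
  have [_ h1] := dx m i k q mq qm; have [_ h2] := dy m i k q mq qm.
  exists (b (x i q) 0 k + \sum_j A m i j * K (x i q - x j q) 0 k -
    (b (y i q) 0 k + \sum_j A' m i j * K (y i q - y j q) 0 k)); last exact: rderB.
  by rewrite (le_trans (ler_normB _ _))// mulr2n mulrDl mul1r lerD//; exact: force_bound.
split; first exact: hv.
apply: (@le_trans _ _ (2 * (Bb + a * BK) * T * (t - 0))); last first.
  by rewrite subr0 ler_wpM2l// mulr_ge0// (le_trans t0).
have -> : (x i t - y i t) 0 k = (x i t 0 k - y i t 0 k) - (x i 0 0 k - y i 0 0 k).
  by rewrite xy0 subrr subr0 !mxE.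
apply: (@rder_lipschitz _ (fun r => x i r 0 k - y i r 0 k)) => //.
  by apply: cont0B; [exact: (cx _ _).1|exact: (cy _ _).1].
move=> q q0 qt; have [m [mq qm]] := time_step q0.
have [h1 _] := dx m i k q mq qm; have [h2 _] := dy m i k q mq qm.
exists (v i q 0 k - u i q 0 k); last exact: rderB.
by have := hv q q0 (le_trans (ltW qt) tT); rewrite !mxE.
Qed.

End WeightedSystem.

(** * Lipschitz bounds for the Euclidean norm *)

Section Hypotheses.
Context (R : realType) (d : nat).
Implicit Types (x y : 'rV[R]_d) (f : 'rV[R]_d -> 'rV[R]_d).

Lemma coord_le_norm x k : `|x 0 k| <= `|x|.
Proof.
rewrite /Num.norm/= mx_normrE.
exact: (le_bigmax _ (fun ij : 'I_1 * 'I_d => `|x ij.1 ij.2|) (ord0, k)).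
Qed.

Lemma norm_le_coord x c : 0 <= c -> (forall k, `|x 0 k| <= c) -> `|x| <= c.
Proof.
move=> c0 xc; rewrite /Num.norm/= mx_normrE.
by apply: bigmax_le => // -[i k] _ /=; rewrite ord1.
Qed.

Lemma normsq_le_sqnorm x : `|x| ^+ 2 <= sqnorm x.
Proof.
suff : `|x| <= Num.sqrt (sqnorm x).
  by move=> h; rewrite -[leRHS]sqr_sqrtr ?sqnorm_ge0// lerXn2r// nnegrE ?sqrtr_ge0.
apply: norm_le_coord => [|k]; first by rewrite sqrtr_ge0.
rewrite -sqrtr_sqr ler_sqrt ?sqnorm_ge0// /sqnorm (bigD1 k)//= lerDl.
by apply: sumr_ge0 => i _; rewrite sqr_ge0.
Qed.

Lemma sqnorm_le_norm x : sqnorm x <= d%:R * `|x| ^+ 2.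
Proof.
apply: (@le_trans _ _ (\sum_(k < d) `|x| ^+ 2)); last first.
  by rewrite sumr_const card_ord mulr_natl.
apply: ler_sum => k _; rewrite -[leLHS]real_normK ?num_real//.
by rewrite lerXn2r ?nnegrE ?coord_le_norm.
Qed.

(** The factor [d] is the price of passing from the sup norm to the Euclidean one: the squared
    Euclidean norm lies between the squared sup norm and [d] times it. *)
Lemma lipschitz_sqlipschitz f L : 0 <= L ->
  (forall x y, `|f x - f y| <= L * `|x - y|) -> sqlipschitz (d%:R * L ^+ 2) f.
Proof.
move=> L0 fL x y; apply: le_trans (sqnorm_le_norm _) _.
rewrite -mulrA ler_wpM2l// (le_trans _ (ler_wpM2l _ (normsq_le_sqnorm _)))//.
  by rewrite -exprMn lerXn2r// ?nnegrE ?mulr_ge0.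
by rewrite sqr_ge0.
Qed.

Lemma bounded_setT (T : Type) (W : normedModType R) (f : T -> W) :
  [bounded f x | x in setT] -> exists2 M : R, 0 < M & forall t, `|f t| <= M.
Proof.
move=> [M [Mreal hM]]; exists (`|M| + 1) => [|t]; first by rewrite ltr_wpDl.
by apply: hM => //; rewrite (le_lt_trans (ler_norm _))// ltrDl.
Qed.

Lemma bounded_coord f : [bounded f x | x in setT] ->
  exists2 B : R, 0 < B & forall x k, `|f x 0 k| <= B.
Proof.
move=> /bounded_setT[M M0 fM]; exists M => // x k.
exact: le_trans (coord_le_norm _ _) (fM x).
Qed.

Lemma lipschitz_on_sqlipschitz f : [lipschitz f x | x in setT] ->
  exists2 L : R, 0 < L & sqlipschitz L f.
Proof.
move=> [M [Mreal hM]].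
have /hM fL : M < `|M| + 1 by rewrite (le_lt_trans (ler_norm _))// ltrDl.
exists (d%:R * (`|M| + 1) ^+ 2 + 1).
  by rewrite ltr_wpDl// mulr_ge0// sqr_ge0.
move=> x y; apply: (@le_trans _ _ (d%:R * (`|M| + 1) ^+ 2 * sqnorm (x - y))).
  apply: lipschitz_sqlipschitz => [|{}x {}y]; first by rewrite addr_ge0.
  exact: (fL (x, y)).
by rewrite ler_wpM2r ?sqnorm_ge0// lerDl.
Qed.

(** Mean value estimate on the segment from [y] to [x], one coordinate at a time: the derivative
    along the segment is a coordinate of [v *m jacobian f], a sum of [d] products each at most [M]
    times the norm of [v]. *)
Lemma C1_sqlipschitz f : C1 f -> [bounded jacobian f x | x in setT] ->
  exists2 L : R, 0 < L & sqlipschitz L f.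
Proof.
move=> [df _] /bounded_setT[M _ fM].
have fM' x i k : `|jacobian f x i k| <= `|M|.
  apply: le_trans (le_trans (fM x) (ler_norm _)); rewrite /Num.norm/= mx_normrE.
  exact: (le_bigmax _ (fun ij : 'I_d * 'I_d => `|jacobian f x ij.1 ij.2|) (i, k)).
pose L : R := d%:R * `|M|.
have L0 : 0 <= L by rewrite mulr_ge0.
exists (d%:R * L ^+ 2 + 1); first by rewrite ltr_wpDl// mulr_ge0// sqr_ge0.
suff : sqlipschitz (d%:R * L ^+ 2) f.
  by move=> h x y; apply: le_trans (h x y) _; rewrite ler_wpM2r ?sqnorm_ge0// lerDl.
apply: lipschitz_sqlipschitz => // x y; apply: norm_le_coord => [|k]; first by rewrite mulr_ge0.
pose v := x - y; pose g (s : R) := f (y + s *: v) 0 k.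
have dg s : is_derive s (1 : R) g ((v *m jacobian f (y + s *: v)) 0 k).
  suff H : h^-1 *: (g (h *: (1 : R) + s) - g s) @[h --> 0^'] -->
      (v *m jacobian f (y + s *: v)) 0 k.
    by split; [exact: cvgP H | exact: cvg_lim H].
  rewrite -deriveEjacobian//.
  have : h^-1 *: (f (h *: v + (y + s *: v)) - f (y + s *: v)) @[h --> 0^'] -->
      'D_v f (y + s *: v) by exact: diff_derivable.
  move=> /(@cvg_comp _ _ _ _ (fun M : 'rV[R]_d => M 0 k)) => H.
  have {}H := H _ (@coord_continuous R 1 d 0 k _); move: H.
  apply: cvg_trans; apply: near_eq_cvg; near=> h.
  by rewrite /= !mxE /g [_ *: (1 : R)]mulr1 scalerDl addrCA.
have -> : (f x - f y) 0 k = g 1 - g 0.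
  by rewrite /g scale1r scale0r addr0 /v [y + _]addrC subrK !mxE.
have -> : L * `|v| = L * `|v| * (1 - 0) by rewrite subr0 mulr1.
apply: rder_lipschitz => //.
  apply: continuous_cont0 => s; apply: differentiable_continuous.
  by apply/derivable1_diffP; case: (dg s).
move=> s _ _; exists ((v *m jacobian f (y + s *: v)) 0 k); last exact: is_derive_rder.
rewrite mxE (le_trans (ler_norm_sum _ _ _))// /L -mulrA.
apply: (@le_trans _ _ (\sum_(j < d) `|M| * `|v|)); last first.
  by rewrite sumr_const card_ord mulr_natl.
apply: ler_sum => j _; rewrite normrM mulrC ler_pM//.
exact: coord_le_norm.
Unshelve. all: by end_near. Qed.
End Hypotheses.

(** * The two systems as weighted systems; divisions *)

Section FromDefs.
Context (R : realType) (d : nat) (b K : 'rV[R]_d -> 'rV[R]_d).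

Lemma is_deriv_within_coord (A : set R) (f : R -> 'rV[R]_d) t l k :
  is_deriv_within A f t l ->
  (s - t)^-1 * (f s 0 k - f t 0 k) @[s --> within A t^'] --> l 0 k.
Proof.
move=> /(@cvg_comp _ _ _ _ (fun M : 'rV[R]_d => M 0 k)) => H.
have {}H := H _ (@coord_continuous R 1 d 0 k _); move: H.
by apply: cvg_trans; apply: near_eq_cvg; near=> s; rewrite /= !mxE.
Unshelve. all: by end_near. Qed.

(** The particle system is specified by derivatives only; its continuity is recovered by multiplying
    the difference quotient by [s - t]. The punctured filter leaves out [s = t], which is treated
    apart. *)
Lemma within_deriv_cvg (A : set R) (f : R -> R) (t l : R) :
  (s - t)^-1 * (f s - f t) @[s --> within A t^'] --> l ->
  f @ within A (nbhs t) --> f t.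
Proof.
move=> df.
have : (s - t) * ((s - t)^-1 * (f s - f t)) + f t @[s --> within A t^'] --> 0 * l + f t.
  apply: cvgD; last exact: cvg_cst.
  apply: cvgM => //.
  apply/cvgrPdist_lt => e e0; rewrite /prop_near1 /nbhs/= /within/= /dnbhs /within/=.
  apply: filterS (nbhsx_ballx t e e0) => s ts _ _.
  by rewrite sub0r normrN distrC.
rewrite mul0r add0r => H B Bt; have /= := H B Bt.
move=> h.
have {}h : nbhs t (fun s => s != t -> A s ->
  B ((s - t) * ((s - t)^-1 * (f s - f t)) + f t)) by exact: h.
apply: filterS h => s hs As; have [->|st] := eqVneq s t.
  exact: (nbhs_singleton Bt).
by have := hs st As; rewrite mulrA divff ?mul1r ?subrK// subr_eq0.
Qed.

Definition particle_weight (N : nat) (i j : 'I_N) : R :=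
  (j != i)%:R / (N%:R - 1).

Definition batch_weight (N p : nat) (D : {set {set 'I_N}}) (i j : 'I_N) : R :=
  ((j \in finset.pblock D i) && (j != i))%:R / (p%:R - 1).

Lemma particle_system_weighted (tau : R) (N : nat) (X V : 'I_N -> R -> 'rV[R]_d) :
  0 < tau -> particle_system b K X V ->
  weighted_system b K tau (fun=> @particle_weight N) X V.
Proof.
move=> tau0 XV; split=> [i k|m i k t mt tm].
  split; apply: cont0_within => t t0; have [h1 h2] := XV i t t0.
    exact: (@within_deriv_cvg _ (fun t => X i t 0 k) t _ (is_deriv_within_coord (k := k) h1)).
  exact: (@within_deriv_cvg _ (fun t => V i t 0 k) t _ (is_deriv_within_coord (k := k) h2)).
have t0 : 0 <= t by rewrite (le_trans _ mt)// mulr_ge0// ltW.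
have [h1 h2] := XV i t t0.
have sub s : t <= s < t + 1 -> `[0, +oo[%classic s.
  by move=> /andP[ts _]; rewrite /= in_itv/= andbT (le_trans t0).
split; first exact: rder_within ltr01 sub (is_deriv_within_coord (k := k) h1).
have := rder_within ltr01 sub (is_deriv_within_coord (k := k) h2).
rewrite !mxE summxE mulr_sumr big_mkcond/=; congr (rder _ _ (_ + _)).
apply: eq_bigr => j _; rewrite /particle_weight.
by case: eqP => _; rewrite ?mul0r ?mul1r.
Qed.

Lemma rbm1_weighted (tau : R) (N p : nat) (xi : nat -> {set {set 'I_N}})
    (X U : 'I_N -> R -> 'rV[R]_d) :
  0 < tau -> rbm1 b K p tau xi X U ->
  weighted_system b K tau (fun m => @batch_weight N p (xi m)) X U.
Proof.
move=> tau0 [cXU dXU]; split=> [i k|m i k t mt tm].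
  have sub t : 0 <= t -> `[0, +oo[%classic t by rewrite /= in_itv/= andbT.
  have [/subspace_continuousP h1 /subspace_continuousP h2] := cXU i.
  split; apply: cont0_within => t /sub t0.
    apply: (@cvg_comp _ _ _ (X i) (fun M : 'rV[R]_d => M 0 k) _ _ _ (h1 t t0)).
    exact: coord_continuous.
  apply: (@cvg_comp _ _ _ (U i) (fun M : 'rV[R]_d => M 0 k) _ _ _ (h2 t t0)).
  exact: coord_continuous.
have tI : t \in `[m%:R * tau, m.+1%:R * tau[%classic by rewrite inE /= in_itv/= mt tm.
have [h1 h2] := dXU m i t tI.
have tm0 : 0 < m.+1%:R * tau - t by rewrite subr_gt0.
have sub s : t <= s < t + (m.+1%:R * tau - t) -> `[m%:R * tau, m.+1%:R * tau[%classic s.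
  by move=> /andP[ts]; rewrite addrC subrK /= in_itv/= (le_trans mt).
split; first exact: rder_within tm0 sub (is_deriv_within_coord (k := k) h1).
have := rder_within tm0 sub (is_deriv_within_coord (k := k) h2).
rewrite !mxE summxE mulr_sumr big_mkcond/=; congr (rder _ _ (_ + _)).
apply: eq_bigr => j _; rewrite /batch_weight.
by case: ifP => _; rewrite ?mul0r ?mul1r.
Qed.

Lemma natrB1_gt0 (N : nat) : (2 <= N)%N -> 0 < N%:R - 1 :> R.
Proof. by move=> N2; rewrite subr_gt0 ltr1n. Qed.

Lemma sum_neq (N : nat) (i : 'I_N) : \sum_(j < N) (j != i)%:R = N%:R - 1 :> R.
Proof.
have -> : N%:R = 1 + \sum_(j < N | j != i) 1 :> R.
  by rewrite -[in LHS](card_ord N) -[LHS]sumr_const (bigD1 i).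
rewrite [1 + _]addrC addrK [RHS]big_mkcond/=.
by apply: eq_bigr => j _; case: eqP.
Qed.

Lemma particle_weight_bounded (N : nat) : (2 <= N)%N ->
  bounded_weights 1 (@particle_weight N).
Proof.
move=> N2; have N1 := natrB1_gt0 N2; split=> [i j|i|j].
- by rewrite divr_ge0// ltW.
- by rewrite -mulr_suml sum_neq divff ?gt_eqF.
- rewrite -mulr_suml; under eq_bigr do rewrite eq_sym.
  by rewrite sum_neq divff ?gt_eqF.
Qed.

Lemma bounded_weights_mono (I : finType) (a a' : R) (A : I -> I -> R) : a <= a' ->
  bounded_weights a A -> bounded_weights a' A.
Proof.
by move=> aa' [A0 A1 A2]; split=> // i; rewrite (le_trans _ aa').
Qed.

Lemma batch_weight_ge0 (N p : nat) (D : {set {set 'I_N}}) i j : (2 <= p)%N ->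
  0 <= batch_weight p D i j.
Proof. by move=> /natrB1_gt0/ltW p1; rewrite divr_ge0. Qed.

(* A crude bound, valid also when D is not a division. *)
Lemma batch_weight_bounded (N p : nat) (D : {set {set 'I_N}}) : (2 <= p)%N ->
  bounded_weights N%:R (@batch_weight N p D).
Proof.
move=> p2; have p1 := natrB1_gt0 p2.
have le1 i j : batch_weight p D i j <= 1.
  rewrite ler_pdivrMr// mul1r.
  apply: (@le_trans _ _ 1); first by case: (_ && _).
  by rewrite lerBrDr (_ : 1 + 1 = 2%:R :> R)// ler_nat.
split=> [i j|i|j]; first exact: batch_weight_ge0.
- rewrite (_ : N%:R = \sum_(k < N) 1); last by rewrite sumr_const card_ord.
  exact: ler_sum.
- rewrite (_ : N%:R = \sum_(k < N) 1); last by rewrite sumr_const card_ord.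
  exact: ler_sum.
Qed.

End FromDefs.

(** * Divisions into batches and their symmetries *)

Section Divisions.
Context (n p : nat).
Local Notation N := (n * p)%N.
Implicit Types (D : {set {set 'I_N}}) (i j l : 'I_N).
Local Open Scope nat_scope.

Lemma divisionsP D : D \in divisions n p ->
  [/\ finset.partition D [set: 'I_N], #|D| = n & forall C, C \in D -> #|C| = p].
Proof.
rewrite inE => /and3P[h1 /eqP h2 /forallP h3]; split=> // C CD.
by have := h3 C; rewrite CD => /eqP.
Qed.

Lemma division_block D i : D \in divisions n p ->
  [/\ finset.trivIset D, finset.pblock D i \in D & i \in finset.pblock D i].
Proof.
move=> /divisionsP[/and3P[/eqP cD tD _] _ _].
have iD : i \in finset.cover D by rewrite cD inE.
by rewrite finset.pblock_mem// finset.mem_pblock.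
Qed.

Definition same_batch D i j : bool := (j \in finset.pblock D i) && (j != i).

Lemma same_batch_sym D i j : D \in divisions n p ->
  same_batch D i j = same_batch D j i.
Proof.
move=> Ddiv; rewrite /same_batch [i == j]eq_sym; congr (_ && _).
have [tD _ ii] := division_block i Ddiv; have [_ _ jj] := division_block j Ddiv.
by apply/idP/idP => h; rewrite (finset.same_pblock tD h).
Qed.

Lemma card_same_batch D i : D \in divisions n p -> \sum_j same_batch D i j = p.-1.
Proof.
move=> Ddiv; have [_ iD ii] := division_block i Ddiv.
have [_ _ /(_ _ iD) cp] := divisionsP Ddiv.
have := finset.cardsD1 i (finset.pblock D i); rewrite ii add1n cp => /(congr1 predn)/= ->.
rewrite -sum1_card [RHS]big_mkcond/=; apply: eq_bigr => j _.
by rewrite !inE andbC /same_batch; case: (_ && _).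
Qed.

Definition relabel (s : {perm 'I_N}) D : {set {set 'I_N}} :=
  [set s @: (C : {set 'I_N}) | C in D]%SET.

Lemma relabel_division s D : D \in divisions n p -> relabel s D \in divisions n p.
Proof.
move=> /divisionsP[PD cD BD]; rewrite inE; apply/and3P; split.
- have -> : [set: 'I_N]%SET = (s @: [set: 'I_N])%SET.
    by apply/esym/setP => i; rewrite inE -[i](permKV s) imset_f ?inE.
  by rewrite imset_partition//; exact: perm_inj.
- by rewrite card_imset ?cD//; exact/imset_inj/perm_inj.
- apply/forallP => C; apply/implyP => /imsetP[B BD' ->].
  by rewrite card_imset ?BD//; exact: perm_inj.
Qed.

Lemma relabel_inj s : injective (relabel s).
Proof. by apply: imset_inj; apply: imset_inj; exact: perm_inj. Qed.

Lemma relabelK s : cancel (relabel s) (relabel s^-1).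
Proof.
move=> D; rewrite /relabel -imset_comp -[RHS]imset_id; apply: eq_imset => C /=.
by rewrite -imset_comp -[RHS]imset_id; apply: eq_imset => k /=; rewrite permK.
Qed.

Lemma relabel_divisionE s D : (relabel s D \in divisions n p) = (D \in divisions n p).
Proof.
apply/idP/idP => [|]; last exact: relabel_division.
by move=> /(relabel_division s^-1); rewrite relabelK.
Qed.

Lemma same_batch_relabel s D i j : D \in divisions n p ->
  same_batch (relabel s D) (s i) (s j) = same_batch D i j.
Proof.
move=> Ddiv; have [tD iD ii] := division_block i Ddiv.
have -> : same_batch (relabel s D) (s i) (s j) =
    (s j \in (s @: finset.pblock D i)%SET) && (s j != s i).
  rewrite /same_batch (@finset.def_pblock _ _ (s @: finset.pblock D i)%SET)//.
  - by have [+ _ _] := division_block (s i) (relabel_division s Ddiv).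
  - exact: imset_f.
  - exact: imset_f.
by rewrite mem_imset ?(inj_eq perm_inj)//; exact: perm_inj.
Qed.

(** Divided by the number of divisions, this is the probability that [j] and [l] are both batch
    mates of [i]. It is not evaluated by enumeration: permutations fixing [i] show that it takes one
    value for [j = l] and another for [j != l]. *)
Definition pair_count i j l : nat :=
  \sum_(D in divisions n p) same_batch D i j * same_batch D i l.

Lemma pair_countC i j l : pair_count i j l = pair_count i l j.
Proof. by apply: eq_bigr => D _; rewrite mulnC. Qed.

Lemma pair_count_relabel (s : {perm 'I_N}) i j l : s i = i ->
  pair_count i (s j) (s l) = pair_count i j l.
Proof.
move=> si; rewrite /pair_count (reindex_inj (@relabel_inj s))/=.
apply: eq_big => [D|D]; first exact: relabel_divisionE.
rewrite relabel_divisionE => Ddiv.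
by rewrite -{1 2}si !same_batch_relabel.
Qed.

Lemma pair_count_diag i j j' : j != i -> j' != i ->
  pair_count i j j = pair_count i j' j'.
Proof.
move=> ji j'i; rewrite -(@pair_count_relabel (tperm j j')) ?tpermL//.
by rewrite tpermD.
Qed.

Lemma pair_count_left i l j j' : j != i -> j' != i -> l != i -> j != l -> j' != l ->
  pair_count i j l = pair_count i j' l.
Proof.
move=> ji j'i li jl j'l; rewrite -(@pair_count_relabel (tperm j j')) ?tpermL//.
  by rewrite tpermD.
by rewrite tpermD.
Qed.

(** The pair is moved one index at a time, by transpositions that must fix [i] and the other index.
    When an old index coincides with a new one, the order of the moves, or the symmetry in the two
    indices, has to be chosen accordingly. *)
Lemma pair_count_off_diag i j l j' l' : j != i -> j' != i -> l != i -> l' != i ->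
  j != l -> j' != l' -> pair_count i j l = pair_count i j' l'.
Proof.
move=> ji j'i li l'i jl j'l'.
have [jl'|jl'] := eqVneq j l'; last first.
  rewrite pair_countC (@pair_count_left _ j l l')// 1?eq_sym//.
  by rewrite pair_countC; exact: pair_count_left.
have [j'l|j'l'n] := eqVneq j' l; first by rewrite jl' j'l pair_countC.
rewrite (@pair_count_left _ l j j')//.
by rewrite pair_countC [RHS]pair_countC; apply: pair_count_left; rewrite // eq_sym.
Qed.

End Divisions.

(** * Moments of the batch noise *)

Section Moments.
Context (R : realType) (n p : nat).
Hypotheses (p2 : (2 <= p)%N) (n1 : (1 <= n)%N).
Local Notation N := (n * p)%N.
Local Notation Dv := (divisions n p).

Lemma particles_ge2 : (2 <= N)%N.
Proof. by rewrite (leq_trans p2)// leq_pmull. Qed.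

Lemma sum_same_batch D i : D \in Dv ->
  \sum_j (same_batch D i j)%:R = p%:R - 1 :> R.
Proof.
move=> Ddiv; rewrite -natr_sum card_same_batch// -subn1 natrB//.
exact: leq_trans p2.
Qed.

Lemma batch_weight_division D : D \in Dv ->
  bounded_weights (1 : R) (@batch_weight R N p D).
Proof.
move=> Ddiv; have p1 := natrB1_gt0 R p2.
have row i : \sum_j batch_weight R p D i j = 1 :> R.
  by rewrite -mulr_suml sum_same_batch// divff// gt_eqF.
split=> [i j|i|j]; first exact: batch_weight_ge0.
- by rewrite row.
- rewrite (eq_bigr (fun i => batch_weight R p D j i)) ?row// => i _.
  by rewrite /batch_weight -!/(same_batch _ _ _) same_batch_sym.
Qed.

Lemma pair_count_const (i : 'I_N) : exists c1 c2 : nat, forall j l,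
  pair_count i j l =
  if (j != i) && (l != i) then (if j == l then c1 else c2) else 0%N.
Proof.
(* The value 0 is a placeholder for the case where no admissible index or pair exists, such as two
   distinct mates when [N] is 2; nothing is claimed then. *)
exists (if [pick j | j != i] is Some j then pair_count i j j else 0%N).
exists (if [pick q : 'I_N * 'I_N | [&& q.1 != i, q.2 != i & q.1 != q.2]] is Some q
  then pair_count i q.1 q.2 else 0%N).
move=> j l; have [->|ji]/= := eqVneq j i.
  by rewrite /pair_count big1// => D _; rewrite /same_batch eqxx andbF.
have [->|li]/= := eqVneq l i.
  by rewrite /pair_count big1// => D _; rewrite /same_batch eqxx !andbF muln0.
have [->|jl] := eqVneq j l.
  by case: pickP => [k ki|/(_ l)]; [exact: pair_count_diag|rewrite li].
case: pickP => [[j' l']/= /and3P[]|/(_ (j, l))/=]; last by rewrite ji li jl.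
by move=> *; exact: pair_count_off_diag.
Qed.

(** Full average minus batch average, hence the opposite of chi in the overview. With this sign its
    time integral is what gets subtracted from V - U. *)
Definition noise (D : {set {set 'I_N}}) (i : 'I_N) (q : 'I_N -> R) : R :=
  \sum_j (particle_weight R i j - batch_weight R p D i j) * q j.

Section Fixed.
Variables (i : 'I_N) (q : 'I_N -> R).
Let a := \sum_j (j != i)%:R * q j / (N%:R - 1).
Let q' j := q j - a.

Let N1 : 0 < N%:R - 1 :> R := natrB1_gt0 R particles_ge2.
Let p1 : 0 < p%:R - 1 :> R := natrB1_gt0 R p2.

(** Both rows of weights sum to 1, so subtracting from [q] its mean [a] over the other particles
    does not change the noise; it makes the full average vanish and leaves only the batch term. *)
Let noiseE D : D \in Dv ->
  noise D i q = - (p%:R - 1)^-1 * \sum_j (same_batch D i j)%:R * q' j.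
Proof.
move=> Ddiv; rewrite /noise.
under eq_bigr do rewrite mulrBl; rewrite sumrB.
have -> : \sum_j particle_weight R i j * q j = a.
  by apply: eq_bigr => j _; rewrite /particle_weight mulrAC.
have -> : \sum_j batch_weight R p D i j * q j =
    (p%:R - 1)^-1 * \sum_j (same_batch D i j)%:R * q j.
  rewrite mulr_sumr; apply: eq_bigr => j _.
  by rewrite /batch_weight -/(same_batch D i j); ring.
have -> : \sum_j (same_batch D i j)%:R * q j =
    \sum_j (same_batch D i j)%:R * q' j + a * (p%:R - 1).
  rewrite -(sum_same_batch i Ddiv) mulr_sumr -big_split/=.
  by apply: eq_bigr => j _; rewrite /q'; ring.
by field; rewrite gt_eqF.
Qed.

Let centered : \sum_j (j != i)%:R * q' j = 0.
Proof.
under eq_bigr do rewrite mulrBr; rewrite sumrB -mulr_suml sum_neq /a -mulr_suml.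
by rewrite mulrCA divff ?mulr1 ?subrr// gt_eqF.
Qed.

(** Every [j] other than [i] shares the batch of [i] in the same number [c1] of divisions, so the
    sum is proportional to the sum of the centred [q']. *)
Lemma sum_noise : \sum_(D in Dv) noise D i q = 0.
Proof.
rewrite (eq_bigr _ noiseE) -mulr_sumr exchange_big/=.
have [c1 [c2 hc]] := pair_count_const i.
have -> : \sum_j \sum_(D in Dv) (same_batch D i j)%:R * q' j =
    c1%:R * \sum_j (j != i)%:R * q' j.
  rewrite mulr_sumr; apply: eq_bigr => j _; rewrite -mulr_suml mulrA; congr (_ * _).
  have := hc j j; rewrite eqxx andbb -natr_sum -natrM => h; congr (_%:R).
  transitivity (pair_count i j j); last by rewrite h; case: (j != i); rewrite ?muln1 ?muln0.
  by apply: eq_bigr => D _; case: same_batch.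
by rewrite centered !mulr0.
Qed.

(** Expanding the square over pairs gives [c1] on the diagonal and [c2] off it. The centred sum
    being zero, what remains is [(c1 - c2)] times the sum [S] of squares, and [c2] is dropped
    because it is nonnegative. Then [S <= (N - 1) * A ^+ 2] and the value of [(N - 1) * c1]
    conclude. *)
Lemma sum_noise_sqr A : (forall j, `|q j| <= A) ->
  \sum_(D in Dv) noise D i q ^+ 2 <= #|Dv|%:R * (A ^+ 2 / (p%:R - 1)).
Proof.
move=> qA.
have [c1 [c2 hc]] := pair_count_const i.
(* Double counting of the pairs formed by a division and a batch mate of [i] in it: each division
   contributes [p - 1] of them. *)
have c1E : (N%:R - 1) * c1%:R = #|Dv|%:R * (p%:R - 1) :> R.
  have : \sum_j (pair_count i j j)%:R = #|Dv|%:R * (p%:R - 1) :> R.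
    rewrite -natr_sum exchange_big/= natr_sum.
    rewrite (eq_bigr (fun=> p%:R - 1)) ?sumr_const ?mulr_natl// => D Ddiv.
    rewrite -(sum_same_batch i Ddiv) -natr_sum; congr (_%:R).
    by apply: eq_bigr => j _; case: same_batch.
  move=> <-; rewrite -(@sum_neq R N i) mulr_suml; apply: eq_bigr => j _.
  by rewrite hc andbb eqxx; case: (j != i); rewrite ?mul1r ?mul0r.
pose S := \sum_j (j != i)%:R * q' j ^+ 2.
have SE : \sum_(D in Dv) noise D i q ^+ 2 = (p%:R - 1) ^- 2 * ((c1%:R - c2%:R) * S).
  transitivity ((p%:R - 1) ^- 2 * \sum_(D in Dv) (\sum_j (same_batch D i j)%:R * q' j) ^+ 2).
    rewrite mulr_sumr; apply: eq_bigr => D Ddiv.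
    by rewrite noiseE// exprMn sqrrN exprVn.
  congr (_ * _).
  transitivity (\sum_j \sum_l (pair_count i j l)%:R * (q' j * q' l)).
    rewrite (eq_bigr (fun D => \sum_j \sum_l
        (same_batch D i j * same_batch D i l)%:R * (q' j * q' l))); last first.
      move=> D _; rewrite expr2 mulr_suml; apply: eq_bigr => j _.
      by rewrite mulr_sumr; apply: eq_bigr => l _; rewrite natrM; ring.
    rewrite exchange_big; apply: eq_bigr => j _.
    rewrite exchange_big; apply: eq_bigr => l _.
    by rewrite /pair_count natr_sum mulr_suml.
  transitivity (c2%:R * ((\sum_j (j != i)%:R * q' j) * (\sum_j (j != i)%:R * q' j))
    + (c1%:R - c2%:R) * S); last by rewrite centered mul0r mulr0 add0r.
  rewrite mulr_suml mulr_sumr mulr_sumr -big_split/=; apply: eq_bigr => j _.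
  rewrite mulr_sumr mulr_sumr (bigD1 j)//= [in RHS](bigD1 j)//= addrAC; congr (_ + _).
    by rewrite hc eqxx andbb; case: (j != i); rewrite /=; ring.
  apply: eq_bigr => l lj; rewrite hc [j == l]eq_sym (negbTE lj).
  by case: (j != i); case: (l != i); rewrite /=; ring.
have S0 : 0 <= S by apply: sumr_ge0 => j _; rewrite mulr_ge0// sqr_ge0.
have SA : S <= (N%:R - 1) * A ^+ 2.
  (* A sum of squares about the mean is the sum of squares minus the squared mean times the number
     of terms, hence at most the former. *)
  have -> : S = \sum_j (j != i)%:R * q j ^+ 2 - (N%:R - 1) * a ^+ 2.
    have aE : \sum_j (j != i)%:R * q j = (N%:R - 1) * a.
      by rewrite /a -mulr_suml mulrCA divff ?mulr1// gt_eqF.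
    have -> : S = \sum_j ((j != i)%:R * q j ^+ 2 - 2 * a * ((j != i)%:R * q j)
        + (j != i)%:R * a ^+ 2).
      by apply: eq_bigr => j _; rewrite /q'; ring.
    by rewrite big_split/= sumrB -mulr_sumr -mulr_suml sum_neq aE; ring.
  apply: (@le_trans _ _ (\sum_j (j != i)%:R * q j ^+ 2)).
    by rewrite lerBlDr lerDl mulr_ge0 ?sqr_ge0// ltW.
  rewrite -(@sum_neq R N i) mulr_suml; apply: ler_sum => j _; rewrite ler_wpM2l//.
  rewrite -[leLHS]real_normK ?num_real// lerXn2r ?nnegrE//.
  exact: le_trans (qA j).
rewrite SE; apply: (@le_trans _ _ ((p%:R - 1) ^- 2 * (c1%:R * ((N%:R - 1) * A ^+ 2)))).
  rewrite ler_wpM2l ?invr_ge0 ?sqr_ge0//.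
  apply: (@le_trans _ _ (c1%:R * S)); first by rewrite ler_wpM2r// gerBl.
  by rewrite ler_wpM2l.
rewrite mulrA [c1%:R * _]mulrC c1E.
rewrite le_eqVlt; apply/orP; left; apply/eqP; field.
by rewrite gt_eqF.
Qed.

End Fixed.
End Moments.

(** * Expectation of bounded measurable functions *)

Section Expectation.
Context (R : realType) (disp : measure_display) (Omega : measurableType disp)
        (P : probability Omega R).
Implicit Types (f g u v : Omega -> R).

Definition bounded_measurable f : Prop :=
  measurable_fun [set: Omega] f /\ exists B, forall w, `|f w| <= B.

Definition Ex f : R := \int[P]_w f w.

Lemma bounded_measurable_integrable f : bounded_measurable f ->
  P.-integrable setT (EFin \o f).
Proof.
move=> [mf [B fB]]; apply: measurable_bounded_integrable => //.
  by rewrite /= probability_setT ltry.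
exists B; split; first exact: num_real.
by move=> M BM w _; exact: le_trans (fB w) (ltW BM).
Qed.

Lemma bounded_measurable_cst (c : R) : bounded_measurable (fun=> c).
Proof. by split; [exact: measurable_cst|exists `|c|]. Qed.

Lemma bounded_measurableD f g : bounded_measurable f -> bounded_measurable g ->
  bounded_measurable (fun w => f w + g w).
Proof.
move=> [mf [A fA]] [mg [B gB]]; split; first exact: measurable_funD.
by exists (A + B) => w; rewrite (le_trans (ler_normD _ _))// lerD.
Qed.

Lemma bounded_measurableM f g : bounded_measurable f -> bounded_measurable g ->
  bounded_measurable (fun w => f w * g w).
Proof.
move=> [mf [A fA]] [mg [B gB]]; split; first exact: measurable_funM.
by exists (A * B) => w; rewrite normrM ler_pM.
Qed.

Lemma bounded_measurableB f g : bounded_measurable f -> bounded_measurable g ->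
  bounded_measurable (fun w => f w - g w).
Proof.
move=> [mf [A fA]] [mg [B gB]]; split; first exact: measurable_funB.
by exists (A + B) => w; rewrite (le_trans (ler_normB _ _))// lerD.
Qed.

Lemma bounded_measurable_sum (I : Type) (s : seq I) (Q : pred I) (F : I -> Omega -> R) :
  (forall i, bounded_measurable (F i)) ->
  bounded_measurable (fun w => \sum_(i <- s | Q i) F i w).
Proof.
move=> bF; rewrite (_ : (fun w => _) = fun w => \sum_(i <- [seq i <- s | Q i]) F i w).
  elim: [seq i <- s | Q i] => [|i r ih].
    rewrite (_ : (fun w => _) = fun=> 0); first exact: bounded_measurable_cst.
    by apply/funext => w; rewrite big_nil.
  rewrite (_ : (fun w => _) = fun w => F i w + \sum_(i <- r) F i w).
    exact: bounded_measurableD.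
  by apply/funext => w; rewrite big_cons.
by apply/funext => w; rewrite big_filter.
Qed.

Lemma bounded_measurable_bool (b : Omega -> bool) : measurable [set w | b w] ->
  bounded_measurable (fun w => (b w)%:R).
Proof.
move=> mb; split; last by exists 1 => w; case: (b w); rewrite ?normr1 ?normr0.
rewrite (_ : (fun w => _) = \1_[set w | b w]); first exact: measurable_indic.
by apply/funext => w; rewrite indicE; congr (nat_of_bool _)%:R; apply/idP/idP; rewrite inE.
Qed.

Lemma ExD f g : bounded_measurable f -> bounded_measurable g ->
  Ex (fun w => f w + g w) = Ex f + Ex g.
Proof. by move=> bf bg; apply: RintegralD => //; exact: bounded_measurable_integrable. Qed.

Lemma ExB f g : bounded_measurable f -> bounded_measurable g ->
  Ex (fun w => f w - g w) = Ex f - Ex g.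
Proof. by move=> bf bg; apply: RintegralB => //; exact: bounded_measurable_integrable. Qed.

Lemma ExZ c f : bounded_measurable f -> Ex (fun w => c * f w) = c * Ex f.
Proof. by move=> bf; apply: RintegralZl => //; exact: bounded_measurable_integrable. Qed.

Lemma Ex_cst (c : R) : Ex (fun=> c) = c.
Proof. by rewrite /Ex Rintegral_cst//= [fine _](_ : _ = 1) ?mulr1//; rewrite -[RHS]/(fine 1%E) -(@probability_setT _ _ _ P). Qed.

Lemma Ex_sum (I : Type) (s : seq I) (Q : pred I) (F : I -> Omega -> R) :
  (forall i, bounded_measurable (F i)) ->
  Ex (fun w => \sum_(i <- s | Q i) F i w) = \sum_(i <- s | Q i) Ex (F i).
Proof.
move=> bF; rewrite -big_filter.
rewrite (_ : (fun w => _) = fun w => \sum_(i <- [seq i <- s | Q i]) F i w); last first.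
  by apply/funext => w; rewrite big_filter.
elim: [seq i <- s | Q i] => [|i r ih].
  rewrite big_nil (_ : (fun w => _) = fun=> 0) ?Ex_cst//.
  by apply/funext => w; rewrite big_nil.
rewrite big_cons -ih -ExD//; last exact: bounded_measurable_sum.
by congr Ex; apply/funext => w; rewrite big_cons.
Qed.

Lemma le_Ex f g : bounded_measurable f -> bounded_measurable g ->
  (forall w, f w <= g w) -> Ex f <= Ex g.
Proof. by move=> bf bg fg; apply: le_Rintegral => //; exact: bounded_measurable_integrable. Qed.

Lemma Ex_norm_le f g : bounded_measurable f -> bounded_measurable g ->
  (forall w, `|f w| <= g w) -> `|Ex f| <= Ex g.
Proof.
move=> bf bg fg; rewrite ler_norml; apply/andP; split.
  rewrite lerNl -mulN1r -ExZ//; apply: le_Ex => // [|w].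
    by apply: bounded_measurableM => //; exact: bounded_measurable_cst.
  by rewrite mulN1r (le_trans _ (fg w))// -normrN ler_norm.
by apply: le_Ex => // w; rewrite (le_trans _ (fg w))// ler_norm.
Qed.

Lemma Ex_bool (b : Omega -> bool) : measurable [set w | b w] ->
  Ex (fun w => (b w)%:R) = fine (P [set w | b w]).
Proof.
move=> mb; rewrite /Ex /Rintegral; congr fine.
rewrite -[in RHS](setIT [set w | b w]) -integral_indic//; apply: eq_integral => w _.
by rewrite indicE; congr (_ _)%:E; congr (nat_of_bool _); apply/idP/idP; rewrite inE.
Qed.

Lemma expectationE f : bounded_measurable f -> ('E_P[f] = (Ex f)%:E)%E.
Proof.
move=> bf; rewrite unlock /Ex /Rintegral fineK//.
exact/integrable_fin_num/bounded_measurable_integrable.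
Qed.

Lemma measurable_nat_preimage (q : Omega -> nat) (B : set nat) :
  (forall c, measurable (q @^-1` [set c])) -> measurable (q @^-1` B).
Proof.
move=> mq; rewrite (_ : q @^-1` B = \bigcup_(c in B) (q @^-1` [set c])).
  by apply: bigcup_measurable => c _; exact: mq.
by apply/seteqP; split=> [w Bw|w [c Bc /= ->]//]; exists (q w).
Qed.

(** Continuity from above of the probability: the events [m <= q w] decrease to the empty set
    because [q w] is a finite number. *)
Lemma prob_tail (q : Omega -> nat) (e : R) : 0 < e ->
  (forall c, measurable (q @^-1` [set c])) ->
  exists m0, forall m, (m0 <= m)%N -> Ex (fun w => (m <= q w)%N%:R) <= e.
Proof.
move=> e0 mq; pose A m := [set w | (m <= q w)%N].
have mA m : measurable (A m).
  exact: (@measurable_nat_preimage q [set k | (m <= k)%N]).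
have A0 : \bigcap_m A m = set0.
  by apply/seteqP; split=> // w /(_ (q w).+1 I); rewrite /A/= ltnn.
have : P (A m) @[m --> \oo] --> P (\bigcap_m A m).
  apply: nonincreasing_cvg_mu => //.
  - by rewrite (le_lt_trans (probability_le1 _ _))// ltry.
  - by rewrite A0.
  - by move=> m k mk; apply/subsetPset => w; rewrite /A/=; exact: leq_trans.
rewrite A0 measure0 => /fine_cvgP[_ /cvgrPdist_le/(_ _ e0)[m0 _ h]].
exists m0 => m m0m; rewrite Ex_bool; last exact: mA.
have := h m m0m; rewrite /= sub0r normrN; apply: le_trans; exact: ler_norm.
Qed.

(** Choosing one representative point in every nonempty fibre of [q n] turns [f] into a function of
    a countable-valued measurable map, automatically measurable; [f] is the limit of such functions
    as the precision tends to 0. *)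
Lemma nearby_measurable (q : nat -> Omega -> nat) f :
  (forall n c, measurable (q n @^-1` [set c])) ->
  (forall e, 0 < e -> exists n, forall w w', q n w = q n w' -> `|f w - f w'| <= e) ->
  measurable_fun [set: Omega] f.
Proof.
move=> mq fq.
have /choice[N hN] : forall k : nat, exists n, forall w w',
  q n w = q n w' -> `|f w - f w'| <= k.+1%:R^-1 by move=> k; exact: fq.
pose F k c : R := if pselect (exists w, q (N k) w = c) is left h then f (projT1 (cid h)) else 0.
apply: (@measurable_fun_cvg _ _ _ setT (fun k w => F k (q (N k) w))) => [k|w _].
  move=> _ B mB; rewrite setTI.
  exact: (@measurable_nat_preimage (q (N k)) (F k @^-1` B)).
apply/cvgrPdist_le => e e0; near=> k.
rewrite /F; case: pselect => [h|[]]; last by exists w.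
case: cid => w' /= w'w; rewrite (le_trans (hN k _ _ (esym w'w)))//.
rewrite ltW//; near: k; exact: (near_infty_natSinv_lt (PosNum e0)).
Unshelve. all: by end_near. Qed.

(* The two discretised laws, weighted by u and v, agree cell by cell; truncating
   to finitely many cells reduces the claim to a finite sum. *)
Lemma Ex_transfer (q r : nat -> Omega -> nat) u v f g :
  bounded_measurable u -> bounded_measurable v ->
  bounded_measurable f -> bounded_measurable g ->
  (forall w, `|u w| <= 1) -> (forall w, `|v w| <= 1) ->
  (forall n c, measurable (q n @^-1` [set c])) ->
  (forall n c, measurable (r n @^-1` [set c])) ->
  (forall n c, Ex (fun w => u w * (q n w == c)%:R) =
               Ex (fun w => v w * (r n w == c)%:R)) ->
  (forall e, 0 < e -> exists n,
     [/\ forall w w', q n w = r n w' -> `|f w - g w'| <= e,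
         forall w w', q n w = q n w' -> `|f w - f w'| <= e &
         forall w w', r n w = r n w' -> `|g w - g w'| <= e]) ->
  Ex (fun w => u w * f w) = Ex (fun w => v w * g w).
Proof.
move=> bu bv bf bg u1 v1 mq mr qr fg.
have [_ [Bf fB]] := bf; have [_ [Bg gB]] := bg.
pose B := Num.max 0 (Num.max Bf Bg).
have B0 : 0 <= B by rewrite le_max lexx.
apply/eqP; rewrite -subr_eq0 -normr_le0; apply/ler_addgt0Pr => e e0; rewrite add0r.
(* Each side costs [e'] for replacing the function by its cell value and [e' * B] for discarding the
   tail; the two sides together cost [2 * e' * (1 + B) = e]. *)
pose e' := e / (2 * (1 + B)).
have e'0 : 0 < e' by rewrite divr_gt0// mulr_gt0// ltr_pwDl.
have [n [hqr hqq hrr]] := fg _ e'0.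
(* One cell function serves both sides: a value of [f] where [q n] meets the cell, otherwise a value
   of [g]. If both meet it, the cross condition between [f] and [g] makes the choice suit [g]
   too. *)
pose F c : R := if pselect (exists w, q n w = c) is left h then f (projT1 (cid h))
  else if pselect (exists w, r n w = c) is left h then g (projT1 (cid h)) else 0.
have FB c : `|F c| <= B.
  rewrite /F; case: pselect => h.
    by rewrite (le_trans (fB _))// /B !le_max lexx orbT.
  case: pselect => h'; last by rewrite normr0.
  by rewrite (le_trans (gB _))// /B !le_max lexx !orbT.
have fF w : `|f w - F (q n w)| <= e'.
  rewrite /F; case: pselect => [h|[]]; last by exists w.
  by case: cid => w' /= w'w; exact/hqq/esym.
have gF w : `|g w - F (r n w)| <= e'.
  rewrite /F; case: pselect => [h|_].
    by case: cid => w' /= w'w; rewrite distrC; exact: hqr.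
  case: pselect => [h|[]]; last by exists w.
  by case: cid => w' /= w'w; exact/hrr/esym.
have [m1 hm1] := prob_tail e'0 (mq n); have [m2 hm2] := prob_tail e'0 (mr n).
pose m := maxn m1 m2.
have btail (p : nat -> Omega -> nat) : (forall n c, measurable (p n @^-1` [set c])) ->
    bounded_measurable (fun w => (m <= p n w)%N%:R).
  move=> mp; apply: bounded_measurable_bool.
  exact: (@measurable_nat_preimage (p n) [set k | (m <= k)%N]).
have bcell (p : nat -> Omega -> nat) c : (forall n c, measurable (p n @^-1` [set c])) ->
    bounded_measurable (fun w => (p n w == c)%:R).
  move=> mp; apply: bounded_measurable_bool.
  rewrite (_ : [set w | _] = p n @^-1` [set c]); first exact: mp.
  by apply/seteqP; split=> w /= /eqP.
have key (p : nat -> Omega -> nat) (a h : Omega -> R) :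
    (forall n c, measurable (p n @^-1` [set c])) ->
    bounded_measurable a -> (forall w, `|a w| <= 1) -> bounded_measurable h ->
    (forall w, `|h w - F (p n w)| <= e') -> Ex (fun w => (m <= p n w)%N%:R) <= e' ->
    `|Ex (fun w => a w * h w) - \sum_(c < m) F c * Ex (fun w => a w * (p n w == c)%:R)|
      <= e' * (1 + B).
  move=> mp ba a1 bh hF pe.
  have -> : \sum_(c < m) F c * Ex (fun w => a w * (p n w == c)%:R) =
      Ex (fun w => \sum_(c < m) F c * (a w * (p n w == c)%:R)).
    rewrite Ex_sum => [|c].
      by apply: eq_bigr => c _; rewrite ExZ//; apply: bounded_measurableM => //; exact: bcell.
    apply: bounded_measurableM; first exact: bounded_measurable_cst.
    by apply: bounded_measurableM => //; exact: bcell.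
  have bs : bounded_measurable (fun w => \sum_(c < m) F c * (a w * (p n w == c)%:R)).
    apply: bounded_measurable_sum => c.
    apply: bounded_measurableM; first exact: bounded_measurable_cst.
    by apply: bounded_measurableM => //; exact: bcell.
  have bah := bounded_measurableM ba bh.
  rewrite -ExB//.
  apply: (@le_trans _ _ (Ex (fun w => e' + B * (m <= p n w)%N%:R))); last first.
    rewrite ExD; last 2 first.
    - exact: bounded_measurable_cst.
    - by apply: bounded_measurableM; [exact: bounded_measurable_cst|exact: btail].
    rewrite Ex_cst ExZ; last exact: btail.
    by rewrite mulrDr mulr1 lerD2l mulrC ler_wpM2r.
  apply: Ex_norm_le; first exact: bounded_measurableB.
    apply: bounded_measurableD; first exact: bounded_measurable_cst.
    by apply: bounded_measurableM; [exact: bounded_measurable_cst|exact: btail].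
  (* At a given point the sum has at most one nonzero term, that of the cell of the point, and none
     when its code is beyond the truncation. *)
  move=> w; have -> : \sum_(c < m) F c * (a w * (p n w == c)%:R) =
      a w * (F (p n w) * (p n w < m)%N%:R).
    case: ltnP => pm.
      rewrite (bigD1 (Ordinal pm))//= eqxx big1 => [|c]; first by rewrite addr0 !mulr1 mulrC.
      by rewrite -val_eqE/= eq_sym => /negbTE ->; rewrite !mulr0.
    rewrite !mulr0 big1// => c _; rewrite gtn_eqF ?mulr0//.
    exact: leq_trans (ltn_ord c) pm.
  rewrite -mulrBr normrM.
  apply: (@le_trans _ _ (1 * `|h w - F (p n w) * (p n w < m)%N%:R|)).
    by rewrite ler_wpM2r.
  rewrite mul1r; have := hF w; case: ltnP => _; rewrite ?mulr1 ?mulr0 ?addr0//.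
  rewrite subr0 => hw; have := FB (p n w).
  have := ler_normD (h w - F (p n w)) (F (p n w)); rewrite subrK; lra.
have k1 := key q u f mq bu u1 bf fF (hm1 m (leq_maxl _ _)).
have k2 := key r v g mr bv v1 bg gF (hm2 m (leq_maxr _ _)).
have eqs : \sum_(c < m) F c * Ex (fun w => u w * (q n w == c)%:R) =
    \sum_(c < m) F c * Ex (fun w => v w * (r n w == c)%:R).
  by apply: eq_bigr => c _; rewrite qr.
rewrite eqs in k1.
have ee : e' * (1 + B) = e / 2 by rewrite /e'; field; rewrite gt_eqF// ltr_pwDl.
rewrite ee in k1 k2; rewrite distrC in k2.
by apply: (le_trans (ler_distD _ _ _) (le_trans (lerD k1 k2) _)); lra.
Qed.

End Expectation.

(** * Cells of initial data and independence *)

Section Cells.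
Context (R : realType) (d : nat).
Local Notation phase := (phase R d).

(** Cubes of side 1 / (n + 1) in phase space. The labels are tuples of integers, so that they form a
    countable type and can be encoded by natural numbers. *)
Definition cell (n : nat) (z : phase) : {ffun 'I_d -> int * int} :=
  [ffun k => (Num.floor (z.1 0 k * n.+1%:R), Num.floor (z.2 0 k * n.+1%:R))].

Lemma floor_close (n : nat) (x y : R) :
  Num.floor (x * n.+1%:R) = Num.floor (y * n.+1%:R) -> `|x - y| <= n.+1%:R^-1.
Proof.
move=> xy; have n0 : 0 < n.+1%:R :> R by rewrite ltr0n.
rewrite -[_^-1]mul1r ler_pdivlMr// -{1}[n.+1%:R]gtr0_norm// -normrM mulrBl.
have /andP[] := floor_itv (x * n.+1%:R); have /andP[] := floor_itv (y * n.+1%:R).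
rewrite xy intrD; move=> *; rewrite ler_norml; apply/andP; split; lra.
Qed.

Lemma cell_close n (z z' : phase) k : cell n z = cell n z' ->
  `|z.1 0 k - z'.1 0 k| <= n.+1%:R^-1 /\ `|z.2 0 k - z'.2 0 k| <= n.+1%:R^-1.
Proof.
by move=> /ffunP/(_ k); rewrite !ffunE => -[h1 h2]; split; exact: floor_close.
Qed.

Definition close (r : R) (z z' : phase) : Prop :=
  forall k, `|z.1 0 k - z'.1 0 k| <= r /\ `|z.2 0 k - z'.2 0 k| <= r.

Lemma close_le r s (z z' : phase) : r <= s -> close r z z' -> close s z z'.
Proof. by move=> rs zz' k; have [h1 h2] := zz' k; split; exact: le_trans rs. Qed.

Lemma fine_cells (r : R) : 0 < r -> exists n, forall z z' : phase,
  cell n z = cell n z' -> close r z z'.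
Proof.
move=> r0; have [n _ /(_ n (leqnn n))/= hn] := near_infty_natSinv_lt (PosNum r0).
exists n => z z' zz' k; have [h1 h2] := cell_close k zz'.
by split; apply: le_trans (ltW hn).
Qed.

Lemma measurable_phase_continuous (f : ('rV[R]_d * 'rV[R]_d)%type -> R) :
  continuous f -> measurable_fun [set: phase] f.
Proof.
move=> cf; apply: (measurability _ (RGenOInfty.measurableE R)) => _ [_ [x ->] <-].
rewrite setTI; apply: sub_sigma_algebra.
by move/continuousP : cf; apply; exact: interval_open.
Qed.

Lemma measurable_floor_fiber (f : phase -> R) (a : R) (c : int) :
  measurable_fun [set: phase] f ->
  measurable [set z | Num.floor (f z * a) = c].
Proof.
move=> mf.
have mfa : measurable_fun [set: phase] (fun z => f z * a).
  by apply: measurable_funM => //; exact: measurable_cst.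
rewrite (_ : [set z | _] = [set: phase] `&` (fun z => f z * a) @^-1` `[c%:~R, (c + 1)%:~R[).
  by apply: mfa => //; exact: measurable_itv.
rewrite setTI; apply/seteqP; split=> z /=; rewrite in_itv/=.
  by move=> <-; exact: floor_itv.
by move=> h; exact: floor_def.
Qed.

Lemma measurable_cell n c : measurable [set z : phase | cell n z = c].
Proof.
rewrite (_ : [set z | _] = \bigcap_(k in [set: 'I_d])
   ([set z : phase | Num.floor (z.1 0 k * n.+1%:R) = (c k).1] `&`
    [set z : phase | Num.floor (z.2 0 k * n.+1%:R) = (c k).2])); last first.
  apply/seteqP; split=> z /=.
    by move=> <- k _; rewrite /= ffunE.
  move=> h; apply/ffunP => k; rewrite ffunE; have [] := h k I.
  by move=> /= -> ->; case: (c k).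
apply: fin_bigcap_measurable => [|k _]; first exact: finite_finset.
apply: measurableI; apply: (@measurable_floor_fiber (fun z : phase => _)).
  apply: (@measurable_phase_continuous (fun z => z.1 0 k)) => z.
  by apply: (@continuous_comp _ _ _ fst (fun M : 'rV[R]_d => M 0 k));
    [exact: cvg_fst|exact: coord_continuous].
apply: (@measurable_phase_continuous (fun z => z.2 0 k)) => z.
by apply: (@continuous_comp _ _ _ snd (fun M : 'rV[R]_d => M 0 k));
  [exact: cvg_snd|exact: coord_continuous].
Qed.

Context (disp : measure_display) (Omega : measurableType disp) (N : nat).
Implicit Types (Z : 'I_N -> Omega -> phase)
  (X : nat -> Omega -> {set {set 'I_N}}).

Definition code Z X (M n : nat) (w : Omega) : nat :=
  pickle ([ffun i => cell n (Z i w)], [ffun m : 'I_M => X m w]).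

Lemma code_eq Z X Z' X' M n w w' : code Z X M n w = code Z' X' M n w' ->
  (forall i, cell n (Z i w) = cell n (Z' i w')) /\
  (forall m, (m < M)%N -> X m w = X' m w').
Proof.
move=> /(pcan_inj pickleK)[/ffunP h1 /ffunP h2]; split=> [i|m mM].
  by have := h1 i; rewrite !ffunE.
by have := h2 (Ordinal mM); rewrite !ffunE.
Qed.

Definition fiber Z X M n (a : 'I_N -> {ffun 'I_d -> int * int})
    (D : nat -> {set {set 'I_N}}) : set Omega :=
  [set w | (forall i, cell n (Z i w) = a i) /\
           (forall m, m \in iota 0 M -> X m w = D m)].

(** A number that encodes nothing has an empty fibre. The alternative and the data [a], [D] do not
    depend on [Z] and [X], so the same code can be compared for the original and the relabelled
    randomness. *)
Lemma code_fiber M n c :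
  (forall Z X, code Z X M n @^-1` [set c] = set0) \/
  exists a D, forall Z X, code Z X M n @^-1` [set c] = fiber Z X M n a D.
Proof.
pose T := ({ffun 'I_N -> {ffun 'I_d -> int * int}} *
  {ffun 'I_M -> {set {set 'I_N}}})%type.
case E : (@pickle_inv T c) => [[a D]|]; last first.
  left=> Z X; apply/seteqP; split=> // w /= wc; move: E.
  by rewrite -wc pickleK_inv.
(* The value at indices from [M] on is a default: [fiber] reads only the indices below [M]. *)
right; exists a, (fun m => if insub m is Some o then D o else finset.set0) => Z X.
have cE : pickle ((a, D) : T) = c by have := @pickle_invK T c; rewrite E.
apply/seteqP; split=> w /=.
  rewrite -cE => /(pcan_inj pickleK)[<- <-]; split=> [i|m]; first by rewrite ffunE.
  rewrite mem_iota add0n => mM; rewrite insubT.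
  by rewrite ffunE.
move=> [h1 h2]; rewrite -cE; congr (pickle (_, _)); apply/ffunP => x; rewrite ffunE//.
by rewrite h2 ?mem_iota//= valK.
Qed.

Lemma measurable_fiber Z X M n a D : (forall i, measurable_fun setT (Z i)) ->
  (forall m D, measurable (X m @^-1` [set D])) -> measurable (fiber Z X M n a D).
Proof.
move=> mZ mX.
rewrite (_ : fiber _ _ _ _ _ _ = \bigcap_(i in [set: 'I_N]) (setT `&` Z i @^-1` [set z | cell n z = a i])
   `&` \bigcap_(m in [set: 'I_M]) (X m @^-1` [set D m])); last first.
  apply/seteqP; split=> w /= [h1 h2]; split.
  - by move=> i _; split=> //; exact: h1.
  - by move=> m _; apply: h2; rewrite mem_iota/=.
  - by move=> i; have [] := h1 i I.
  - by move=> m; rewrite mem_iota add0n => mM; exact: (h2 (Ordinal mM) I).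
apply: measurableI; apply: fin_bigcap_measurable => //; try exact: finite_finset.
by move=> i _; apply: mZ => //; exact: measurable_cell.
Qed.

Lemma measurable_code Z X M n c : (forall i, measurable_fun setT (Z i)) ->
  (forall m D, measurable (X m @^-1` [set D])) ->
  measurable (code Z X M n @^-1` [set c]).
Proof.
move=> mZ mX; have [->//|[a [D ->]]] := code_fiber M n c.
exact: measurable_fiber.
Qed.

End Cells.

(** * Joint law of the initial cells and the divisions *)

Section Law.
Context (R : realType) (d n p : nat) (mu0 : probability (phase R d) R).
Context (disp : measure_display) (Omega : measurableType disp)
        (P : probability Omega R).
Local Notation N := (n * p)%N.
Local Notation Dv := (divisions n p).
Context (Z0 : 'I_N -> Omega -> phase R d) (xi : nat -> Omega -> {set {set 'I_N}}).
Hypotheses (Z0_measurable : forall i, measurable_fun setT (Z0 i))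
  (Z0_law : forall i B, measurable B -> P (Z0 i @^-1` B) = mu0 B)
  (xi_uniform : forall m, uniform_division P (xi m))
  (independence : mutually_independent P (generated_events Z0 xi)).

Lemma joint_law (A : 'I_N -> set (phase R d)) (J : seq nat)
    (D : nat -> {set {set 'I_N}}) : (forall i, measurable (A i)) -> uniq J ->
  P [set w | (forall i, A i (Z0 i w)) /\ (forall m, m \in J -> xi m w = D m)] =
  ((\prod_i mu0 (A i)) * \prod_(m <- J) P (xi m @^-1` [set D m]))%E.
Proof.
move=> mA uJ.
pose F (k : 'I_N + nat) : set Omega :=
  match k with inl i => Z0 i @^-1` A i | inr m => xi m @^-1` [set D m] end.
pose S : seq ('I_N + nat) := [seq inl i | i <- index_enum 'I_N] ++ [seq inr m | m <- J].
have uS : uniq S.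
  rewrite cat_uniq; apply/and3P; split.
  - by rewrite map_inj_uniq ?index_enum_uniq// => ? ? [].
  - by apply/hasPn => _ /mapP[m _ ->]; apply/mapP => -[].
  - by rewrite map_inj_uniq// => ? ? [].
have FS k : k \in S -> generated_events Z0 xi k (F k).
  by case: k => [i|m] _ /=; [exists (A i)|exists [set D m]].
have := independence uS FS.
rewrite big_cat !big_map/=.
under eq_bigr do rewrite Z0_law//.
move=> <-; congr (P _); apply/seteqP; split=> w /=.
  move=> [h1 h2] [i|m] /=; first by move=> _; exact: h1.
  by rewrite mem_cat => /orP[/mapP[]//|/mapP[m' m'J [->]]]; exact: h2.
move=> h; split=> [i|m mJ].
  by apply: (h (inl i)); rewrite /= mem_cat map_f ?mem_index_enum.
by apply: (h (inr m)); rewrite /= mem_cat [X in _ || X]map_f ?orbT.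
Qed.

Lemma xi_measurable m D : measurable (xi m @^-1` [set D]).
Proof. by case: (xi_uniform m D). Qed.

Definition division_mass (D : {set {set 'I_N}}) : R :=
  (D \in Dv)%:R / #|Dv|%:R.

Lemma xi_mass m D : P (xi m @^-1` [set D]) = (division_mass D)%:E.
Proof. by case: (xi_uniform m D). Qed.

Lemma division_mass_relabel s D : division_mass (relabel s D) = division_mass D.
Proof.
by rewrite /division_mass relabel_divisionE.
Qed.

(** Both probabilities are products by independence. Relabelling permutes the factors of the initial
    states, which share the law [mu0], and preserves the uniform mass of each division. *)
Lemma code_fiber_relabel (s : {perm 'I_N}) M k c :
  P (code Z0 xi M k @^-1` [set c]) =
  P (code (fun i => Z0 (s i)) (fun m w => relabel s (xi m w)) M k @^-1` [set c]).
Proof.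
have [h|[a [D h]]] := @code_fiber R d _ Omega N M k c; rewrite !h//.
have -> : fiber (fun i => Z0 (s i)) (fun m w => relabel s (xi m w)) M k a D =
    fiber Z0 xi M k (fun i => a (s^-1%g i)) (fun m => relabel s^-1%g (D m)).
  apply/seteqP; split=> w [h1 h2]; split=> [i|m mM].
  - by rewrite -h1 permKV.
  - by rewrite -h2// relabelK.
  - by rewrite h1 permK.
  - by rewrite h2//; have := relabelK s^-1%g (D m); rewrite invgK.
rewrite !(joint_law (A := fun i => [set z | cell k z = _])) ?iota_uniq//;
  try by move=> i; exact: measurable_cell.
congr (_ * _)%E; last by apply: eq_bigr => m _; rewrite !xi_mass division_mass_relabel.
by rewrite [RHS](reindex_inj (@perm_inj _ s))/=; apply: eq_bigr => i _; rewrite permK.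
Qed.

(* Bounded and uniformly continuous in the initial data; in particular f does
   not depend on the divisions. *)
Definition adapted (f : Omega -> R) : Prop :=
  (exists B, forall w, `|f w| <= B) /\
  (forall e : R, 0 < e -> exists2 r : R, 0 < r & forall w w',
     (forall i, close r (Z0 i w) (Z0 i w')) -> `|f w - f w'| <= e).

Lemma adapted_cells f (e : R) : adapted f -> 0 < e -> exists k, forall w w',
  (forall i, cell k (Z0 i w) = cell k (Z0 i w')) -> `|f w - f w'| <= e.
Proof.
move=> [_ fc] /fc[r r0 hr]; have [k kr] := fine_cells d r0.
by exists k => w w' ww'; apply: hr => i; exact: kr.
Qed.

Lemma adapted_bounded_measurable f : adapted f -> bounded_measurable f.
Proof.
move=> fa; split; last exact: fa.1.
apply: (@nearby_measurable _ _ _ (code Z0 xi 0)) => [k c|e e0].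
  by apply: measurable_code => // *; exact: xi_measurable.
by have [k hk] := adapted_cells fa e0; exists k => w w' /code_eq[h _]; exact: hk.
Qed.

Lemma adapted_cst (c : R) : adapted (fun=> c).
Proof.
split; first by exists `|c|.
by move=> e e0; exists 1 => // w w' _; rewrite subrr normr0 ltW.
Qed.

Lemma adaptedD f g : adapted f -> adapted g -> adapted (fun w => f w + g w).
Proof.
move=> [[A fA] fc] [[B gB] gc]; split.
  by exists (A + B) => w; rewrite (le_trans (ler_normD _ _))// lerD.
move=> e e0; have e2 : 0 < e / 2 by rewrite divr_gt0.
have [r r0 hr] := fc _ e2; have [s s0 hs] := gc _ e2.
exists (Num.min r s); first by rewrite lt_min r0.
move=> w w' ww'; rewrite opprD addrACA (le_trans (ler_normD _ _))// [e]splitr lerD//.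
  by apply: hr => i; apply: close_le (ww' i); rewrite ge_min lexx.
by apply: hs => i; apply: close_le (ww' i); rewrite ge_min lexx orbT.
Qed.

Lemma adaptedM f g : adapted f -> adapted g -> adapted (fun w => f w * g w).
Proof.
move=> [[A fA] fc] [[B gB] gc]; split.
  by exists (A * B) => w; rewrite normrM ler_pM.
move=> e e0; pose C := Num.max 0 (Num.max A B) + 1.
have C0 : 0 < C by rewrite ltr_wpDl// le_max lexx.
have fC w : `|f w| <= C.
  by rewrite (le_trans (fA w))// (@le_trans _ _ (Num.max 0 (Num.max A B)))// ?lerDl// !le_max lexx orbT.
have gC w : `|g w| <= C.
  by rewrite (le_trans (gB w))// (@le_trans _ _ (Num.max 0 (Num.max A B)))// ?lerDl// !le_max lexx !orbT.
have e2 : 0 < e / (2 * C) by rewrite divr_gt0// mulr_gt0.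
have [r r0 hr] := fc _ e2; have [s s0 hs] := gc _ e2.
exists (Num.min r s); first by rewrite lt_min r0.
move=> w w' ww'.
have h1 : `|f w - f w'| <= e / (2 * C).
  by apply: hr => i; apply: close_le (ww' i); rewrite ge_min lexx.
have h2 : `|g w - g w'| <= e / (2 * C).
  by apply: hs => i; apply: close_le (ww' i); rewrite ge_min lexx orbT.
have -> : f w * g w - f w' * g w' = (f w - f w') * g w + f w' * (g w - g w') by ring.
rewrite (le_trans (ler_normD _ _))// !normrM.
apply: (@le_trans _ _ (e / (2 * C) * C + C * (e / (2 * C)))).
  by rewrite lerD// ler_pM.
by rewrite le_eqVlt; apply/orP; left; apply/eqP; field; rewrite gt_eqF.
Qed.

Lemma adapted_sum (I : Type) (s : seq I) (F : I -> Omega -> R) :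
  (forall i, adapted (F i)) -> adapted (fun w => \sum_(i <- s) F i w).
Proof.
move=> aF; elim: s => [|i s ih].
  rewrite (_ : (fun w => _) = fun=> 0); first exact: adapted_cst.
  by apply/funext => w; rewrite big_nil.
rewrite (_ : (fun w => _) = fun w => F i w + \sum_(j <- s) F j w).
  exact: adaptedD.
by apply/funext => w; rewrite big_cons.
Qed.

Lemma xi_event_measurable (J : seq nat) (D : nat -> {set {set 'I_N}}) :
  measurable [set w | all (fun m => xi m w == D m) J].
Proof.
rewrite (_ : [set w | _] = \bigcap_(m in [set` J]) (xi m @^-1` [set D m])).
  by apply: fin_bigcap_measurable => // m _; exact: xi_measurable.
apply/seteqP; split=> w /=; first by move=> /allP h m /= /h/eqP.
by move=> h; apply/allP => m /h/= /eqP.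
Qed.

Lemma division_mass_ge0 D : 0 <= division_mass D.
Proof. by rewrite /division_mass divr_ge0. Qed.

Lemma fine_prodEFin (I : Type) (s : seq I) (F : I -> R) :
  (\prod_(i <- s) (F i)%:E = (\prod_(i <- s) F i)%:E)%E.
Proof. by elim: s => [|i s ih]; rewrite ?big_nil// !big_cons ih EFinM. Qed.

(** Independence is assumed for events only. On each cell of initial data the claim is the product
    formula; [Ex_transfer], with the event as one weight and the constant product of masses as the
    other, extends it to [f], which is nearly constant on fine cells. *)
Lemma Ex_independent (J : seq nat) (D : nat -> {set {set 'I_N}}) f :
  uniq J -> adapted f ->
  Ex P (fun w => (all (fun m => xi m w == D m) J)%:R * f w) =
  (\prod_(m <- J) division_mass (D m)) * Ex P f.
Proof.
move=> uJ fa; have bf := adapted_bounded_measurable fa.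
have mq k c : measurable (code Z0 xi 0 k @^-1` [set c]).
  by apply: measurable_code => // *; exact: xi_measurable.
have bq k c : bounded_measurable (fun w => (code Z0 xi 0 k w == c)%:R : R).
  apply: bounded_measurable_bool; have := mq k c; congr measurable.
  by apply/seteqP; split=> w /= /eqP.
have bJ : bounded_measurable (fun w => (all (fun m => xi m w == D m) J)%:R : R).
  exact/bounded_measurable_bool/xi_event_measurable.
rewrite -ExZ//; apply: (@Ex_transfer _ _ _ P (code Z0 xi 0) (code Z0 xi 0)) => //.
- exact: bounded_measurable_cst.
- by move=> w; case: all; rewrite ?normr1 ?normr0.
- move=> w; rewrite ger0_norm; last by apply: prodr_ge0 => m _; exact: division_mass_ge0.
  apply: prodr_ile1 => m; rewrite division_mass_ge0/= /division_mass.
  case: (D m \in Dv) / boolP => Dd; last by rewrite mul0r.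
  have c0 : (0 < #|Dv|)%N by rewrite finset.card_gt0; apply/finset.set0Pn; exists (D m).
  by rewrite mul1r invf_le1 ?ler1n ?ltr0n.
- move=> k c; rewrite ExZ//.
  have -> : Ex P (fun w => (code Z0 xi 0 k w == c)%:R) = fine (P (code Z0 xi 0 k @^-1` [set c])).
    rewrite Ex_bool; last by have := mq k c; congr measurable; apply/seteqP; split=> w /= /eqP.
    by congr (fine (P _)); apply/seteqP; split=> w /= /eqP.
  under [fun w => _ * _]eq_fun do rewrite -natrM mulnb.
  rewrite Ex_bool; last first.
    rewrite (_ : [set w | _] = [set w | all (fun m => xi m w == D m) J] `&`
      code Z0 xi 0 k @^-1` [set c]); first by apply: measurableI => //; exact: xi_event_measurable.
    by apply/seteqP; split=> w /= => [/andP[? /eqP]|[? /eqP ?]]//; apply/andP.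
  have [h|[a [D' h]]] := @code_fiber R d _ Omega N 0 k c.
    rewrite h measure0 mulr0 (_ : [set w | _] = set0) ?measure0//.
    apply/seteqP; split=> // w /= /andP[_ /eqP wc].
    by have : (code Z0 xi 0 k @^-1` [set c]) w by []; rewrite h.
  rewrite h.
  have -> : [set w | all (fun m => xi m w == D m) J && (code Z0 xi 0 k w == c)] =
    [set w | (forall i, [set z | cell k z = a i] (Z0 i w)) /\ (forall m, m \in J -> xi m w = D m)].
    apply/seteqP; split=> w /=.
      move=> /andP[/allP hJ /eqP wc]; split; last by move=> m /hJ/eqP.
      have : (code Z0 xi 0 k @^-1` [set c]) w by [].
      by rewrite h => -[].
    move=> [h1 h2]; apply/andP; split; first by apply/allP => m /h2 /eqP.
    have : (code Z0 xi 0 k @^-1` [set c]) w by rewrite h; split=> // m; rewrite in_nil.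
    by move=> /= ->.
  rewrite (@joint_law (fun i => [set z | cell k z = a i]) J D)//; last first.
    by move=> i; exact: measurable_cell.
  rewrite /fiber (@joint_law (fun i => [set z | cell k z = a i]) [::] D')//; last first.
    by move=> i; exact: measurable_cell.
  rewrite big_nil mule1; under [X in (_ * X)%E]eq_bigr do rewrite xi_mass.
  rewrite fine_prodEFin fineM//=; first by rewrite mulrC.
  by apply: prode_fin_num => i _; apply: fin_num_measure; exact: measurable_cell.
- move=> e e0; have [k hk] := adapted_cells fa e0.
  by exists k; split=> w w' /code_eq[h _]; exact: hk.
Qed.

End Law.

(** * Exchangeability and decorrelation of the noise *)

Section Decoupling.
Context (R : realType) (d n p : nat) (mu0 : probability (phase R d) R).
Context (disp : measure_display) (Omega : measurableType disp)
        (P : probability Omega R).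
Local Notation N := (n * p)%N.
Local Notation Dv := (divisions n p).
Context (Z0 : 'I_N -> Omega -> phase R d) (xi : nat -> Omega -> {set {set 'I_N}}).
Hypotheses (Z0_measurable : forall i, measurable_fun setT (Z0 i))
  (Z0_law : forall i B, measurable B -> P (Z0 i @^-1` B) = mu0 B)
  (xi_uniform : forall m, uniform_division P (xi m))
  (independence : mutually_independent P (generated_events Z0 xi)).
Hypotheses (p2 : (2 <= p)%N) (n1 : (1 <= n)%N).

Lemma near_data_measurable M (f : Omega -> R) :
  (forall e : R, 0 < e -> exists2 r : R, 0 < r & forall w w',
     (forall i, close r (Z0 i w) (Z0 i w')) ->
     (forall m, (m < M)%N -> xi m w = xi m w') -> `|f w - f w'| <= e) ->
  measurable_fun [set: Omega] f.
Proof.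
move=> fc; apply: (@nearby_measurable _ _ _ (code Z0 xi M)) => [k c|e e0].
  by apply: measurable_code => // *; exact: (xi_measurable xi_uniform).
have [r r0 hr] := fc _ e0; have [k kr] := fine_cells d r0.
by exists k => w w' /code_eq[h1 h2]; apply: hr => // i; exact: kr.
Qed.

(** [Ex_transfer] with unit weights, between the code of the actual data and that of the data
    relabelled by [s], which have the same law. The three conditions say that [g] is [f] read after
    relabelling, and that each is continuous in the data. *)
Lemma Ex_exchange (s : {perm 'I_N}) M (f g : Omega -> R) :
  bounded_measurable f -> bounded_measurable g ->
  (forall e : R, 0 < e -> exists2 r : R, 0 < r & forall w w',
    [/\ (forall i, close r (Z0 i w) (Z0 (s i) w')) ->
        (forall m, (m < M)%N -> xi m w = relabel s (xi m w')) ->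
        `|f w - g w'| <= e,
        (forall i, close r (Z0 i w) (Z0 i w')) ->
        (forall m, (m < M)%N -> xi m w = xi m w') -> `|f w - f w'| <= e &
        (forall i, close r (Z0 i w) (Z0 i w')) ->
        (forall m, (m < M)%N -> xi m w = xi m w') -> `|g w - g w'| <= e]) ->
  Ex P f = Ex P g.
Proof.
move=> bf bg fg.
have b1 : bounded_measurable (fun _ : Omega => 1 : R) by exact: bounded_measurable_cst.
have mxi m D : measurable (xi m @^-1` [set D]) by exact: (xi_measurable xi_uniform).
have mq k c : measurable (code Z0 xi M k @^-1` [set c]) by exact: measurable_code.
have mr k c : measurable (code (fun i => Z0 (s i)) (fun m w => relabel s (xi m w)) M k
    @^-1` [set c]).
  apply: measurable_code => // m D.
  rewrite (_ : _ @^-1` _ = xi m @^-1` [set relabel s^-1%g D])//.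
  apply/seteqP; split=> w /= => [<-|->]; first by rewrite relabelK.
  by have := relabelK s^-1%g D; rewrite invgK.
have cellE (q : nat -> Omega -> nat) k c : measurable (q k @^-1` [set c]) ->
    Ex P (fun w => 1 * (q k w == c)%:R) = fine (P (q k @^-1` [set c])).
  move=> mqk; have E : [set w | q k w == c] = q k @^-1` [set c].
    by apply/seteqP; split=> w /= /eqP.
  under [fun w => _ * _]eq_fun do rewrite mul1r.
  by rewrite Ex_bool E.
have := @Ex_transfer _ _ _ P (code Z0 xi M)
  (code (fun i => Z0 (s i)) (fun m w => relabel s (xi m w)) M)
  (fun=> 1) (fun=> 1) f g b1 b1 bf bg.
under [fun w => _ * f w]eq_fun do rewrite mul1r.
under [fun w => _ * g w]eq_fun do rewrite mul1r.
apply=> //.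
- by move=> w; rewrite normr1.
- by move=> w; rewrite normr1.
- move=> k c; rewrite !cellE//.
  by rewrite (code_fiber_relabel Z0_law xi_uniform independence s).
- move=> e e0; have [r r0 hr] := fg _ e0; have [k kr] := fine_cells d r0.
  exists k; split=> w w' /code_eq[h1 h2]; have [c1 c2 c3] := hr w w'.
  + by apply: c1 => // i; exact: kr.
  + by apply: c2 => // i; exact: kr.
  (* Two points with the same relabelled code have the same original data, because relabelling is
     injective on divisions and permutes the cells. *)
  + apply: c3 => [i|m mM]; last exact/(@relabel_inj n p s)/h2.
    by apply: kr; rewrite -[i](permKV s); exact: h1.
Qed.

Lemma adapted_noise D i (G : 'I_N -> Omega -> R) : (forall j, adapted Z0 (G j)) ->
  adapted Z0 (fun w => noise D i (G ^~ w)).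
Proof.
move=> aG; apply: (adapted_sum (index_enum _)) => j.
by apply: adaptedM => //; exact: adapted_cst.
Qed.

(** Splitting over the finitely many values of [xi m] makes the division deterministic in each term,
    so that conditioning on it becomes a finite sum. *)
Lemma xi_partition m (F : {set {set 'I_N}} -> R) w :
  F (xi m w) = \sum_D (xi m w == D)%:R * F D.
Proof.
rewrite (bigD1 (xi m w))//= eqxx mul1r big1 ?addr0// => D.
by rewrite eq_sym => /negbTE ->; rewrite mul0r.
Qed.

Lemma sum_division_mass (F : {set {set 'I_N}} -> R) :
  \sum_D division_mass R D * F D = #|Dv|%:R^-1 * \sum_(D in Dv) F D.
Proof.
rewrite mulr_sumr [RHS]big_mkcond/=; apply: eq_bigr => D _.
by rewrite /division_mass; case: (D \in Dv); rewrite ?mul1r// !mul0r.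
Qed.

Let bnd f : adapted Z0 f -> bounded_measurable f.
Proof. exact: (adapted_bounded_measurable Z0_measurable xi_uniform). Qed.

Let bxi m D : bounded_measurable (fun w => (xi m w == D)%:R : R).
Proof.
apply: bounded_measurable_bool.
have := xi_measurable xi_uniform m D; congr measurable.
by apply/seteqP; split=> w /= /eqP.
Qed.

Lemma bounded_measurable_noise m i (G : 'I_N -> Omega -> R) :
  (forall j, adapted Z0 (G j)) ->
  bounded_measurable (fun w => noise (xi m w) i (G ^~ w)).
Proof.
move=> aG; rewrite (_ : (fun w => _) =
    fun w => \sum_D (xi m w == D)%:R * noise D i (G ^~ w)).
  apply: bounded_measurable_sum => D; apply: bounded_measurableM => //.
  exact/bnd/adapted_noise.
by apply/funext => w; rewrite (xi_partition m (fun D => noise D i (G ^~ w))).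
Qed.

(** After splitting over the values [D], [D'] of both divisions, independence replaces their
    indicators by masses. The sums can then be taken back inside the expectation, where at each
    point they form a product of two averages over all divisions, zero by [sum_noise]. *)
Lemma noise_uncorrelated m m' i (G G' : 'I_N -> Omega -> R) : m != m' ->
  (forall j, adapted Z0 (G j)) -> (forall j, adapted Z0 (G' j)) ->
  Ex P (fun w => noise (xi m w) i (G ^~ w) * noise (xi m' w) i (G' ^~ w)) = 0.
Proof.
move=> mm' aG aG'.
pose g D w := noise D i (G ^~ w); pose g' D w := noise D i (G' ^~ w).
have ag D : adapted Z0 (g D) by exact: adapted_noise.
have ag' D : adapted Z0 (g' D) by exact: adapted_noise.
have agg D D' := adaptedM (ag D) (ag' D').
rewrite (_ : (fun w => _) = fun w => \sum_D \sum_D'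
    (all (fun l => xi l w == (if l == m then D else D')) [:: m; m'])%:R *
    (g D w * g' D' w)); last first.
  apply/funext => w; rewrite (xi_partition m (fun D => noise D i (G ^~ w))).
  rewrite (xi_partition m' (fun D => noise D i (G' ^~ w))) mulr_suml.
  apply: eq_bigr => D _; rewrite mulr_sumr; apply: eq_bigr => D' _.
  rewrite /= eqxx [m' == m]eq_sym (negbTE mm') andbT /g /g'.
  by case: (xi m w == D); case: (xi m' w == D'); rewrite /= ?mul1r ?mul0r ?mulr0.
have bt D D' : bounded_measurable (fun w =>
    (all (fun l => xi l w == (if l == m then D else D')) [:: m; m'])%:R *
    (g D w * g' D' w)).
  apply: bounded_measurableM; last exact/bnd/agg.
  by apply: bounded_measurable_bool; exact: (xi_event_measurable xi_uniform).
rewrite Ex_sum; last by move=> D; exact: bounded_measurable_sum.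
under eq_bigr => D _.
  rewrite Ex_sum//.
  under eq_bigr => D' _.
    rewrite (Ex_independent Z0_measurable Z0_law xi_uniform independence); last 2 first.
    - by rewrite /= inE mm'.
    - exact: agg.
    rewrite !big_cons big_nil eqxx [m' == m]eq_sym (negbTE mm') mulr1.
    rewrite -ExZ; last exact/bnd/agg.
    over.
  rewrite -Ex_sum; last first.
    by move=> D'; apply: bounded_measurableM; [exact: bounded_measurable_cst|exact/bnd/agg].
  over.
rewrite -Ex_sum; last first.
  move=> D; apply: bounded_measurable_sum => D'.
  by apply: bounded_measurableM; [exact: bounded_measurable_cst|exact/bnd/agg].
rewrite (_ : (fun w => _) = fun=> 0) ?Ex_cst//; apply/funext => w.
transitivity ((\sum_D division_mass R D * g D w) * (\sum_D division_mass R D * g' D w)).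
  rewrite mulr_suml; apply: eq_bigr => D _; rewrite mulr_sumr.
  by apply: eq_bigr => D' _; ring.
by rewrite sum_division_mass sum_noise// mulr0 mul0r.
Qed.

(** The same splitting over a single division reduces the second moment to the average over
    divisions at a fixed point of Omega, which [sum_noise_sqr] bounds. *)
Lemma noise_variance m i (G : 'I_N -> Omega -> R) (A : R) :
  (forall j, adapted Z0 (G j)) -> (forall j w, `|G j w| <= A) ->
  Ex P (fun w => noise (xi m w) i (G ^~ w) ^+ 2) <= A ^+ 2 / (p%:R - 1).
Proof.
move=> aG GA; pose g D w := noise D i (G ^~ w).
have ag D : adapted Z0 (g D) by exact: adapted_noise.
have agg D := adaptedM (ag D) (ag D).
rewrite (_ : (fun w => _) = fun w => \sum_D
    (all (fun l => xi l w == D) [:: m])%:R * (g D w * g D w)); last first.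
  apply/funext => w; rewrite (xi_partition m (fun D => noise D i (G ^~ w) ^+ 2)).
  by apply: eq_bigr => D _; rewrite /= andbT.
have bt D : bounded_measurable (fun w =>
    (all (fun l => xi l w == D) [:: m])%:R * (g D w * g D w)).
  apply: bounded_measurableM; last exact/bnd/agg.
  by apply: bounded_measurable_bool; exact: (xi_event_measurable xi_uniform _ (fun=> D)).
rewrite Ex_sum//.
under eq_bigr => D _.
  rewrite (Ex_independent Z0_measurable Z0_law xi_uniform independence (fun=> D))//.
  rewrite big_cons big_nil mulr1 -ExZ; last exact/bnd/agg.
  over.
have bgg D : bounded_measurable (fun w => division_mass R D * (g D w * g D w)).
  by apply: bounded_measurableM; [exact: bounded_measurable_cst|exact/bnd/agg].
rewrite -Ex_sum// -[leRHS](Ex_cst P); apply: le_Ex.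
- exact: bounded_measurable_sum.
- exact: bounded_measurable_cst.
move=> w; rewrite (sum_division_mass (fun D => g D w * g D w)).
have p1 := natrB1_gt0 R p2.
have B0 : 0 <= A ^+ 2 / (p%:R - 1) by rewrite divr_ge0 ?sqr_ge0// ltW.
have [->|c0] := eqVneq (#|Dv|) 0%N; first by rewrite invr0 mul0r.
rewrite mulrC ler_pdivrMr ?ltr0n ?lt0n// mulrC.
exact: (sum_noise_sqr p2 n1 i (fun j => GA j w)).
Qed.

Lemma total_noise_sqr M0 i (G : nat -> 'I_N -> Omega -> R) (A : nat -> R) :
  (forall m j, adapted Z0 (G m j)) -> (forall m j w, `|G m j w| <= A m) ->
  Ex P (fun w => (\sum_(m < M0) noise (xi m w) i (fun j => G m j w)) ^+ 2)
  <= (\sum_(m < M0) A m ^+ 2) / (p%:R - 1).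
Proof.
move=> aG GA.
have bn m : bounded_measurable (fun w => noise (xi m w) i (fun j => G m j w)).
  exact: bounded_measurable_noise.
rewrite (_ : (fun w => _) = fun w => \sum_(m < M0) \sum_(m' < M0)
   noise (xi m w) i (fun j => G m j w) * noise (xi m' w) i (fun j => G m' j w)).
  rewrite Ex_sum => [|m]; last first.
    by apply: bounded_measurable_sum => m'; exact: bounded_measurableM.
  rewrite mulr_suml; apply: ler_sum => m _.
  rewrite Ex_sum => [|m']; last exact: bounded_measurableM.
  rewrite (bigD1 m)//= big1 ?addr0.
    exact: noise_variance.
  by move=> m' m'm; apply: noise_uncorrelated => //; rewrite eq_sym.
apply/funext => w; rewrite expr2 mulr_suml; apply: eq_bigr => m _.
by rewrite mulr_sumr.
Qed.

End Decoupling.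

(** * Total noise along a trajectory *)

Section Antiderivative.
Context (R : realType).

Lemma antiderivative (f : R -> R) : cont0 f ->
  exists2 H : R -> R, continuous H & forall t, 0 <= t -> rder H t (f t).
Proof.
move=> cf; pose f0 t := f (Num.max 0 t).
(* Integrating from -1 puts time 0 in the interior of the interval, where the fundamental theorem of
   calculus gives a two-sided derivative. *)
pose F (x : R) : R := \int[@lebesgue_measure R]_(t in `[-1, x]) f0 t.
have dF (x : R) : 0 <= x -> is_derive x (1 : R) F (f0 x).
  move=> x0; have [] := @continuous_FTC1_closed R f0 (-1) x (x + 1) _ _ _ _.
  - by rewrite ltrDl.
  - apply: continuous_compact_integrable; first exact: segment_compact.
    exact: continuous_subspaceT.
  - by rewrite (lt_le_trans _ x0)// ltrN10.
  - exact: cf.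
  by rewrite derive1E => h1 h2; rewrite -h2; exact: DeriveDef.
exists (fun t => F (Num.max 0 t)) => [t|t t0].
  apply: continuous_comp; first exact: continuous_max0.
  apply: differentiable_continuous; apply/derivable1_diffP.
  by case: (@dF (Num.max 0 t)) => //; rewrite le_max lexx.
apply: (@rder_near _ _ F); first by rewrite max_r.
- near=> s; have ts : t < s by near: s; exact: nbhs_right_gt.
  by rewrite max_r// (le_trans t0 (ltW ts)).
- by have := is_derive_rder (dF t t0); rewrite /f0 max_r.
Unshelve. all: by end_near. Qed.

Lemma continuous_min_comp (H : R -> R) (c : R) : continuous H ->
  continuous (fun r => H (Num.min c r)).
Proof.
move=> cH t; apply: (@continuous_comp _ _ _ (fun r => Num.min c r) H); last exact: cH.
have -> : (fun r : R => Num.min c r) = (fun r => c - Num.max 0 (c - r)).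
  apply/funext => r; have [h|/ltW h] := leP c r.
    by rewrite max_l ?subr0// subr_le0.
  by rewrite max_r ?subr_ge0// subKr.
apply: cvgB; first exact: cvg_cst.
apply: (@continuous_comp _ _ _ (fun r : R => c - r) (Num.max 0)); last exact: continuous_max0.
by apply: cvgB; [exact: cvg_cst|exact: cvg_id].
Qed.

(** For [H] an antiderivative of [h] and [0 <= r], the integral of [h] over the part of the step
    from m tau to (m + 1) tau that lies before [r]: it is zero, then grows, then stays frozen. *)
Definition increment (tau : R) (H : R -> R) (m : nat) (r : R) : R :=
  H (Num.min (m.+1%:R * tau) r) - H (Num.min (m%:R * tau) r).

Lemma continuous_increment tau H m : continuous H -> continuous (increment tau H m).
Proof. by move=> cH t; apply: cvgB; exact: continuous_min_comp. Qed.

Lemma rder_increment (tau : R) (H : R -> R) (h : R) (m m' : nat) (r : R) :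
  0 < tau -> m%:R * tau <= r -> r < m.+1%:R * tau -> rder H r h ->
  rder (increment tau H m') r (if m' == m then h else 0).
Proof.
move=> tau0 mr rm dH.
have le k l : (k <= l)%N -> k%:R * tau <= l%:R * tau by move=> kl; rewrite ler_pM2r// ler_nat.
have near1 : \forall s \near r^'+, r <= s < m.+1%:R * tau.
  by near=> s; apply/andP; split; [apply/ltW|]; near: s;
    [exact: nbhs_right_gt|exact: nbhs_right_lt].
have rr : r <= r < m.+1%:R * tau by rewrite lexx.
suff [g hg dg] : exists2 g, (forall s, r <= s < m.+1%:R * tau -> increment tau H m' s = g s)
    & rder g r (if m' == m then h else 0).
  apply: (@rder_near _ _ g) => //; first exact: hg.
  by apply: filterS near1 => s; exact: hg.
case: ltngtP => mm.
- exists (fun=> H (m'.+1%:R * tau) - H (m'%:R * tau)); last exact: rder_cst.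
  move=> s /andP[rs sm]; rewrite /increment !min_l//.
    by rewrite (le_trans (le _ _ (ltnW mm)))// (le_trans mr).
  by rewrite (le_trans (le _ _ mm))// (le_trans mr).
- exists (fun=> 0); last exact: rder_cst.
  move=> s /andP[rs sm]; rewrite /increment !min_r ?subrr//.
    by rewrite (le_trans (ltW sm))// le.
  by rewrite (le_trans (ltW sm))// le// ltnW.
- exists (fun s => H s - H (m%:R * tau)).
    move=> s /andP[rs sm]; rewrite /increment mm min_r ?(ltW sm)// min_l//.
    exact: le_trans rs.
  by rewrite -[h]subr0; apply: rderB => //; exact: rder_cst.
Unshelve. all: by end_near. Qed.

Lemma increment_bound (tau : R) (H h : R -> R) (B : R) m r : 0 < tau -> 0 <= r ->
  continuous H -> (forall t, 0 <= t -> rder H t (h t)) ->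
  (forall t, 0 <= t -> t < r -> `|h t| <= B) ->
  `|increment tau H m r| <=
     B * (Num.min (m.+1%:R * tau) r - Num.min (m%:R * tau) r).
Proof.
move=> tau0 r0 cH dH hB.
have m0 : 0 <= m%:R * tau by rewrite mulr_ge0// ltW.
have mm : m%:R * tau <= m.+1%:R * tau by rewrite ler_pM2r// ler_nat.
apply: rder_lipschitz; first by rewrite le_min m0.
- by rewrite le_min ge_min mm/= ge_min lexx orbT.
- exact: continuous_cont0.
move=> t; rewrite lt_min => mt /andP[_ tr].
have t0 : 0 <= t by rewrite (le_trans _ mt)// le_min m0.
by exists (h t); [exact: hB|exact: dH].
Qed.

(** Each length is at most [tau] and the lengths telescope to at most [r]. The factor [tau] of the
    final bound originates here. *)
Lemma sum_increment_length (tau r : R) M0 : 0 < tau -> 0 <= r ->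
  \sum_(m < M0) (Num.min (m.+1%:R * tau) r - Num.min (m%:R * tau) r) ^+ 2 <= tau * r.
Proof.
move=> tau0 r0.
have mm m : m%:R * tau <= m.+1%:R * tau by rewrite ler_pM2r// ler_nat.
have len0 m : 0 <= Num.min (m.+1%:R * tau) r - Num.min (m%:R * tau) r.
  by rewrite subr_ge0 le_min ge_min mm/= ge_min lexx orbT.
have len1 m : Num.min (m.+1%:R * tau) r - Num.min (m%:R * tau) r <= tau.
  have e : m.+1%:R * tau = m%:R * tau + tau by rewrite -natr1; ring.
  rewrite e; have [h|h] := leP (m%:R * tau) r; last first.
    by rewrite min_r ?subrr// ltW// (lt_le_trans h)// lerDl ltW.
  by rewrite lerBlDl ge_min lexx.
apply: (@le_trans _ _ (\sum_(m < M0) tau *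
    (Num.min (m.+1%:R * tau) r - Num.min (m%:R * tau) r))).
  by apply: ler_sum => m _; rewrite expr2 ler_wpM2r.
rewrite -mulr_sumr ler_wpM2l ?(ltW tau0)//.
rewrite -(big_mkord xpredT (fun m => Num.min (m.+1%:R * tau) r - Num.min (m%:R * tau) r)).
rewrite telescope_sumr// mul0r (min_l r0) subr0 ge_min lexx orbT//.
Qed.

(** Discrete Gronwall inequality: the exponential factors of the steps multiply to one factor over
    the total time, and the forcing of each step is bounded by granting it that full factor. *)
Lemma grid_growth (E c : nat -> R) (lam h : R) K :
  0 <= lam -> 0 <= h -> (forall l, 0 <= c l) -> E 0%N = 0 ->
  (forall l, (l < K)%N -> E l.+1 <= expR (lam * h) * (E l + h * c l)) ->
  E K <= expR (lam * (K%:R * h)) * \sum_(l < K) h * c l.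
Proof.
move=> lam0 h0 c0 E0 step.
suff : forall k, (k <= K)%N -> E k <= expR (lam * (k%:R * h)) * \sum_(l < k) h * c l.
  by apply.
elim=> [_|k ih kK]; first by rewrite E0 big_ord0 mulr0.
apply: le_trans (step k kK) _.
have -> : lam * (k.+1%:R * h) = lam * h + lam * (k%:R * h) by rewrite -natr1; ring.
rewrite expRD -mulrA ler_pM2l ?expR_gt0// big_ord_recr/= mulrDr lerD ?ih ?(ltnW kK)//.
by rewrite ler_peMl ?mulr_ge0// -expR0 ler_expR !mulr_ge0.
Qed.

End Antiderivative.

(** * Pathwise comparison of the two systems through the total noise *)

Section Pathwise.
Context (R : realType) (d n p : nat) (b K : 'rV[R]_d -> 'rV[R]_d) (tau : R).
Local Notation N := (n * p)%N.
Hypotheses (p2 : (2 <= p)%N) (n1 : (1 <= n)%N) (tau_gt0 : 0 < tau).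
Context (Lb LK BK : R).
Hypotheses (hb : sqlipschitz Lb b) (hK : sqlipschitz LK K).
Hypotheses (Lb0 : 0 <= Lb) (LK0 : 0 <= LK).
Hypotheses (KB : forall x k, `|K x 0 k| <= BK) (BK0 : 0 <= BK).

Let N2 : (2 <= N)%N := particles_ge2 p2 n1.

Lemma noise_bound D (i : 'I_N) (q : 'I_N -> R) B : 0 <= B -> D \in divisions n p ->
  (forall j, `|q j| <= B) -> `|noise D i q| <= 2 * B.
Proof.
move=> B0 Ddiv qB.
have [pw0 pw1 _] := particle_weight_bounded R N2.
have [bw0 bw1 _] := batch_weight_division R p2 Ddiv.
rewrite (le_trans (ler_norm_sum _ _ _))//.
apply: (@le_trans _ _ (\sum_j (particle_weight R i j + batch_weight R p D i j) * B)).
  apply: ler_sum => j _; rewrite normrM ler_pM//.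
  by rewrite (le_trans (ler_normB _ _))// !ger0_norm.
by rewrite -mulr_suml ler_wpM2r// big_split/= -[2]/(1 + 1) lerD.
Qed.

Context (M0 : nat) (T : R) (D : nat -> {set {set 'I_N}}).
Hypotheses (T_lt : T < M0%:R * tau)
  (D_div : forall m, (m < M0)%N -> D m \in divisions n p).
Context (X V Y U : 'I_N -> R -> 'rV[R]_d)
  (H : 'I_N -> 'I_N -> 'I_d -> R -> R).
Hypotheses (XV : weighted_system b K tau (fun=> particle_weight R (N := N)) X V)
  (YU : weighted_system b K tau (fun m => batch_weight R p (D m)) Y U)
  (XY0 : forall i, X i 0 = Y i 0) (VU0 : forall i, V i 0 = U i 0).
Hypotheses (cH : forall i j k, continuous (H i j k))
  (dH : forall i j k t, 0 <= t -> rder (H i j k) t (K (X i t - X j t) 0 k)).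

Definition total_noise (i : 'I_N) (k : 'I_d) (r : R) : R :=
  \sum_(m < M0) noise (D m) i (fun j => increment tau (H i j k) m r).

Lemma total_noise0 i k : total_noise i k 0 = 0.
Proof.
apply: big1 => m _; apply: big1 => j _; rewrite /increment !min_r ?subrr ?mulr0//;
  by rewrite mulr_ge0// ltW.
Qed.

Lemma cont0_total_noise i k : cont0 (total_noise i k).
Proof.
apply: cont0_sum => m _; apply: cont0_sum => j _; apply: cont0M; first exact: cont0_cst.
exact/continuous_cont0/continuous_increment.
Qed.

Lemma rder_total_noise m i k r : m%:R * tau <= r -> r < m.+1%:R * tau -> r < T ->
  rder (total_noise i k) r
    (\sum_j (particle_weight R i j - batch_weight R p (D m) i j) * K (X i r - X j r) 0 k).
Proof.
move=> mr rm rT.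
have r0 : 0 <= r by rewrite (le_trans _ mr)// mulr_ge0// ltW.
have mM : (m < M0)%N.
  by rewrite -(ltr_nat R) -(ltr_pM2r tau_gt0) (le_lt_trans mr)// (lt_trans rT).
have := rder_sum (r := index_enum 'I_M0) (P := xpredT)
  (F := fun m' r => noise (D m') i (fun j => increment tau (H i j k) m' r))
  (L := fun m' => noise (D m') i (fun j => if m' == m :> nat then K (X i r - X j r) 0 k else 0)) (t := r).
rewrite (bigD1 (Ordinal mM))//= eqxx [X in _ + X]big1 ?addr0 => [|m']; last first.
  rewrite -val_eqE/= => /negbTE ->; apply: big1 => j _; exact: mulr0.
apply=> m' _; apply: rder_sum => j _; apply: rderZ.
by apply: rder_increment => //; exact: dH.
Qed.

Lemma total_noise_lipschitz i k r s : 0 <= r -> r <= s -> s <= T ->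
  `|total_noise i k s - total_noise i k r| <= 2 * BK * (s - r).
Proof.
move=> r0 rs sT; apply: rder_lipschitz => //; first exact: cont0_total_noise.
move=> t rt ts; have t0 := le_trans r0 rt.
have [m [mt tm]] := time_step tau_gt0 t0.
have tT := lt_le_trans ts sT.
exists (\sum_j (particle_weight R i j - batch_weight R p (D m) i j) * K (X i t - X j t) 0 k).
  apply: noise_bound => //; apply: D_div.
  by rewrite -(ltr_nat R) -(ltr_pM2r tau_gt0) (le_lt_trans mt)// (lt_trans tT).
exact: rder_total_noise.
Qed.

Let lam := 2 + (2 * Lb + 8 * 1 ^+ 2 * LK).

Definition noise_energy r : R := \sum_i \sum_k total_noise i k r ^+ 2.

(** The mesh [h = t / L] is unrelated to [tau]. Within a mesh interval the noise is compared with
    its value at the left end, so only its values at grid times enter; [noise_comparison] is applied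
    on each interval and [grid_growth] chains the results. The outer factors 2 come from adding the
    noise back to the velocity gap. *)
Lemma pathwise_gap (t : R) (L : nat) : (0 < L)%N -> 0 <= t -> t <= T ->
  \sum_i (sqnorm (X i t - Y i t) + sqnorm (V i t - U i t)) <=
  2 * (expR (lam * t) * \sum_(l < L) t / L%:R *
    (2 * noise_energy (l%:R * (t / L%:R)) + N%:R * (d%:R * (8 * (BK * (t / L%:R)) ^+ 2))))
  + 2 * noise_energy t.
Proof.
move=> L0 t0 tT; set h := t / L%:R.
have L0' : 0 < L%:R :> R by rewrite ltr0n.
have h0 : 0 <= h by rewrite divr_ge0// ltW.
have Lh : L%:R * h = t by rewrite /h mulrCA divff ?mulr1// gt_eqF.
pose mu i r : 'rV[R]_d := \row_k total_noise i k r.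
have muE r : \sum_i sqnorm (mu i r) = noise_energy r.
  by apply: eq_bigr => i _; apply: eq_bigr => k _; rewrite mxE.
pose E r := \sum_i (sqnorm (X i r - Y i r) + sqnorm (V i r - U i r - mu i r)).
have e0 r : 0 <= noise_energy r.
  by apply: sumr_ge0 => i _; apply: sumr_ge0 => k _; exact: sqr_ge0.
pose c l := 2 * noise_energy (l%:R * h) + N%:R * (d%:R * (8 * (BK * h) ^+ 2)).
have c0 l : 0 <= c l.
  by rewrite addr_ge0 ?mulr_ge0// sqr_ge0.
have EL : E t <= expR (lam * t) * \sum_(l < L) h * c l.
  rewrite -[in leLHS]Lh -[in leRHS]Lh.
  apply: (@grid_growth _ (fun l => E (l%:R * h))) => //.
  - by rewrite addr_ge0// addr_ge0// mulr_ge0// mulr_ge0// sqr_ge0.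
  - apply: big1 => i _; rewrite mul0r XY0 VU0 !subrr sub0r /sqnorm !big1 ?addr0// => k _.
      by rewrite !mxE total_noise0 oppr0 expr0n.
    by rewrite mxE expr0n.
  move=> l lL.
  have step : l.+1%:R * h = l%:R * h + h by rewrite -natr1; ring.
  have lh0 : 0 <= l%:R * h by rewrite mulr_ge0.
  have lht : l.+1%:R * h <= t by rewrite -Lh ler_wpM2r// ler_nat.
  have -> : expR (lam * h) * (E (l%:R * h) + h * c l) =
      expR (lam * (l.+1%:R * h - l%:R * h)) *
      (E (l%:R * h) + c l * (l.+1%:R * h - l%:R * h)).
    by rewrite step (addrC (l%:R * h)) addrK [c l * h]mulrC.
  apply: (@noise_comparison R d b K tau tau_gt0 Lb LK hb hK Lb0 LK0 _ 1
    (fun=> particle_weight R (N := N)) (fun m => batch_weight R p (D m))) => //.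
  - move=> m mlt; apply: batch_weight_division => //; apply: D_div.
    rewrite -(ltr_nat R) -(ltr_pM2r tau_gt0) (lt_trans mlt)//.
    exact: le_lt_trans (le_trans lht tT) T_lt.
  - move=> i k; rewrite (_ : (fun r => _) = total_noise i k).
      exact: cont0_total_noise.
    by apply/funext => r; rewrite mxE.
  - move=> m i k r mr rm lr rl.
    rewrite (_ : (fun r => _) = total_noise i k).
      apply: rder_total_noise => //.
      exact: lt_le_trans rl (le_trans lht tT).
    by apply/funext => r'; rewrite mxE.
  - by rewrite ler_wpM2r// ler_nat.
  move=> r lr rl; rewrite muE /c.
  (* The noise moves by at most [2 * BK * h] per coordinate within a mesh interval; its square,
     doubled by [sqrD_le], gives the 8. *)
  have -> : N%:R * (d%:R * (8 * (BK * h) ^+ 2)) =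
      \sum_(i < N) \sum_(k < d) 2 * (2 * BK * h) ^+ 2.
    rewrite !sumr_const !card_ord mulr_natl; congr (_ *+ _).
    by rewrite mulr_natl; congr (_ *+ _); ring.
  rewrite /noise_energy mulr_sumr -big_split/=; apply: ler_sum => i _.
  rewrite mulr_sumr -big_split/=; apply: ler_sum => k _.
  have rT : r <= T by rewrite (le_trans (ltW rl))// (le_trans lht).
  have := total_noise_lipschitz i k lh0 lr rT.
  set a := total_noise i k r; set a' := total_noise i k (l%:R * h) => aa'.
  have -> : a = a' + (a - a') by ring.
  apply: le_trans (sqrD_le _ _) _; rewrite lerD2l ler_wpM2l//.
  rewrite -[leLHS]real_normK ?num_real// lerXn2r ?nnegrE ?mulr_ge0//.
  apply: le_trans aa' _; rewrite ler_wpM2l ?mulr_ge0// lerBlDr addrC.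
  by move: rl; rewrite step => /ltW.
rewrite (le_trans (_ : _ <= 2 * E t + 2 * noise_energy t))//; last first.
  by rewrite lerD2r ler_wpM2l.
rewrite -muE /E !mulr_sumr -big_split/=; apply: ler_sum => i _.
have h1 : sqnorm (V i t - U i t) <= 2 * sqnorm (V i t - U i t - mu i t) + 2 * sqnorm (mu i t).
  rewrite /sqnorm !mulr_sumr -big_split/=; apply: ler_sum => k _.
  apply: le_trans (sqrD_le _ _); rewrite le_eqVlt; apply/orP; left; apply/eqP.
  by rewrite !mxE; ring.
have := sqnorm_ge0 (X i t - Y i t); lra.
Qed.

End Pathwise.

(** * Estimates in expectation *)

Lemma cont0_sqlipschitz (R : realType) (d : nat) (f : 'rV[R]_d -> 'rV[R]_d) (L : R)
    (x : R -> 'rV[R]_d) k : 0 <= L -> sqlipschitz L f ->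
  (forall l, cont0 (fun t => x t 0 l)) -> cont0 (fun t => f (x t) 0 k).
Proof.
move=> L0 fL cx t; pose y s := x (Num.max 0 s).
have L1 : 0 < L + 1 by rewrite ltr_wpDl.
have cg : (fun s => \sum_l (y t 0 l - y s 0 l) ^+ 2) s @[s --> t] -->
    \sum_l (y t 0 l - y t 0 l) ^+ 2.
  apply: cvg_big => [|l _]; first exact: add_continuous.
  have h : (fun s => y t 0 l - y s 0 l) s @[s --> t] --> y t 0 l - y t 0 l.
    by apply: cvgB; [exact: cvg_cst|exact: cx].
  exact: (cvgM h h).
rewrite [X in _ --> X]big1 in cg; last by move=> l _; rewrite subrr expr0n.
apply/cvgrPdist_lt => e e0.
have e1 : 0 < e ^+ 2 / (L + 1) by rewrite divr_gt0// exprn_gt0.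
move/cvgrPdist_lt : cg => /(_ _ e1); apply: filterS => s.
rewrite sub0r normrN ger0_norm; last by apply: sumr_ge0 => l _; exact: sqr_ge0.
rewrite ltr_pdivlMr// => hs.
rewrite -(@ltr_pXn2r _ 2) ?nnegrE//; last exact: ltW.
rewrite real_normK ?num_real//; apply: le_lt_trans hs.
apply: (@le_trans _ _ (sqnorm (f (y t) - f (y s)))).
  rewrite /sqnorm (bigD1 k)//= !mxE lerDl.
  by apply: sumr_ge0 => l _; exact: sqr_ge0.
apply: le_trans (fL _ _) _; rewrite mulrC.
have -> : sqnorm (y t - y s) = \sum_l (y t 0 l - y s 0 l) ^+ 2.
  by apply: eq_bigr => l _; rewrite !mxE.
rewrite ler_wpM2l ?lerDl//.
by apply: sumr_ge0 => l _; exact: sqr_ge0.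
Qed.

Lemma coord_sq_le (R : realType) (d : nat) (x : 'rV[R]_d) k : x 0 k ^+ 2 <= sqnorm x.
Proof.
rewrite /sqnorm (bigD1 k)//= lerDl.
by apply: sumr_ge0 => l _; exact: sqr_ge0.
Qed.

Lemma norm_le_of_sqr (R : realType) (x c r : R) : 0 <= c -> 0 <= r ->
  x ^+ 2 <= c * r ^+ 2 -> `|x| <= Num.sqrt c * r.
Proof.
move=> c0 r0 xc; rewrite -(@ler_pXn2r _ 2) ?nnegrE ?mulr_ge0 ?sqrtr_ge0//.
by rewrite real_normK ?num_real// exprMn sqr_sqrtr.
Qed.

Lemma dist_sqr_le (R : realType) (x y a B : R) :
  `|x - y| <= a -> `|x| <= B -> `|y| <= B -> `|x ^+ 2 - y ^+ 2| <= a * (2 * B).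
Proof.
move=> xy xB yB; rewrite subr_sqr normrM ler_pM//.
by rewrite (le_trans (ler_normD _ _))// mulr2n mulrDl mul1r lerD.
Qed.

Section Estimates.
Context (R : realType) (d : nat) (b K : 'rV[R]_d -> 'rV[R]_d).
Context (Lb LK Bb BK : R).
Hypotheses (hb : sqlipschitz Lb b) (hK : sqlipschitz LK K).
Hypotheses (Lb0 : 0 <= Lb) (LK0 : 0 <= LK).
Hypotheses (bB : forall x k, `|b x 0 k| <= Bb) (KB : forall x k, `|K x 0 k| <= BK).
Hypotheses (Bb0 : 0 <= Bb) (BK0 : 0 <= BK).
Context (mu0 : probability (phase R d) R) (T : R).
Hypothesis T_gt0 : 0 < T.
Context (p n : nat).
Hypotheses (p2 : (2 <= p)%N) (n1 : (1 <= n)%N).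
Local Notation N := (n * p)%N.
Context (tau : R).
Hypothesis tau_gt0 : 0 < tau.
Context (disp : measure_display) (Omega : measurableType disp)
        (P : probability Omega R).
Context (Z0 : 'I_N -> Omega -> phase R d) (xi : nat -> Omega -> {set {set 'I_N}}).
Hypotheses (Z0_measurable : forall i, measurable_fun setT (Z0 i))
  (Z0_law : forall i B, measurable B -> P (Z0 i @^-1` B) = mu0 B)
  (xi_uniform : forall m, uniform_division P (xi m))
  (independence : mutually_independent P (generated_events Z0 xi)).
Context (X V Y U : 'I_N -> R -> Omega -> 'rV[R]_d).
Hypotheses (init : forall i w, X i 0 w = (Z0 i w).1 /\ Y i 0 w = (Z0 i w).1 /\
                        V i 0 w = (Z0 i w).2 /\ U i 0 w = (Z0 i w).2)
  (XV : forall w, weighted_system b K tau (fun=> particle_weight R (N := N))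
          (fun i t => X i t w) (fun i t => V i t w))
  (YU : forall w, weighted_system b K tau (fun m => batch_weight R p (xi m w))
          (fun i t => Y i t w) (fun i t => U i t w)).

Let N2 : (2 <= N)%N := particles_ge2 p2 n1.
Let N0 : 0 < N%:R :> R. Proof. by rewrite ltr0n (leq_trans _ N2). Qed.

Let pw_bounded : bounded_weights N%:R (@particle_weight R N).
Proof.
apply: bounded_weights_mono (particle_weight_bounded R N2).
by rewrite ler1n (leq_trans _ N2).
Qed.

Let bw_bounded w m : bounded_weights N%:R (@batch_weight R N p (xi m w)).
Proof. exact: batch_weight_bounded. Qed.

(** The weight bound is [N] here because it must hold at every point of Omega, including those where
    [xi] is not a division. These constants serve only to find a radius of continuity; the final
    bound uses the rate with weight bound 1. *)
Let lamN := 2 + (2 * Lb + 8 * N%:R ^+ 2 * LK).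
Let Q := expR (lamN * T) * (N%:R * (2 * d%:R)).

Let Q0 : 0 <= Q.
Proof. by rewrite mulr_ge0 ?expR_ge0// !mulr_ge0. Qed.

Lemma initial_spread (x v : 'I_N -> Omega -> 'rV[R]_d) (s : 'I_N -> 'I_N) r w w' :
  0 <= r ->
  (forall i w, x i w = (Z0 i w).1) -> (forall i w, v i w = (Z0 i w).2) ->
  (forall i, close r (Z0 i w) (Z0 (s i) w')) ->
  \sum_i (sqnorm (x i w - x (s i) w') + sqnorm (v i w - v (s i) w')) <=
    N%:R * (2 * d%:R) * r ^+ 2.
Proof.
move=> r0 xZ vZ ww'.
have sq (a c : 'rV[R]_d) : (forall k, `|a 0 k - c 0 k| <= r) -> sqnorm (a - c) <= d%:R * r ^+ 2.
  move=> h; apply: (@le_trans _ _ (\sum_(k < d) r ^+ 2)); last first.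
    by rewrite sumr_const card_ord [leRHS]mulr_natl.
  apply: ler_sum => k _; rewrite !mxE -[leLHS]real_normK ?num_real//.
  by rewrite lerXn2r ?nnegrE.
apply: (@le_trans _ _ (\sum_(i < N) 2 * d%:R * r ^+ 2)); last first.
  by rewrite sumr_const card_ord -[leRHS]mulrA [leRHS]mulr_natl.
apply: ler_sum => i _; rewrite !xZ !vZ -mulrA mulr2n mulrDl !mul1r lerD//.
  by apply: sq => k; have [] := ww' i k.
by apply: sq => k; have [] := ww' i k.
Qed.

Let growth_le t x : 0 <= t -> t <= T -> 0 <= x -> expR (lamN * t) * x <= expR (lamN * T) * x.
Proof.
move=> t0 tT x0; rewrite ler_wpM2r// ler_expR ler_wpM2l//.
by rewrite addr_ge0// addr_ge0// mulr_ge0// mulr_ge0// sqr_ge0.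
Qed.

(** The full weights are invariant under relabelling, so the relabelled solution at [w'] solves the
    same system as the solution at [w]. The identity gives continuity in the data; a transposition
    gives exchangeability. *)
Lemma particle_spread (s : 'I_N -> 'I_N) r w w' t : bijective s -> 0 <= r ->
  0 <= t -> t <= T -> (forall i, close r (Z0 i w) (Z0 (s i) w')) ->
  \sum_i (sqnorm (X i t w - X (s i) t w') + sqnorm (V i t w - V (s i) t w')) <=
    Q * r ^+ 2.
Proof.
move=> sb r0 t0 tT ww'.
have i0 := @initial_spread (fun i => X i 0) (fun i => V i 0) s r w w' r0
  (fun i w => (init i w).1) (fun i w => (init i w).2.2.1) ww'.
have := @weighted_system_stability R d b K tau tau_gt0 Lb LK hb hK Lb0 LK0 _ N%:R
  (fun=> particle_weight R (N := N))
  (fun m i j => particle_weight R (s i) (s j)) _ _ _ _ t N0 _ _ (XV w)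
  (weighted_system_relabel sb (XV w')) t0.
have e i j : particle_weight R i j = particle_weight R (s i) (s j).
  by rewrite /particle_weight (inj_eq (bij_inj sb)).
move=> H; apply: le_trans (H _ _) _.
- move=> _; have [h1 h2 h3] := pw_bounded; split=> [i j|i|j].
  + exact: h1.
  + by under eq_bigr do rewrite -e; exact: h2.
  + by under eq_bigr do rewrite -e; exact: h3.
- by move=> m i j _; exact: e.
rewrite /= -[Q * _]mulrA; apply: (@le_trans _ _ (expR (lamN * T) *
  (\sum_i (sqnorm (X i 0 w - X (s i) 0 w') + sqnorm (V i 0 w - V (s i) 0 w'))))).
  apply: growth_le => //; apply: sumr_ge0 => i _.
  by rewrite addr_ge0// sqnorm_ge0.
by rewrite ler_wpM2l// expR_ge0.
Qed.

Let M0 := (Num.truncn (T / tau)).+1.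

Let T_lt : T < M0%:R * tau.
Proof.
have : 0 <= T / tau by rewrite divr_ge0// ltW.
by move=> /truncn_itv/andP[_]; rewrite ltr_pdivrMr.
Qed.

Let step_lt m t : t <= T -> m%:R * tau < t -> (m < M0)%N.
Proof.
move=> tT mt; rewrite -(ltr_nat R) -(ltr_pM2r tau_gt0).
exact: lt_trans mt (le_lt_trans tT T_lt).
Qed.

Lemma batch_spread (s : 'I_N -> 'I_N) r w w' t : bijective s -> 0 <= r ->
  0 <= t -> t <= T -> (forall i, close r (Z0 i w) (Z0 (s i) w')) ->
  (forall m i j, (m < M0)%N ->
     batch_weight R p (xi m w) i j = batch_weight R p (xi m w') (s i) (s j)) ->
  \sum_i (sqnorm (Y i t w - Y (s i) t w') + sqnorm (U i t w - U (s i) t w')) <=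
    Q * r ^+ 2.
Proof.
move=> sb r0 t0 tT ww' hA.
have i0 := @initial_spread (fun i => Y i 0) (fun i => U i 0) s r w w' r0
  (fun i w => (init i w).2.1) (fun i w => (init i w).2.2.2) ww'.
have := @weighted_system_stability R d b K tau tau_gt0 Lb LK hb hK Lb0 LK0 _ N%:R
  (fun m => batch_weight R p (xi m w))
  (fun m i j => batch_weight R p (xi m w') (s i) (s j)) _ _ _ _ t N0 _ _ (YU w)
  (weighted_system_relabel sb (YU w')) t0.
move=> H; apply: le_trans (H _ _) _.
- move=> m; have [h1 h2 h3] := bw_bounded w' m; split=> [i j|i|j].
  + exact: h1.
  + rewrite (_ : \sum_j _ = \sum_j batch_weight R p (xi m w') (s i) j)//.
    by rewrite [RHS](reindex s)//; exact: onW_bij.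
  + rewrite (_ : \sum_i _ = \sum_i batch_weight R p (xi m w') i (s j))//.
    by rewrite [RHS](reindex s)//; exact: onW_bij.
- by move=> m i j mt; apply: hA; exact: step_lt mt.
rewrite /= -[Q * _]mulrA; apply: (@le_trans _ _ (expR (lamN * T) *
  (\sum_i (sqnorm (Y i 0 w - Y (s i) 0 w') + sqnorm (U i 0 w - U (s i) 0 w'))))).
  apply: growth_le => //; apply: sumr_ge0 => i _.
  by rewrite addr_ge0// sqnorm_ge0.
by rewrite ler_wpM2l// expR_ge0.
Qed.

Definition gap j t w : R :=
  sqnorm (X j t w - Y j t w) + sqnorm (V j t w - U j t w).

Let Bgap := 2 * (Bb + N%:R * BK) * T + 2 * (Bb + N%:R * BK) * T * T.

Let gap_coord j t w k : 0 <= t -> t <= T ->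
  `|(V j t w - U j t w) 0 k| <= Bgap /\ `|(X j t w - Y j t w) 0 k| <= Bgap.
Proof.
move=> t0 tT.
have [i1 [i2 [i3 i4]]] := init j w.
have c0 : 0 <= 2 * (Bb + N%:R * BK) by rewrite mulr_ge0// addr_ge0// mulr_ge0.
have [] := @weighted_system_gap R d b K tau tau_gt0 Bb BK bB KB BK0 _ N%:R
  _ _ _ _ _ _ t T j k (fun=> pw_bounded) (bw_bounded w) (XV w) (YU w) _ _ t0 tT.
- by rewrite i1 i2.
- by rewrite i3 i4.
move=> h1 h2; split.
  by apply: le_trans h1 _; rewrite /Bgap lerDl; exact: mulr_ge0 (mulr_ge0 c0 (ltW T_gt0)) (ltW T_gt0).
by apply: le_trans h2 _; rewrite /Bgap lerDr; exact: mulr_ge0 c0 (ltW T_gt0).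
Qed.

Let gap_ge0 j t w : 0 <= gap j t w.
Proof. by rewrite addr_ge0// sqnorm_ge0. Qed.

Let gap_bound j t w : 0 <= t -> t <= T -> gap j t w <= d%:R * Bgap ^+ 2 + d%:R * Bgap ^+ 2.
Proof.
move=> t0 tT.
have sq (a : 'rV[R]_d) : (forall k, `|a 0 k| <= Bgap) -> sqnorm a <= d%:R * Bgap ^+ 2.
  move=> h; apply: (@le_trans _ _ (\sum_(k < d) Bgap ^+ 2)); last first.
    by rewrite sumr_const card_ord [leRHS]mulr_natl.
  apply: ler_sum => k _; rewrite -[leLHS]real_normK ?num_real//.
  by rewrite lerXn2r ?nnegrE// (le_trans _ (h k)).
by rewrite lerD//; apply: sq => k; have [] := gap_coord j w k t0 tT.
Qed.

(** Coordinates of the gaps are bounded by [Bgap], so a difference of their squares is at most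
    [2 * Bgap] times the difference of the coordinates, which the two spread estimates make linear
    in [r]. *)
Lemma gap_close (s : 'I_N -> 'I_N) r w w' t j : bijective s -> 0 <= r ->
  0 <= t -> t <= T -> (forall i, close r (Z0 i w) (Z0 (s i) w')) ->
  (forall m i j, (m < M0)%N ->
     batch_weight R p (xi m w) i j = batch_weight R p (xi m w') (s i) (s j)) ->
  `|gap j t w - gap (s j) t w'| <=
    (d%:R * (2 * (2 * Num.sqrt Q * (2 * Bgap)))) * r.
Proof.
move=> sb r0 t0 tT ww' hA.
have sx := particle_spread sb r0 t0 tT ww'.
have sy := batch_spread sb r0 t0 tT ww' hA.
have term (x v : 'I_N -> 'rV[R]_d) k : \sum_i (sqnorm (x i) + sqnorm (v i)) <= Q * r ^+ 2 ->
    `|x j 0 k| <= Num.sqrt Q * r /\ `|v j 0 k| <= Num.sqrt Q * r.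
  rewrite (bigD1 j)//= => h.
  have h0 : 0 <= \sum_(i < N | i != j) (sqnorm (x i) + sqnorm (v i)).
    by apply: sumr_ge0 => i _; rewrite addr_ge0// sqnorm_ge0.
  have x0 := sqnorm_ge0 (x j); have v0 := sqnorm_ge0 (v j).
  have xk := coord_sq_le (x j) k; have vk := coord_sq_le (v j) k.
  by split; apply: norm_le_of_sqr => //; lra.
have dist (x y x' y' : 'rV[R]_d) : (forall k, `|(x - x') 0 k| <= Num.sqrt Q * r) ->
    (forall k, `|(y - y') 0 k| <= Num.sqrt Q * r) ->
    (forall k, `|(x - y) 0 k| <= Bgap) -> (forall k, `|(x' - y') 0 k| <= Bgap) ->
    `|sqnorm (x - y) - sqnorm (x' - y')| <= d%:R * (2 * Num.sqrt Q * r * (2 * Bgap)).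
  move=> h1 h2 h3 h4; rewrite /sqnorm -sumrB (le_trans (ler_norm_sum _ _ _))//.
  apply: (@le_trans _ _ (\sum_(k < d) 2 * Num.sqrt Q * r * (2 * Bgap))); last first.
    by rewrite sumr_const card_ord [leRHS]mulr_natl.
  apply: ler_sum => k _; apply: dist_sqr_le => //.
  have -> : (x - y) 0 k - (x' - y') 0 k = (x - x') 0 k - (y - y') 0 k.
    by rewrite !mxE; ring.
  rewrite (le_trans (ler_normB _ _))// (le_trans (lerD (h1 k) (h2 k)))//.
  by rewrite le_eqVlt; apply/orP; left; apply/eqP; ring.
have d1 := dist (X j t w) (Y j t w) (X (s j) t w') (Y (s j) t w')
  (fun k => (term _ _ k sx).1) (fun k => (term _ _ k sy).1)
  (fun k => (gap_coord j w k t0 tT).2) (fun k => (gap_coord (s j) w' k t0 tT).2).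
have d2 := dist (V j t w) (U j t w) (V (s j) t w') (U (s j) t w')
  (fun k => (term _ _ k sx).2) (fun k => (term _ _ k sy).2)
  (fun k => (gap_coord j w k t0 tT).1) (fun k => (gap_coord (s j) w' k t0 tT).1).
rewrite /gap opprD addrACA (le_trans (ler_normD _ _))// (le_trans (lerD d1 d2))//.
by rewrite le_eqVlt; apply/orP; left; apply/eqP; ring.
Qed.

Let Cgap := d%:R * (2 * (2 * Num.sqrt Q * (2 * Bgap))).

Let Cgap0 : 0 <= Cgap.
Proof.
by rewrite !mulr_ge0 ?sqrtr_ge0// /Bgap addr_ge0// !mulr_ge0// ?addr_ge0 ?mulr_ge0// ltW.
Qed.

Let small (c e : R) : 0 <= c -> 0 < e -> exists2 r : R, 0 < r & c * r <= e.
Proof.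
move=> c0 e0; have c1 : 0 < c + 1 by rewrite ltr_wpDl.
exists (e / (c + 1)); first by rewrite divr_gt0.
by rewrite mulrCA ler_piMr ?(ltW e0)// ler_pdivrMr// mul1r lerDl.
Qed.

Let idb : bijective (id : 'I_N -> 'I_N).
Proof. by exists id. Qed.

Lemma gap_bounded_measurable j t : 0 <= t -> t <= T -> bounded_measurable (gap j t).
Proof.
move=> t0 tT; split; last first.
  by exists (d%:R * Bgap ^+ 2 + d%:R * Bgap ^+ 2) => w; rewrite ger0_norm// gap_bound.
apply: (near_data_measurable Z0_measurable xi_uniform (M := M0)) => e e0.
have [r r0 hr] := small Cgap0 e0; exists r => // w w' ww' xiE.
apply: le_trans (gap_close j idb (ltW r0) t0 tT ww' _) hr.
by move=> m i k mM; rewrite xiE.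
Qed.

(** [xi] takes values among all families of sets; this is the event that every value governing the
    dynamics up to [T] is a genuine division. *)
Definition good w := all (fun m => xi m w \in divisions n p) (iota 0 M0).

Let good_measurable : measurable [set w | good w].
Proof.
rewrite (_ : [set w | _] = \bigcap_(m in [set` iota 0 M0])
  \bigcup_(D in [set D | D \in divisions n p]) (xi m @^-1` [set D])).
  apply: fin_bigcap_measurable => // m _; apply: fin_bigcup_measurable => //.
  by move=> D _; exact: (xi_measurable xi_uniform).
apply/seteqP; split=> w /=; first by move=> /allP h m /= /h hm; exists (xi m w).
by move=> h; apply/allP => m /h[D /= DD ->].
Qed.

Let bgood : bounded_measurable (fun w => (good w)%:R : R).
Proof. exact: bounded_measurable_bool. Qed.

Let bxi m D : bounded_measurable (fun w => (xi m w == D)%:R : R).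
Proof.
apply: bounded_measurable_bool.
have := xi_measurable xi_uniform m D; congr measurable.
by apply/seteqP; split=> w /= /eqP.
Qed.

(** The two integrands differ by at most a constant times the sum of the indicators of the bad
    values of each [xi m], a finite sum of events of mass zero. *)
Lemma Ex_good f : bounded_measurable f -> Ex P f = Ex P (fun w => (good w)%:R * f w).
Proof.
move=> bf; have [_ [B fB]] := bf.
have bgf := bounded_measurableM bgood bf.
have bs : bounded_measurable (fun w => \sum_(m < M0) \sum_(D | D \notin divisions n p)
    (xi m w == D)%:R : R).
  by apply: bounded_measurable_sum => m; exact: bounded_measurable_sum.
have s0 : Ex P (fun w => \sum_(m < M0) \sum_(D | D \notin divisions n p)
    (xi m w == D)%:R) = 0.
  rewrite Ex_sum; last by move=> m; exact: bounded_measurable_sum.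
  apply: big1 => m _; rewrite Ex_sum//; apply: big1 => D Dn.
  have E : [set w | xi m w == D] = xi m @^-1` [set D].
    by apply/seteqP; split=> w /= /eqP.
  rewrite Ex_bool E; last exact: (xi_measurable xi_uniform).
  by rewrite (xi_mass xi_uniform) /division_mass (negbTE Dn) mul0r.
apply/eqP; rewrite -subr_eq0 -normr_le0 -ExB//.
have -> : 0 = Ex P (fun w => `|B| * \sum_(m < M0) \sum_(D | D \notin divisions n p)
    (xi m w == D)%:R) by rewrite ExZ// s0 mulr0.
apply: Ex_norm_le; first exact: bounded_measurableB.
  by apply: bounded_measurableM => //; exact: bounded_measurable_cst.
move=> w; case: (boolP (good w)) => [_|].
  rewrite mul1r subrr normr0 mulr_ge0// sumr_ge0// => m _.
  by apply: sumr_ge0.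
move=> /allPn[m]; rewrite mem_iota add0n => mM Dn; rewrite mul0r subr0.
apply: (@le_trans _ _ (`|B| * 1)).
  by rewrite mulr1 (le_trans (fB w))// ler_norm.
rewrite ler_wpM2l// (bigD1 (Ordinal mM))//= (bigD1 (xi m w))//= eqxx -addrA lerDl.
by rewrite addr_ge0 ?sumr_ge0// => ? _; apply: sumr_ge0.
Qed.

(** Exchanging [i] and [j] in the initial data and in the divisions preserves the law. Batch weights
    are known to follow the relabelling for genuine divisions, so both expectations are restricted
    to [good], itself invariant under relabelling. A transposition is its own inverse, which aligns
    the two directions of relabelling. *)
Lemma Ex_gap_exchange i j t : 0 <= t -> t <= T -> Ex P (gap i t) = Ex P (gap j t).
Proof.
move=> t0 tT; rewrite Ex_good; last exact: gap_bounded_measurable.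
rewrite [RHS]Ex_good; last exact: gap_bounded_measurable.
pose s := tperm i j.
have sK k : s (s k) = k by rewrite tpermK.
have sb : bijective s by exists s.
have bg k := bounded_measurableM bgood (gap_bounded_measurable k t0 tT).
apply: (Ex_exchange Z0_measurable Z0_law xi_uniform independence (s := s) (M := M0)) => // e e0.
have [r r0 hr] := small Cgap0 e0; exists r => // w w'.
have goodE : (forall m, (m < M0)%N -> xi m w = xi m w') -> good w = good w'.
  by move=> h; apply: eq_in_all => m; rewrite mem_iota add0n => mM; rewrite h.
have same k : (forall i, close r (Z0 i w) (Z0 i w')) ->
    (forall m, (m < M0)%N -> xi m w = xi m w') ->
    `|(good w)%:R * gap k t w - (good w')%:R * gap k t w'| <= e.
  move=> ww' xiE; rewrite (goodE xiE) -mulrBr normrM.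
  apply: (@le_trans _ _ (1 * `|gap k t w - gap k t w'|)).
    by rewrite ler_wpM2r//; case: good; rewrite ?normr1 ?normr0.
  rewrite mul1r; apply: le_trans (gap_close k idb (ltW r0) t0 tT ww' _) hr.
  by move=> m a c mM; rewrite xiE.
split; [|exact: same|exact: same].
move=> ww' xiE.
have -> : good w = good w'.
  by apply: eq_in_all => m; rewrite mem_iota add0n => mM; rewrite xiE// relabel_divisionE.
case: (boolP (good w')) => [/allP gw|_]; last by rewrite !mul0r subrr normr0 ltW.
rewrite !mul1r -[j](tpermL i j).
apply: le_trans (gap_close i sb (ltW r0) t0 tT ww' _) hr.
move=> m a c mM; have Ddiv : xi m w' \in divisions n p by apply: gw; rewrite mem_iota.
have := same_batch_relabel s (s a) (s c) Ddiv; rewrite !sK => h.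
by rewrite xiE// /batch_weight -!/(same_batch _ _ _) h.
Qed.

(** * Second moment of the noise and bound on the mean gap *)

Section Noise.
Context (H : Omega -> 'I_N -> 'I_N -> 'I_d -> R -> R).
Hypotheses (cH : forall w i j k, continuous (H w i j k))
  (dH : forall w i j k t, 0 <= t -> rder (H w i j k) t (K (X i t w - X j t w) 0 k)).

Let CK := Num.sqrt (LK * (4 * Q)).

Lemma force_close r w w' t i j k : 0 <= r -> 0 <= t -> t <= T ->
  (forall i, close r (Z0 i w) (Z0 i w')) ->
  `|K (X i t w - X j t w) 0 k - K (X i t w' - X j t w') 0 k| <= CK * r.
Proof.
move=> r0 t0 tT ww'.
have sx := particle_spread idb r0 t0 tT ww'.
apply: norm_le_of_sqr => //; first by rewrite !mulr_ge0.
have sq l : sqnorm (X l t w - X l t w') <= Q * r ^+ 2.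
  apply: le_trans sx; rewrite (bigD1 l)//= -addrA lerDl addr_ge0 ?sqnorm_ge0//.
  by apply: sumr_ge0 => q _; rewrite addr_ge0// sqnorm_ge0.
have -> : K (X i t w - X j t w) 0 k - K (X i t w' - X j t w') 0 k =
    (K (X i t w - X j t w) - K (X i t w' - X j t w')) 0 k by rewrite !mxE.
apply: le_trans (coord_sq_le _ _) _; apply: le_trans (hK _ _) _.
rewrite -[leRHS]mulrA -[4 * Q * _]mulrA ler_wpM2l//.
have -> : X i t w - X j t w - (X i t w' - X j t w') =
    (X i t w - X i t w') - (X j t w - X j t w').
  by apply/rowP => l; rewrite !mxE; ring.
have := sqnormB_le (X i t w - X i t w') (X j t w - X j t w').
have := sq i; have := sq j; lra.
Qed.

Let length m t := Num.min (m.+1%:R * tau) t - Num.min (m%:R * tau) t.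

Let length_ge0 m t : 0 <= length m t.
Proof.
have mm : m%:R * tau <= m.+1%:R * tau by rewrite ler_pM2r// ler_nat.
by rewrite subr_ge0 le_min ge_min mm/= ge_min lexx orbT.
Qed.

Lemma increment_le m i j k t w : 0 <= t ->
  `|increment tau (H w i j k) m t| <= BK * length m t.
Proof.
move=> t0; apply: (@increment_bound _ _ _ (fun s => K (X i s w - X j s w) 0 k)) => //.
by move=> s s0; exact: dH.
Qed.

(** [H w] is chosen separately at each [w], up to an additive constant that increments cancel. The
    difference of the increments at two points is an increment of a difference of antiderivatives,
    whose derivative is a difference of forces, at most [CK * r]. *)
Lemma adapted_increment m i j k t : 0 <= t -> t <= T ->
  adapted Z0 (fun w => increment tau (H w i j k) m t).
Proof.
move=> t0 tT; split; first by exists (BK * length m t) => w; exact: increment_le.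
move=> e e0.
have cl0 : 0 <= CK * length m t by rewrite mulr_ge0// sqrtr_ge0.
have [r r0 hr] := small cl0 e0; exists r => // w w' ww'.
apply: le_trans hr; rewrite mulrAC.
have -> : increment tau (H w i j k) m t - increment tau (H w' i j k) m t =
    increment tau (fun s => H w i j k s - H w' i j k s) m t.
  by rewrite /increment; ring.
apply: (@increment_bound _ _ _ (fun s => K (X i s w - X j s w) 0 k - K (X i s w' - X j s w') 0 k)) => //.
- by move=> s; apply: cvgB; exact: cH.
- by move=> s s0; apply: rderB; exact: dH.
- move=> s s0 st; apply: force_close => //; first exact: ltW.
  exact: le_trans (ltW st) tT.
Qed.

Let energy t w := noise_energy tau M0 (fun m => xi m w) (H w) t.

Let btotal_noise i k t : 0 <= t -> t <= T ->
  bounded_measurable (fun w => total_noise tau M0 (fun m => xi m w) (H w) i k t).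
Proof.
move=> t0 tT; apply: bounded_measurable_sum => m.
apply: (bounded_measurable_noise Z0_measurable xi_uniform m i
  (G := fun j w => increment tau (H w i j k) m t)) => j.
exact: adapted_increment.
Qed.

Let benergy t : 0 <= t -> t <= T -> bounded_measurable (energy t).
Proof.
move=> t0 tT; apply: bounded_measurable_sum => i; apply: bounded_measurable_sum => k.
by apply: bounded_measurableM; exact: btotal_noise.
Qed.

Let p1 : 0 < p%:R - 1 :> R := natrB1_gt0 R p2.
Let eps := tau / (p%:R - 1).

(** [total_noise_sqr] applies with [A m = BK * length m t], and the squared lengths add up to at
    most [tau * t]; division by [p - 1] produces [eps]. *)
Lemma Ex_noise_energy t : 0 <= t -> t <= T ->
  Ex P (energy t) <= N%:R * (d%:R * (BK ^+ 2 * T * eps)).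
Proof.
move=> t0 tT.
have ba i k := btotal_noise i k t0 tT.
have ba2 i k := bounded_measurableM (ba i k) (ba i k).
rewrite Ex_sum; last by move=> i; apply: bounded_measurable_sum => k; exact: ba2.
apply: (@le_trans _ _ (\sum_(i < N) \sum_(k < d) BK ^+ 2 * T * eps)); last first.
  by rewrite !sumr_const !card_ord [leRHS]mulr_natl [X in _ <= X *+ _]mulr_natl.
apply: ler_sum => i _; rewrite Ex_sum; last by move=> k; exact: ba2.
apply: ler_sum => k _.
apply: le_trans (@total_noise_sqr R d n p mu0 disp Omega P Z0 xi Z0_measurable
  Z0_law xi_uniform independence p2 n1 M0 i (fun m j w => increment tau (H w i j k) m t)
  (fun m => BK * length m t) _ _) _.
- by move=> m j; exact: adapted_increment.
- by move=> m j w; exact: increment_le.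
rewrite /eps mulrA ler_pM2r ?invr_gt0//.
under eq_bigr do rewrite exprMn.
rewrite -mulr_sumr -mulrA ler_wpM2l ?sqr_ge0//.
apply: le_trans (sum_increment_length M0 tau_gt0 t0) _.
by rewrite mulrC ler_wpM2r// ltW.
Qed.

Let lam := 2 + (2 * Lb + 8 * 1 ^+ 2 * LK).

(** By exchangeability [N] times the mean gap of one particle is the mean of the total gap, which
    the pathwise bound controls on [good]. Both the noise energy and the mesh error are proportional
    to [N], so [N] cancels. *)
Lemma Ex_gap_le i t : 0 <= t -> t <= T ->
  Ex P (gap i t) <=
    d%:R * BK ^+ 2 * (2 * (expR (lam * T) * (T * (2 * T + 1))) + 2 * T) * eps.
Proof.
move=> t0 tT.
have eps0 : 0 < eps by rewrite divr_gt0.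
have lam0 : 0 <= lam by rewrite addr_ge0// addr_ge0// mulr_ge0// mulr_ge0// sqr_ge0.
(* Taking [L] above [x] and at least 1 gives [L ^+ 2 >= x], hence [8 * (t / L) ^+ 2 <= eps]: the
   mesh error has the size of the noise. *)
pose x := 8 * T ^+ 2 / eps.
have x0 : 0 <= x by rewrite /x divr_ge0 ?(ltW eps0)// mulr_ge0// sqr_ge0.
pose L := (Num.truncn x).+1.
have xL : x < L%:R by have /truncn_itv/andP[] := x0.
have L1 : 1 <= L%:R :> R by rewrite ler1n.
have L0 : 0 < L%:R :> R by rewrite ltr0n.
have hL : 8 * (t / L%:R) ^+ 2 <= eps.
  rewrite exprMn exprVn mulrA ler_pdivrMr ?exprn_gt0//.
  apply: (@le_trans _ _ (8 * T ^+ 2)).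
    by rewrite ler_wpM2l// lerXn2r// nnegrE// ltW.
  move: xL; rewrite /x ltr_pdivrMr// => /ltW/le_trans; apply.
  by rewrite [leRHS]mulrC expr2 ler_wpM2r ?(ltW eps0)// ler_pMl.
have h0 : 0 <= t / L%:R by rewrite divr_ge0.
pose c := N%:R * (d%:R * (8 * (BK * (t / L%:R)) ^+ 2)).
pose rhs w := 2 * (expR (lam * t) * \sum_(l < L) t / L%:R *
    (2 * energy (l%:R * (t / L%:R)) w + c)) + 2 * energy t w.
have grid l : (l < L)%N -> 0 <= l%:R * (t / L%:R) /\ l%:R * (t / L%:R) <= T.
  move=> lL; split; first by rewrite mulr_ge0.
  apply: le_trans tT; rewrite mulrCA -[leRHS]mulr1 ler_wpM2l// ler_pdivrMr// mul1r.
  by rewrite ler_nat ltnW.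
have e0 s w : 0 <= energy s w.
  by apply: sumr_ge0 => a _; apply: sumr_ge0 => k _; exact: sqr_ge0.
have c0 : 0 <= c by rewrite !mulr_ge0// sqr_ge0.
have bstep (l : 'I_L) : bounded_measurable (fun w => t / L%:R *
    (2 * energy (l%:R * (t / L%:R)) w + c)).
  have [g0 gT] := grid l (ltn_ord l).
  apply: bounded_measurableM; first exact: bounded_measurable_cst.
  apply: bounded_measurableD; last exact: bounded_measurable_cst.
  apply: bounded_measurableM; first exact: bounded_measurable_cst.
  exact: benergy.
have bsum : bounded_measurable (fun w => \sum_(l < L) t / L%:R *
    (2 * energy (l%:R * (t / L%:R)) w + c)) by exact: bounded_measurable_sum.
have brhs1 : bounded_measurable (fun w => expR (lam * t) * \sum_(l < L) t / L%:R *
    (2 * energy (l%:R * (t / L%:R)) w + c)).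
  by apply: bounded_measurableM => //; exact: bounded_measurable_cst.
have brhs2 : bounded_measurable (fun w => 2 * (expR (lam * t) * \sum_(l < L) t / L%:R *
    (2 * energy (l%:R * (t / L%:R)) w + c))).
  by apply: bounded_measurableM => //; exact: bounded_measurable_cst.
have ben := benergy t0 tT.
have be2 : bounded_measurable (fun w => 2 * energy t w).
  by apply: bounded_measurableM => //; exact: bounded_measurable_cst.
have brhs : bounded_measurable rhs by exact: bounded_measurableD.
have bgap j := gap_bounded_measurable j t0 tT.
have bsg : bounded_measurable (fun w => \sum_j gap j t w) by exact: bounded_measurable_sum.
have sumE : N%:R * Ex P (gap i t) = Ex P (fun w => (good w)%:R * \sum_j gap j t w).
  rewrite -Ex_good// Ex_sum// (eq_bigr (fun=> Ex P (gap i t))).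
    by rewrite sumr_const card_ord mulr_natl.
  by move=> j _; exact: Ex_gap_exchange.
have step1 : N%:R * Ex P (gap i t) <= Ex P rhs.
  rewrite sumE; apply: le_Ex => //; first exact: bounded_measurableM.
  move=> w; case: (boolP (good w)) => [/allP gw|_]; last first.
    rewrite mul0r addr_ge0 ?mulr_ge0 ?expR_ge0// sumr_ge0// => l _.
    by rewrite mulr_ge0// addr_ge0// mulr_ge0.
  rewrite mul1r.
  apply: (@pathwise_gap R d n p b K tau p2 n1 tau_gt0 Lb LK BK hb hK Lb0 LK0
    KB BK0 M0 T (fun m => xi m w) T_lt _ (fun i t => X i t w) (fun i t => V i t w)
    (fun i t => Y i t w) (fun i t => U i t w) (H w) (XV w) (YU w) _ _ (@cH w) (@dH w) t L) => //.
  - by move=> m mM; apply: gw; rewrite mem_iota.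
  - by move=> j; have [-> [-> _]] := init j w.
  - by move=> j; have [_ [_ [-> ->]]] := init j w.
pose e := BK ^+ 2 * T * eps.
have cle : c <= N%:R * (d%:R * (BK ^+ 2 * eps)).
  rewrite /c ler_wpM2l ?ler0n// ler_wpM2l ?ler0n// exprMn mulrCA ler_wpM2l ?sqr_ge0//.
have step2 : Ex P rhs <= 2 * (expR (lam * t) * \sum_(l < L) t / L%:R *
    (2 * (N%:R * (d%:R * e)) + c)) + 2 * (N%:R * (d%:R * e)).
  rewrite /rhs ExD// !ExZ// lerD ?ler_wpM2l ?expR_ge0 ?Ex_noise_energy//.
  rewrite Ex_sum//; apply: ler_sum => l _.
  have [g0 gT] := grid l (ltn_ord l).
  have bel := benergy g0 gT.
  have be2l : bounded_measurable (fun w => 2 * energy (l%:R * (t / L%:R)) w).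
    by apply: bounded_measurableM => //; exact: bounded_measurable_cst.
  have bc : bounded_measurable (fun _ : Omega => c) by exact: bounded_measurable_cst.
  rewrite ExZ; last exact: bounded_measurableD.
  rewrite ExD// ExZ// Ex_cst ler_wpM2l// lerD2r ler_wpM2l//.
  exact: Ex_noise_energy.
rewrite -(ler_pM2l N0); apply: le_trans step1 (le_trans step2 _).
have sumL y : \sum_(l < L) t / L%:R * y = t * y.
  by rewrite sumr_const card_ord -[LHS]mulr_natl mulrA mulrCA divff ?gt_eqF// mulr1.
rewrite sumL.
have e_ge0 : 0 <= e by rewrite mulr_ge0 ?(ltW eps0)// mulr_ge0 ?sqr_ge0// ltW.
have k1 : 2 * (N%:R * (d%:R * e)) + c <= N%:R * (d%:R * (BK ^+ 2 * eps)) * (2 * T + 1).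
  have -> : N%:R * (d%:R * (BK ^+ 2 * eps)) * (2 * T + 1) =
    2 * (N%:R * (d%:R * e)) + N%:R * (d%:R * (BK ^+ 2 * eps)) by rewrite /e; ring.
  by rewrite lerD2l.
have k10 : 0 <= 2 * (N%:R * (d%:R * e)) + c.
  by rewrite addr_ge0// mulr_ge0// mulr_ge0 ?ler0n// mulr_ge0 ?ler0n.
have k2 : expR (lam * t) * (t * (2 * (N%:R * (d%:R * e)) + c)) <=
    expR (lam * T) * (T * (N%:R * (d%:R * (BK ^+ 2 * eps)) * (2 * T + 1))).
  apply: ler_pM; rewrite ?expR_ge0// ?mulr_ge0//.
    by rewrite ler_expR ler_wpM2l.
  exact: ler_pM.
have -> : N%:R * (d%:R * BK ^+ 2 * (2 * (expR (lam * T) * (T * (2 * T + 1))) + 2 * T) * eps) =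
    2 * (expR (lam * T) * (T * (N%:R * (d%:R * (BK ^+ 2 * eps)) * (2 * T + 1)))) +
    2 * (N%:R * (d%:R * e)) by rewrite /e; ring.
by rewrite lerD2r ler_wpM2l.
Qed.

End Noise.
End Estimates.

(** * Mean-square error bound, uniform in time *)

Theorem theoremA1 (R : realType) (d : nat) (b K : 'rV[R]_d -> 'rV[R]_d)
    (b_C1 : C1 b)
    (b_bounded : [bounded b x | x in setT])
    (Db_bounded : [bounded jacobian b x | x in setT])
    (K_bounded : [bounded K x | x in setT])
    (K_lipschitz : [lipschitz K x | x in setT])
    (mu0 : probability (phase R d) R) (T : R) (T_gt0 : 0 < T) :
  exists C : R, 0 < C /\
  forall (p n : nat) (p_ge2 : (2 <= p)%N) (n_ge1 : (1 <= n)%N)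
    (tau : R) (tau_gt0 : 0 < tau)
    (disp : measure_display) (Omega : measurableType disp)
    (P : probability Omega R)
    (Z0 : 'I_(n * p) -> Omega -> phase R d)
    (xi : nat -> Omega -> {set {set 'I_(n * p)}})
    (Z0_measurable : forall i, measurable_fun setT (Z0 i))
    (Z0_law : forall i B, measurable B -> P (Z0 i @^-1` B) = mu0 B)
    (xi_uniform : forall m, uniform_division P (xi m))
    (independence : mutually_independent P (generated_events Z0 xi))
    (X V Xt U : 'I_(n * p) -> R -> Omega -> 'rV[R]_d)
    (init : forall i w, X i 0 w = (Z0 i w).1 /\ Xt i 0 w = (Z0 i w).1 /\
                        V i 0 w = (Z0 i w).2 /\ U i 0 w = (Z0 i w).2)
    (XV_solution : forall w,
      particle_system b K (fun i t => X i t w) (fun i t => V i t w))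
    (XtU_rbm1 : forall w,
      rbm1 b K p tau (fun m => xi m w)
        (fun i t => Xt i t w) (fun i t => U i t w))
    (i : 'I_(n * p)),
  let gap j t w :=
    sqnorm (X j t w - Xt j t w) + sqnorm (V j t w - U j t w) in
  let mean_gap t w := ((n * p)%:R)^-1 * \sum_(j < n * p) gap j t w in
  ereal_sup [set ('E_P[mean_gap t] `^ 2^-1)%E | t in `[0, T]]
    = ereal_sup [set ('E_P[gap i t] `^ 2^-1)%E | t in `[0, T]] /\
  (ereal_sup [set 'E_P[gap i t] `^ 2^-1 | t in `[0%R, T]]
    <= (C * Num.sqrt (tau / (p%:R - 1)))%:E)%E.
Proof.
have [Bb Bb0 bB] := bounded_coord b_bounded.
have [BK BK0 KB] := bounded_coord K_bounded.
have [Lb Lb0 hb] := C1_sqlipschitz b_C1 Db_bounded.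
have [LK LK0 hK] := lipschitz_on_sqlipschitz K_lipschitz.
pose lam := 2 + (2 * Lb + 8 * 1 ^+ 2 * LK).
(* The constant of [Ex_gap_le], plus 1 so that it is positive in every dimension, 0 included. *)
pose C2 := d%:R * BK ^+ 2 * (2 * (expR (lam * T) * (T * (2 * T + 1))) + 2 * T) + 1.
have T0 := ltW T_gt0.
have C2_gt0 : 0 < C2.
  rewrite ltr_wpDl//; apply: mulr_ge0; first by rewrite mulr_ge0 ?sqr_ge0 ?ler0n.
  apply: addr_ge0; last by rewrite mulr_ge0.
  by rewrite mulr_ge0// mulr_ge0 ?expR_ge0// mulr_ge0// addr_ge0// mulr_ge0.
exists (Num.sqrt C2); split; first by rewrite sqrtr_gt0.
move=> p n p2 n1 tau tau0 disp Omega P Z0 xi mZ0 lawZ0 xiu indep X V Y U init hXV hYU i.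
have XV w := particle_system_weighted tau0 (hXV w).
have YU w := rbm1_weighted tau0 (hYU w).
(* Antiderivatives in time of all pair forces, picked path by path by choice; no measurability in
   [w] is asked of them. *)
have /choice[H hH] : forall q : Omega * 'I_(n * p) * 'I_(n * p) * 'I_d,
    exists h : R -> R, continuous h /\ forall t, 0 <= t ->
      rder h t (K (X q.1.1.2 t q.1.1.1 - X q.1.2 t q.1.1.1) 0 q.2).
  move=> [[[w j] l] k] /=.
  have [|h ch dh] := @antiderivative R (fun t => K (X j t w - X l t w) 0 k); last by exists h.
  apply: (cont0_sqlipschitz (ltW LK0) hK) => m.
  rewrite (_ : (fun t => _) = fun t => X j t w 0 m - X l t w 0 m).
    by apply: cont0B; exact: ((XV w).1 _ _).1.
  by apply/funext => t; rewrite !mxE.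
pose eps := tau / (p%:R - 1).
have p1 := natrB1_gt0 R p2.
have eps0 : 0 < eps by rewrite divr_gt0.
have bg j t (t0 : 0 <= t) (tT : t <= T) : bounded_measurable (gap X V Y U j t) :=
  gap_bounded_measurable hb hK (ltW Lb0) (ltW LK0) bB KB (ltW Bb0) (ltW BK0) T_gt0
    p2 n1 tau0 mZ0 xiu init XV YU j t0 tT.
have exch j t (t0 : 0 <= t) (tT : t <= T) :
    Ex P (gap X V Y U i t) = Ex P (gap X V Y U j t) :=
  Ex_gap_exchange hb hK (ltW Lb0) (ltW LK0) bB KB (ltW Bb0) (ltW BK0) T_gt0
    p2 n1 tau0 mZ0 lawZ0 xiu indep init XV YU i j t0 tT.
have bound t (t0 : 0 <= t) (tT : t <= T) : Ex P (gap X V Y U i t) <= C2 * eps.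
  have cH w j l k : continuous (H (w, j, l, k)) by case: (hH (w, j, l, k)).
  have dH w j l k s : 0 <= s -> rder (H (w, j, l, k)) s (K (X j s w - X l s w) 0 k).
    by case: (hH (w, j, l, k)) => _; apply.
  apply: le_trans (Ex_gap_le hb hK (ltW Lb0) (ltW LK0) bB KB (ltW Bb0) (ltW BK0) T_gt0
    p2 n1 tau0 mZ0 lawZ0 xiu indep init XV YU
    (H := fun w j l k => H (w, j, l, k)) cH dH i t0 tT) _.
  by rewrite ler_wpM2r ?(ltW eps0)// lerDl.
move=> gap0 mean_gap.
have EgapE t : 0 <= t -> t <= T -> ('E_P[gap0 i t] = (Ex P (gap X V Y U i t))%:E)%E.
  by move=> t0 tT; exact/expectationE/bg.
have EmeanE t : 0 <= t -> t <= T -> ('E_P[mean_gap t] = (Ex P (gap X V Y U i t))%:E)%E.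
  move=> t0 tT.
  have bs : bounded_measurable (fun w => \sum_j gap X V Y U j t w).
    by apply: bounded_measurable_sum => j; exact: bg.
  have N0 : (n * p)%:R != 0 :> R.
    by rewrite pnatr_eq0 -lt0n (leq_trans _ (particles_ge2 p2 n1)).
  rewrite (@expectationE _ _ _ P (fun w => (n * p)%:R^-1 * \sum_j gap X V Y U j t w)).
    rewrite ExZ// Ex_sum => [|j]; last exact: bg.
    rewrite (eq_bigr (fun=> Ex P (gap X V Y U i t))); last by move=> j _; rewrite -exch.
    by rewrite sumr_const card_ord -[X in _ * X]mulr_natl mulKf.
  by apply: bounded_measurableM => //; exact: bounded_measurable_cst.
split.
  congr ereal_sup; apply/seteqP; split=> y [t]; rewrite /= in_itv/= => /andP[t0 tT] <-;
    exists t; rewrite /= ?in_itv/= ?t0//.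
    by rewrite EgapE// EmeanE.
  by rewrite EgapE// EmeanE.
apply: ge_ereal_sup => y [t]; rewrite /= in_itv/= => /andP[t0 tT] <-.
rewrite EgapE// poweR_EFin lee_fin powR12_sqrt; last first.
  by apply: Rintegral_ge0 => w _; rewrite addr_ge0// sqnorm_ge0.
by rewrite -sqrtrM ?(ltW C2_gt0)// ler_wsqrtr// bound.
Qed.
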